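(* Let $\theta>0$, let $X=[0,1]$ and $\nu=\theta\lambda$ where $\lambda$ is Lebesgue measure on $[0,1]$, and let $\mathcal{M}$ be the set of non-negative measurable functions $a$ on $[0,1]$ with $\int_0^1|\log a(s)|\,ds<\infty$. 1) The Poisson--Dirichlet distribution $\operatorname{PD}(\theta)$ is quasi-invariant under the Markovian operator $S_a$ for all $a\in\mathcal{M}$, and $$\frac{dS_a\operatorname{PD}(\theta)}{d\operatorname{PD}(\theta)}(y)=\exp\left(-\theta\int_0^1\log a(s)\,ds\right)\cdot\int_0^\infty\frac{\sigma^{\theta-1}}{\Gamma(\theta)}\left(\prod_{i=1}^\infty L_{1/a}(\sigma y_i)\right)d\sigma,$$ where $L_{1/a}(t)=\int_0^1 e^{-t/a(s)}\,ds$ is the Laplace transform of the distribution of the function $1/a$ with respect to the uniform distribution on $[0,1]$. 2) The Poisson--Dirichlet distribution $\operatorname{PD}(\theta)$ is ergodic with respect to $\{S_a\}_{a\in\mathcal{M}}$.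
   Context: $\Sigma=\{y=(y_1,y_2,\ldots): y_1\ge y_2\ge\ldots\ge0,\ y_1+y_2+\ldots=1\}$. The gamma measure $P_\Gamma$ on $(X,\nu)$ is the law of the random finite positive discrete measure $\eta$ on $X$ determined by $\mathbb{E}\left[\exp(-\int_X a\,d\eta)\right]=\exp\left(-\int_X\log(1+a)\,d\nu\right)$ for all non-negative bounded Borel $a$. Writing $\eta=\sum Q_i\delta_{X_i}$ with $Q_1\ge Q_2\ge\ldots$ and $X_i$ distinct, $\operatorname{PD}(\theta)$ is the distribution on $\Sigma$ of $(Q_1/\eta(X),Q_2/\eta(X),\ldots)$. For $a\in\mathcal{M}$, the Markovian operator $S_a$ on $\Sigma$ sends $y\in\Sigma$ to the random point $$S_ay=V\left(\frac{a(X_1)y_1}{\sigma},\frac{a(X_2)y_2}{\sigma},\ldots\right),\qquad \sigma=a(X_1)y_1+a(X_2)y_2+\ldots,$$ where $X_1,X_2,\ldots$ are i.i.d. uniform on $[0,1]$ and $V$ arranges the coordinates in non-increasing order (this is defined for $\operatorname{PD}(\theta)$-almost all $y$, almost surely). $S_a\operatorname{PD}(\theta)$ denotes the distribution of $S_ay$ when $y$ has distribution $\operatorname{PD}(\theta)$ and is independent of $(X_i)$; quasi-invariance means that $S_a\operatorname{PD}(\theta)$ is equivalent to $\operatorname{PD}(\theta)$. Ergodicity with respect to $\{S_a\}_{a\in\mathcal{M}}$ means: every measurable function $G:\Sigma\to\mathbb{R}$ such that, for every $a\in\mathcal{M}$, $G(S_ay)=G(y)$ almost surely (with $y\sim\operatorname{PD}(\theta)$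 independent of $(X_i)$) is $\operatorname{PD}(\theta)$-almost everywhere constant. *)

(* Defs.v *)
From HB Require Import structures.
From mathcomp Require Import all_boot all_order all_algebra.
From mathcomp Require Import all_classical all_reals all_analysis.

Set Implicit Arguments.
Unset Strict Implicit.
Unset Printing Implicit Defensive.
Import Order.TTheory GRing.Theory Num.Theory.
Import numFieldNormedType.Exports.

Local Open Scope classical_set_scope.
Local Open Scope ring_scope.

Definition unit_itv (R : realType) : set R := `[0, 1]%classic.
Arguments unit_itv : clear implicits.

(* The simplex Sigma; sequences are indexed from 0. *)
Record simplex (R : realType) := Simplex {
  coords :> nat -> R ;
  coords_ge0 : forall i, 0 <= coords i ;
  coords_noninc : forall i, coords i.+1 <= coords i ;
  coords_sum : (\sum_(0 <= i <oo) (coords i)%:E = 1)%E }.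

Section simplex_measurable.
Variable R : realType.

Definition simplex_vertex : simplex R.
Proof.
exists (fun i => (i == 0)%:R).
- by move=> i; rewrite ler0n.
- by move=> i /=; rewrite ler0n.
- rewrite (nneseries_split 0 1); last by move=> k _; rewrite lee_fin ler0n.
  rewrite add0n big_nat1 eqxx eseries0 ?adde0// => i.
  by case: i => [|i]// _ _; rewrite eqxx.
Defined.

HB.instance Definition _ := gen_eqMixin (simplex R).
HB.instance Definition _ := gen_choiceMixin (simplex R).
HB.instance Definition _ := isPointed.Build (simplex R) simplex_vertex.

(* The sigma-algebra generated by the coordinates, i.e. the trace of the
   product sigma-algebra of R^nat. *)
Definition simplex_measurable : set (set (simplex R)) :=
  <<s [set A | exists i (B : set R),
         measurable B /\ A = [set y : simplex R | B (y i)]] >>.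

Let simplex_measurable0 : simplex_measurable set0.
Proof. exact: sigma_algebra0. Qed.

Let simplex_measurableC A : simplex_measurable A -> simplex_measurable (~` A).
Proof. exact: sigma_algebraC. Qed.

Let simplex_measurableU (F : (set (simplex R))^nat) :
  (forall i, simplex_measurable (F i)) -> simplex_measurable (\bigcup_i F i).
Proof. exact: sigma_algebra_bigcup. Qed.

Definition simplex_display : measure_display.
Proof. by constructor. Qed.

HB.instance Definition _ := @isMeasurable.Build simplex_display (simplex R)
  simplex_measurable simplex_measurable0 simplex_measurableC
  simplex_measurableU.

End simplex_measurable.

(* eta is a random finite discrete measure on [0, 1] (seen as a random measure
   on R carried by [0, 1]), with ranked masses Q and distinct positions X, whose
   law is the gamma measure with base measure theta * Lebesgue.  A finite number
   of atoms is not excluded a priori: the masses may vanish from some index on. *)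
Definition gamma_random_measure (R : realType) (theta : R)
    d (Om : measurableType d) (P : probability Om R)
    (eta : R.-ker Om ~> R) (Q X : nat -> {RV P >-> R}) : Prop :=
  [/\ forall w, (eta w setT < +oo)%E,
      forall w i, 0 <= Q i.+1 w <= Q i w,
      forall w, injective (fun i => X i w) /\ (forall i, 0 <= X i w <= 1),
      forall w (B : set R), measurable B ->
        (eta w B = \sum_(0 <= i <oo) ((Q i w)%:E * \d_(X i w) B))%E &
      forall a : R -> R, measurable_fun (unit_itv R) a ->
        (exists M : R, forall x : R, 0 <= x <= 1 -> 0 <= a x <= M) ->
        ('E_P[fun w => expR (- \int[eta w]_(x in (unit_itv R)) a x)] =
         (expR (- (theta *
            \int[@lebesgue_measure R]_(x in (unit_itv R)) ln (1 + a x))))%:E)%E ].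

Definition poisson_dirichlet (R : realType) (theta : R)
    (PD : probability (simplex R) R) : Prop :=
  exists d (Om : measurableType d) (P : probability Om R)
    (eta : R.-ker Om ~> R) (Q X : nat -> {RV P >-> R})
    (Y : {RV P >-> simplex R}),
    [/\ gamma_random_measure theta eta Q X,
        {ae P, forall w, forall i, Y w i = Q i w / fine (eta w (unit_itv R))} &
        forall A, measurable A -> PD A = distribution P Y A].

(* ln 0 = 0 in the library, so log is taken in the extended reals:
   lne 0 = -oo, and the integrability forces a > 0 almost everywhere. *)
Definition logintegrable (R : realType) (a : R -> R) : Prop :=
  [/\ forall s : R, 0 <= s <= 1 -> 0 <= a s,
      measurable_fun (unit_itv R) a &
      (\int[@lebesgue_measure R]_(s in (unit_itv R)) `|lne (a s)%:E| < +oo)%E ].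

(* y ~ PD, the x_i are i.i.d. uniform on [0, 1], and y is independent of them. *)
Definition markov_input (R : realType) (PD : probability (simplex R) R)
    d (Om : measurableType d) (P : probability Om R)
    (Y : {RV P >-> simplex R}) (X : nat -> {RV P >-> R}) : Prop :=
  [/\ forall A, measurable A -> distribution P Y A = PD A,
      forall i (B : set R), measurable B ->
        distribution P (X i) B = uniform_prob (@ltr01 R) B &
      forall n (A : set (simplex R)) (B : nat -> set R),
        measurable A -> (forall i, measurable (B i)) ->
        (P (Y @^-1` A `&` \bigcap_(i < n) (X i @^-1` B i)) =
         P (Y @^-1` A) * \prod_(i < n) P (X i @^-1` B i))%E ].

(* w = V z: since w lies in the simplex, it is non-increasing. *)
Definition arranged (R : realType) (z : nat -> R) (w : simplex R) : Prop :=
  exists2 s : nat -> nat, bijective s & forall i, w i = z (s i).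

(* w = S_a y for the given sample x of the uniform variables; such a w is unique
   when it exists.  Values of a outside [0, 1] play no role for almost every x. *)
Definition is_Sa (R : realType) (a : R -> R) (x : nat -> R)
    (y w : simplex R) : Prop :=
  exists2 sigma : R,
    (\sum_(0 <= i <oo) (a (x i) * y i)%:E = sigma%:E)%E &
    arranged (fun i => a (x i) * y i / sigma) w.

Definition Gamma (R : realType) (theta : R) : R :=
  \int[@lebesgue_measure R]_(t in `]0, +oo[) (t `^ (theta - 1) * expR (- t)).

Definition laplace_inv (R : realType) (a : R -> R) (t : R) : R :=
  \int[@lebesgue_measure R]_(s in (unit_itv R)) expR (- (t / a s)).

(* The Radon-Nikodym density; the limit of partial products exists for y in the
   simplex because every factor lies in [0, 1]. *)
Definition Sa_density (R : realType) (theta : R) (a : R -> R)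
    (y : simplex R) : \bar R :=
  (expeR (- (theta%:E *
     \int[@lebesgue_measure R]_(s in (unit_itv R)) lne (a s)%:E)) *
   \int[@lebesgue_measure R]_(sigma in `]0%R, +oo[)
     (sigma `^ (theta - 1) / Gamma theta *
      limn (fun n => \prod_(i < n) laplace_inv a (sigma * y i))%R)%:E)%E.

(* is_Sa is used relationally: its conclusion constrains G wherever S_a y is
   defined, which is almost everywhere. *)
Definition Sa_ergodic (R : realType) (PD : probability (simplex R) R)
    d (Om : measurableType d) (P : probability Om R)
    (Y : {RV P >-> simplex R}) (X : nat -> {RV P >-> R}) : Prop :=
  forall G : simplex R -> R, measurable_fun setT G ->
    (forall a, logintegrable a ->
      {ae P, forall w, forall z,
         is_Sa a (fun i => X i w) (Y w) z -> G z = G (Y w)}) ->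
    exists c : R, {ae PD, forall y, G y = c}.

(* Main.v *)
Require Import Defs.
From HB Require Import structures.
From mathcomp Require Import all_boot all_order all_algebra.
From mathcomp Require Import all_classical all_reals all_analysis.
From mathcomp Require Import measurable_realfun.
From mathcomp Require Import ring lra.

(** The theorem rests on one identity.  Let Y have law PD(theta), and let T be
    the total mass of the gamma measure.  Then T is independent of Y, the
    masses of the gamma measure are the T Y_i, and marking them with
    independent points of law U gives, for f >= 0,

      E prod_i int exp (- T Y_i f(s)) dU(s) = exp (- theta int ln (1 + f) dU).

    This is [laplace_identity], in which T = e^u and [lam] is the law of u.

    The identity comes from the definition of the gamma measure
    ([poisson_dirichlet_split]).  For test functions on [0, 1] that are
    constant on the cells of a grid, the definition says that the masses of the
    cells are independent gamma variables.  Since the positions of the atoms are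
    distinct, a fine grid separates them, so a product over atoms is the limit
    of products over cells ([cells_cvg], [laplace_functional]).  Independence of
    Y and T holds because replacing f by f + l multiplies the integrand by
    exp (- l T), and changes the right-hand side as dividing T by 1 + l does.

    When U is uniform and f is constant on the cells of a grid, the integrands
    are the [symmetric_products].  They are stable under multiplication, and
    they generate the Borel sets of the pairs (y, u): a ranked sequence is
    recovered from its power sums.  Hence they determine integrals
    ([symmetric_products_determine], [bclosure_integral_eq]).

    Quasi-invariance.  Let a > 0, let sigma be the sum of the a(X_i) Y_i, which
    is finite by the identity applied to a / n ([total_finite]), and let g be a
    step function.  The unnormalized masses T a(X_i) Y_i determine the symmetric
    products of (S_a Y, ln (T sigma)), and averaging over the X_i gives
    exp (- theta iint ln (1 + a(s) g(s')) ds ds') ([marked_law_products]).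
    Letting the parameter of the gamma density tend to 0 removes the 1 from the
    identity: when T has the infinite law t^(theta - 1) dt / Gamma(theta), the
    right-hand side becomes exp (- theta int ln f dU)
    ([gamma_mixture_integral]).  For f(s, s') = g(s') + 1 / a(s) the integrand
    is the symmetric product of g times the product of the L_(1/a) (t y_i), and
    ln f = ln (1 + a g) - ln a.  So (S_a Y, T sigma) has density
    exp (- theta int ln a) t^(theta - 1) / Gamma(theta) prod_i L_(1/a) (t y_i)
    with respect to PD(theta) and Lebesgue measure, and integrating over t
    gives the density of S_a Y ([transform_law]).  It is positive almost
    everywhere, again by the identity for f / n ([transform_density_gt0]).

    Ergodicity.  Take 1 / a = 1 + g with g a step function.  The density of
    S_a Y is then a constant times the conditional expectation given Y of a
    symmetric product of (Y, T).  A bounded function of Y that is invariant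
    under S_a for all these a is therefore uncorrelated with every symmetric
    product, hence with every bounded function of Y, and is constant
    ([invariant_uncorrelated], [ergodicity]). *)

Set Implicit Arguments.
Unset Strict Implicit.
Unset Printing Implicit Defensive.
Import Order.TTheory GRing.Theory Num.Theory.
Import numFieldNormedType.Exports.

Local Open Scope classical_set_scope.
Local Open Scope ring_scope.
Local Open Scope charge_scope.

(** * Classes of functions closed under bounded limits *)

Section bounded_closure.
Context {R : realType} {T : Type}.
Implicit Types (G : set (T -> R)) (f g : T -> R).

(** Limits are required to be bounded, so that an equality of integrals passes
    from [G] to its closure by dominated convergence. *)
Inductive bclosure G : (T -> R) -> Prop :=
| bclosure_gen g : G g -> bclosure G g
| bclosure_lin (a : R) f g :
    bclosure G f -> bclosure G g -> bclosure G (fun x => a * f x + g x)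
| bclosure_lim (F : nat -> T -> R) f (M : R) :
    (forall n, bclosure G (F n)) -> (forall n x, `|F n x| <= M) ->
    (forall x, F n x @[n --> \oo] --> f x) -> bclosure G f.

Variable G : set (T -> R).
Hypothesis G1 : G (fun=> 1).
Hypothesis GM : forall f g, G f -> G g -> G (fun x => f x * g x).
Hypothesis Gb : forall g, G g -> exists M : R, forall x, `|g x| <= M.

Lemma bclosure_bounded f : bclosure G f -> exists M : R, forall x, `|f x| <= M.
Proof.
elim=> {f} [g /Gb //|a f g _ [M fM] _ [N gN]|F f M _ _ FM Ff].
  exists (`|a| * M + N) => x; rewrite (le_trans (ler_normD _ _))// lerD//.
  by rewrite normrM ler_wpM2l.
exists M => x.
rewrite -(cvg_lim (@Rhausdorff R) (cvg_norm (Ff x))).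
apply: limr_le; first by apply/cvg_ex; eexists; exact: cvg_norm (Ff x).
by near=> n.
Unshelve. all: by end_near. Qed.

Lemma bclosureZ a f : bclosure G f -> bclosure G (fun x => a * f x).
Proof.
move=> Gf; have G0 : bclosure G (fun x => -1 * f x + f x) by exact: bclosure_lin.
by have := bclosure_lin a Gf G0; congr bclosure; apply/funext => x; ring.
Qed.

Lemma bclosureD f g : bclosure G f -> bclosure G g -> bclosure G (fun x => f x + g x).
Proof.
move=> Gf Gg; have := bclosure_lin 1 Gf Gg.
by congr bclosure; apply/funext => x; ring.
Qed.

Lemma bclosure_cst a : bclosure G (fun=> a).
Proof.
by have := bclosureZ a (bclosure_gen G1); congr bclosure; apply/funext => x; ring.
Qed.

Lemma bclosureB f g : bclosure G f -> bclosure G g -> bclosure G (fun x => f x - g x).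
Proof.
move=> Gf Gg; have := bclosure_lin (-1) Gg Gf.
by congr bclosure; apply/funext => x; ring.
Qed.

(** Induct on the first factor, then on the second; [G] itself is stable under
    products. *)
Lemma bclosureM f g : bclosure G f -> bclosure G g -> bclosure G (fun x => f x * g x).
Proof.
move=> Gf Gg; elim: Gf => {f} [f Gf|a f1 f2 _ If1 _ If2|F f M GF IF FM Ff].
- elim: Gg => {g} [g Gg|a g1 g2 _ Ig1 _ Ig2|F g M GF IF FM Fg].
  + by apply: bclosure_gen; exact: GM.
  + have := bclosure_lin a Ig1 Ig2.
    by congr bclosure; apply/funext => x; ring.
  + have [N fN] := Gb Gf.
    apply: (@bclosure_lim _ (fun n x => f x * F n x) _ (N * M)) => //.
      by move=> n x; rewrite normrM ler_pM.
    by move=> x; apply: cvgMr; exact: Fg.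
- have := bclosure_lin a If1 If2.
  by congr bclosure; apply/funext => x; ring.
- have [N gN] := bclosure_bounded Gg.
  apply: (@bclosure_lim _ (fun n x => F n x * g x) _ (M * N)) => //.
    by move=> n x; rewrite normrM ler_pM.
  by move=> x; apply: cvgMl; exact: Ff.
Qed.

(** Polynomials in x that increase to the absolute value of x on [-1, 1]. *)
Fixpoint abs_approx (n : nat) (x : R) : R :=
  if n is m.+1 then abs_approx m x + (x ^+ 2 - abs_approx m x ^+ 2) / 2 else 0.

(** The error is multiplied at each step by 1 - (|x| + p) / 2, where p is the
    current approximation. *)
Lemma abs_approx_bound n x : `|x| <= 1 ->
  [/\ 0 <= abs_approx n x, abs_approx n x <= `|x| &
      `|x| - abs_approx n x <= `|x| * (1 - `|x| / 2) ^+ n].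
Proof.
move=> x1; have x0 := normr_ge0 x; elim: n => [|n [IH0 IH1 IH2]] /=.
  by rewrite expr0 mulr1 subr0.
rewrite -(real_normK (num_real x)).
set p := abs_approx n x in IH0 IH1 IH2 *; set y := `|x| in x0 x1 IH1 IH2 *.
have -> : p + (y ^+ 2 - p ^+ 2) / 2 = y - (y - p) * (1 - (y + p) / 2) by field.
split; first by nra.
  by nra.
rewrite opprB addrC subrK exprSr mulrA.
apply: (@le_trans _ _ ((y - p) * (1 - y / 2))); first by nra.
by apply: ler_wpM2r; lra.
Qed.

Lemma abs_approx_cvg x : `|x| <= 1 -> abs_approx n x @[n --> \oo] --> `|x|.
Proof.
move=> x1; have [->|x0] := eqVneq x 0.
  rewrite normr0; under eq_cvg => n.
    have [a b _] := @abs_approx_bound n 0 ltac:(by rewrite normr0 ler01).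
    rewrite normr0 in b; rewrite (@le_anti _ _ (abs_approx n 0) 0) ?a ?b//.
    over.
  exact: cvg_cst.
rewrite -[X in _ --> X]subr0.
under eq_cvg => n do rewrite -[abs_approx n x](subKr `|x|).
apply: cvgB; first exact: cvg_cst.
apply: (@squeeze_cvgr _ _ _ _ (fun=> 0) (fun n => `|x| * (1 - `|x| / 2) ^+ n)).
- near=> n; have [a b c] := @abs_approx_bound n x x1.
  by rewrite subr_ge0 b c.
- exact: cvg_cst.
- rewrite -[X in _ --> X](mulr0 `|x|); apply: cvgMr.
  apply: cvg_expr; have := normr_gt0 x; rewrite x0 => xp.
  by rewrite ger0_norm; lra.
Unshelve. all: by end_near. Qed.

Lemma bclosure_abs f : bclosure G f -> bclosure G (fun x => `|f x|).
Proof.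
move=> Gf; have [M0 fM0] := bclosure_bounded Gf.
pose M := `|M0| + 1; have M_gt0 : 0 < M by rewrite ltr_wpDl.
have fM x : `|f x / M| <= 1.
  rewrite normrM normfV (gtr0_norm M_gt0) ler_pdivrMr// mul1r.
  by rewrite (le_trans (fM0 x))// (le_trans (ler_norm _))// /M lerDl.
have Gabs n : bclosure G (fun x => abs_approx n (f x / M)).
  elim: n => [|n IH] /=; first exact: bclosure_cst.
  have Gg : bclosure G (fun x => f x / M).
    by have := bclosureZ M^-1 Gf; congr bclosure; apply/funext => x; ring.
  have := bclosureZ 2^-1 (bclosureB (bclosureM Gg Gg) (bclosureM IH IH)).
  move=> /(bclosureD IH); congr bclosure; apply/funext => x.
  by rewrite !expr2 (mulrC _ 2^-1).
apply: (@bclosure_lim _ (fun n x => M * abs_approx n (f x / M)) _ M).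
- by move=> n; apply: bclosureZ.
- move=> n x; have [a b _] := abs_approx_bound n (fM x).
  rewrite normrM (gtr0_norm M_gt0) ger0_norm//.
  by rewrite -[leRHS]mulr1 ler_pM2l// (le_trans b).
- move=> x; have -> : `|f x| = M * `|f x / M|.
    by rewrite normrM normfV (gtr0_norm M_gt0) mulrC divfK// gt_eqF.
  by apply: cvgMr; exact: abs_approx_cvg.
Qed.

(** With h the positive part of f - s, rescaled into [0, 1], the indicator is
    the limit of 1 - (1 - h)^n. *)
Lemma bclosure_indic_gt f s : bclosure G f -> bclosure G (\1_[set x | s < f x]).
Proof.
move=> Gf; have [M0 fM0] := bclosure_bounded Gf.
pose M := `|M0| + `|s| + 1; have M_gt0 : 0 < M by rewrite ltr_wpDl// addr_ge0.
pose h x := (`|f x - s| + (f x - s)) / (2 * M).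
have h0 x : 0 <= h x.
  rewrite /h divr_ge0// ?mulr_ge0// ?(ltW M_gt0)//.
  by have := ler_norm (- (f x - s)); rewrite normrN; lra.
have h1 x : h x <= 1.
  rewrite /h ler_pdivrMr ?mulr_gt0// mul1r.
  have := ler_norm (f x - s); have := ler_normB (f x) s; have := fM0 x.
  by have := ler_norm M0; rewrite /M; lra.
have Gh : bclosure G h.
  have Gfs := bclosureB Gf (bclosure_cst s).
  have := bclosureZ (2 * M)^-1 (bclosureD (bclosure_abs Gfs) Gfs).
  by congr bclosure; apply/funext => x; rewrite mulrC.
have Gn n : bclosure G (fun x => 1 - (1 - h x) ^+ n).
  apply: (bclosureB (bclosure_cst 1)).
  elim: n => [|n IH]; first by under eq_fun do rewrite expr0; exact: bclosure_cst.
  under eq_fun do rewrite exprS.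
  exact: (bclosureM (bclosureB (bclosure_cst 1) Gh)).
apply: (bclosure_lim (M := 1) Gn).
  move=> n x; have a0 : 0 <= 1 - h x by rewrite subr_ge0.
  have := exprn_ge0 n a0.
  have : (1 - h x) ^+ n <= 1 by apply: exprn_ile1 => //; rewrite gerBl.
  by rewrite ler_norml; lra.
move=> x; rewrite indicE; have [sf|fs] := ltP s (f x).
  rewrite mem_set//= -[X in _ --> X]subr0.
  apply: cvgB; first exact: cvg_cst.
  apply: cvg_expr; rewrite ger0_norm ?subr_ge0// ltrBlDr ltrDl.
  rewrite /h gtr0_norm ?subr_gt0// divr_gt0// ?mulr_gt0//.
  by lra.
rewrite memNset /=; last by apply/negP; rewrite -leNgt.
have -> : h x = 0 by rewrite /h ler0_norm ?subr_le0// addNr mul0r.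
under eq_cvg do rewrite subr0 expr1n subrr; exact: cvg_cst.
Qed.

Let D : set (set T) := [set A | bclosure G (\1_A)].

Lemma bclosure_indic0 : D set0.
Proof. by rewrite /D/= indic0; exact: bclosure_cst. Qed.

Lemma bclosure_indicC A : D A -> D (~` A).
Proof.
move=> DA; have := bclosureB (bclosure_cst 1) DA; congr bclosure.
apply/funext => x; rewrite !indicE in_setC.
by case: (x \in A); rewrite ?subrr ?subr0.
Qed.

Lemma bclosure_indicI A B : D A -> D B -> D (A `&` B).
Proof.
move=> DA DB; have := bclosureM DA DB; congr bclosure.
by apply/funext => x; rewrite indicI.
Qed.

Lemma bclosure_indicU (F : (set T)^nat) : (forall n, D (F n)) -> D (\bigcup_n F n).
Proof.
move=> DF; rewrite -(setCK (\bigcup_n F n)) setC_bigcup; apply: bclosure_indicC.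
have Dn n : D (\big[setI/setT]_(i < n) ~` F i).
  elim: n => [|n IH]; first by rewrite big_ord0 -setC0; apply: bclosure_indicC; exact: bclosure_indic0.
  by rewrite big_ord_recr /=; apply: bclosure_indicI => //; exact: bclosure_indicC.
apply: (bclosure_lim (M := 1) Dn).
  by move=> n x; rewrite indicE; case: (_ \in _); rewrite ?normr1 ?normr0.
move=> x; rewrite !indicE; have [xF|xF] := pselect ((\bigcap_i ~` F i) x).
  rewrite mem_set//; under eq_cvg => n.
    rewrite indicE mem_set; last by rewrite -(bigcap_mkord _ (fun i => ~` F i)) => i _; exact: xF.
    over.
  exact: cvg_cst.
rewrite memNset//; move: xF; rewrite -setC_bigcup /= => /contrapT[i _ Fix].
apply: cvg_near_cst; near=> n.
rewrite indicE memNset// -(bigcap_mkord _ (fun i => ~` F i)) => /(_ i); apply => //=.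
by near: n; exists i.+1.
Unshelve. all: by end_near. Qed.

End bounded_closure.

Section bclosure_measurable.
Context {R : realType} d (T : measurableType d).
Variable G : set (T -> R).
Hypothesis G1 : G (fun=> 1).
Hypothesis GM : forall f g, G f -> G g -> G (fun x => f x * g x).
Hypothesis Gb : forall g, G g -> exists M : R, forall x, `|g x| <= M.
Hypothesis Gm : forall d' (T' : measurableType d') (Psi : T' -> T),
  (forall g, G g -> measurable_fun setT (g \o Psi)) -> measurable_fun setT Psi.

(** The sets whose indicator lies in the closure form a sigma-algebra.  The last
    hypothesis on [G], applied to the identity map from this sigma-algebra,
    says that it contains the measurable sets. *)
Lemma bclosure_indic A : measurable A -> bclosure G (\1_A).
Proof.
pose D : set (set T) := [set A | bclosure G (\1_A)].
have sD : sigma_algebra setT D.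
  split; first exact: bclosure_indic0.
    by move=> B; rewrite setTD; exact: bclosure_indicC.
  by move=> F; exact: bclosure_indicU.
have mid : measurable_fun setT (id : g_sigma_algebraType D -> T).
  apply: Gm => g Gg mT.
  apply: (measurability _ (RGenOInfty.measurableE R)) => //.
  move=> _ [_ [s ->] <-]; rewrite setTI; apply: sub_sigma_algebra.
  have := bclosure_indic_gt G1 GM Gb s (bclosure_gen Gg).
  congr (bclosure _ (\1_ _)); apply/seteqP; split => x /=;
    by rewrite in_itv/= andbT.
move=> mA; have := mid measurableT _ mA; rewrite setTI.
by rewrite /measurable/= (sigma_algebra_id sD).
Qed.

End bclosure_measurable.

(** * Infinite products and the simplex *)

Section exponentials.
Context {R : realType}.

Lemma exp_unit (q t : R) : 0 <= q -> 0 <= t -> 0 <= expR (- (q * t)) <= 1.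
Proof. by move=> q0 t0; rewrite expR_ge0/= -expR0 ler_expR oppr_le0 mulr_ge0. Qed.

Lemma measurable_exp_scaled d (T : measurableType d) (c : R) (f : T -> R) :
  measurable_fun setT f -> measurable_fun setT (fun x => expR (- (c * f x))).
Proof.
move=> mf; apply: measurableT_comp => //; apply: measurable_funN.
by apply: measurable_funM => //; exact: measurable_cst.
Qed.

End exponentials.

Section iprod.
Context {R : realType}.
Implicit Types b c : nat -> R.

Definition iprod b : R := limn (fun n => \prod_(i < n) b i).

Definition unit_seq b := forall i, 0 <= b i <= 1.

Lemma prod_unit b n : unit_seq b -> 0 <= \prod_(i < n) b i <= 1.
Proof.
move=> b01; elim: n => [|n /andP[p0 p1]]; first by rewrite big_ord0 ler01 lexx.
have /andP[b0 b1] := b01 n.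
by rewrite big_ord_recr/= mulr_ge0//= mulr_ile1.
Qed.

Lemma prod_unit_noninc b : unit_seq b ->
  nonincreasing_seq (fun n => \prod_(i < n) b i).
Proof.
move=> b01; apply/nonincreasing_seqP => n; rewrite big_ord_recr/=.
have /andP[p0 _] := prod_unit n b01; have /andP[b0 b1] := b01 n.
by rewrite ler_piMr.
Qed.

Lemma iprod_cvg b : unit_seq b -> \prod_(i < n) b i @[n --> \oo] --> iprod b.
Proof.
move=> b01; apply: nonincreasing_is_cvgn; first exact: prod_unit_noninc.
by exists 0 => _ [n _ <-]; have /andP[] := prod_unit n b01.
Qed.

Lemma iprod_le b n : unit_seq b -> iprod b <= \prod_(i < n) b i.
Proof.
move=> b01; apply: limr_le; first exact: iprod_cvg.
by near=> m; apply: prod_unit_noninc => //; near: m; exact: nbhs_infty_ge.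
Unshelve. all: by end_near. Qed.

Lemma iprod_ge b a : unit_seq b -> (forall n, a <= \prod_(i < n) b i) ->
  a <= iprod b.
Proof.
by move=> b01 ab; apply: limr_ge; [exact: iprod_cvg|near=> n].
Unshelve. all: by end_near. Qed.

Lemma iprod_unit b : unit_seq b -> 0 <= iprod b <= 1.
Proof.
move=> b01; rewrite iprod_ge//=; last by move=> n; have /andP[] := prod_unit n b01.
by rewrite (le_trans (iprod_le 0 b01))// big_ord0.
Qed.

Lemma iprod_mono b c : unit_seq b -> unit_seq c -> (forall i, b i <= c i) ->
  iprod b <= iprod c.
Proof.
move=> b01 c01 bc; apply: iprod_ge => // n; apply: (le_trans (iprod_le n b01)).
by apply: ler_prod => i _; rewrite bc andbT; have /andP[] := b01 i.
Qed.

Lemma iprodM b c : unit_seq b -> unit_seq c ->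
  iprod (fun i => b i * c i) = iprod b * iprod c.
Proof.
move=> b01 c01; apply: cvg_lim => //; under eq_cvg do rewrite big_split/=.
by apply: cvgM; exact: iprod_cvg.
Qed.

Lemma unit_seq_expR b : (forall i, 0 <= b i) -> unit_seq (fun i => expR (- b i)).
Proof. by move=> b0 i; rewrite expR_ge0/= -expR0 ler_expR oppr_le0. Qed.

Lemma iprod_expR b s : series b @ \oo --> s ->
  iprod (fun i => expR (- b i)) = expR (- s).
Proof.
move=> bs; apply: cvg_lim => //.
have : expR (- series b n) @[n --> \oo] --> expR (- s).
  by apply: continuous_cvg; [exact: continuous_expR|exact: cvgN].
apply: cvg_trans; apply: near_eq_cvg; near=> n.
by rewrite -expR_sum sumrN /series/= big_mkord.
Unshelve. all: by end_near. Qed.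

(** Finite products converge factor by factor and bound the infinite product
    from above; monotonicity bounds it from below. *)
Lemma iprod_cvg_above (B : nat -> nat -> R) b : unit_seq b ->
  (forall m, unit_seq (B m)) -> (forall m i, b i <= B m i) ->
  (forall i, B m i @[m --> \oo] --> b i) -> iprod (B m) @[m --> \oo] --> iprod b.
Proof.
move=> b01 B01 bB Bb; apply/cvgrPdist_lt => e e0.
have e20 : 0 < e / 2 by rewrite divr_gt0.
have /cvgrPdist_lt/(_ _ e20)[N _ /(_ N (leqnn N))] := iprod_cvg b01.
have bN := iprod_le N b01; rewrite distrC ger0_norm ?subr_ge0// => bNe.
have /cvgrPdist_lt/(_ _ e20) : \prod_(i < N) B m i @[m --> \oo] --> \prod_(i < N) b i.
  elim: (N) => [|n IH].
    by rewrite big_ord0; under eq_cvg do rewrite big_ord0; exact: cvg_cst.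
  rewrite big_ord_recr; under eq_cvg do rewrite big_ord_recr.
  by apply: cvgM => //; exact: Bb.
apply: filterS => m.
have := iprod_mono b01 (B01 m) (bB m); have := iprod_le N (B01 m).
move=> h1 h2; rewrite !ltr_norml => /andP[h3 h4]; apply/andP; split; lra.
Qed.

(** Since the factors are at most 1, a finite product of rearranged factors is
    at least any longer product containing them. *)
Lemma iprod_bij b (s : nat -> nat) : bijective s -> unit_seq b ->
  iprod (b \o s) = iprod b.
Proof.
have half c t t' : cancel t t' -> cancel t' t -> unit_seq c ->
    iprod c <= iprod (c \o t).
  move=> tK t'K c01; apply: iprod_ge => [i|n]; first exact: c01.
  pose N := (\max_(i < n) t i).+1.
  apply: (le_trans (iprod_le N c01)).
  have tN i : (i < n)%N -> (t i < N)%N.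
    by move=> ni; rewrite /N ltnS; exact: (leq_bigmax (Ordinal ni)).
  rewrite -(big_mkord xpredT c) -(big_mkord xpredT (c \o t)).
  rewrite -(big_map t xpredT c)/=.
  rewrite (bigID (mem [seq t i | i <- index_iota 0 n]))/=.
  rewrite -[leRHS]mulr1 ler_pM//.
  - by apply: prodr_ge0 => i _; have /andP[] := c01 i.
  - by apply: prodr_ge0 => i _; have /andP[] := c01 i.
  - rewrite -big_filter (perm_big [seq t i | i <- index_iota 0 n])//.
    apply: uniq_perm.
    + by rewrite filter_uniq// iota_uniq.
    + by rewrite map_inj_uniq ?iota_uniq//; exact: can_inj tK.
    + move=> j; rewrite mem_filter andb_idr// => /mapP[i].
      by rewrite !mem_index_iota => /andP[_ /tN ? ->].
  - suff /andP[] : 0 <= \prod_(0 <= i < N | i \notin [seq t i | i <- index_iota 0 n]) c i <= 1 by [].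
    elim/big_ind : _ => //; first by rewrite ler01 lexx.
    by move=> x y /andP[? ?] /andP[? ?]; rewrite mulr_ge0//= mulr_ile1.
case=> s' sK s'K b01; apply/eqP; rewrite eq_le (half _ _ _ sK s'K)// andbT.
have bs01 : unit_seq (b \o s) by move=> i; exact: b01.
rewrite (le_trans (half _ _ _ s'K sK bs01))//.
rewrite (_ : (b \o s) \o s' = b)//; apply/funext => i /=.
by rewrite s'K.
Qed.

Lemma measurable_iprod d (T : measurableType d) (D : set T) (B : nat -> T -> R) :
  measurable D ->
  (forall i, measurable_fun D (B i)) -> (forall x, D x -> unit_seq (B ^~ x)) ->
  measurable_fun D (fun x => iprod (B ^~ x)).
Proof.
move=> mD mB B01; apply: (measurable_fun_cvg (h := fun n x => \prod_(i < n) B i x)).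
  by move=> n; apply: measurable_prod => i _; exact: mB.
by move=> x Dx; apply: iprod_cvg; exact: B01.
Qed.

End iprod.

Section simplex_facts.
Context {R : realType}.
Implicit Types y : simplex R.

Lemma simplex_cvg y : series y @ \oo --> (1 : R).
Proof.
have h : (\sum_(0 <= i < n) (y i)%:E)%E @[n --> \oo] --> (1%:E : \bar R).
  rewrite -(coords_sum y); apply: is_cvg_nneseries => i _ _.
  by rewrite lee_fin coords_ge0.
move/fine_cvgP : h => [_]; apply: cvg_trans.
by apply: near_eq_cvg; near=> n => /=; rewrite sumEFin.
Unshelve. all: by end_near. Qed.

Lemma simplex_antimono y i j : (i <= j)%N -> y j <= y i.
Proof. by move: i j; apply/nonincreasing_seqP => n; exact: coords_noninc. Qed.

Lemma simplex_gt0 y : 0 < y 0%N.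
Proof.
rewrite lt_neqAle coords_ge0 andbT; apply/eqP => y0.
have : series y @ \oo --> (0 : R).
  rewrite (_ : series y = cst 0); first exact: cvg_cst.
  apply/funext => n; rewrite /series/= big1// => i _.
  by apply/le_anti; rewrite coords_ge0 andbT y0 simplex_antimono.
move/(cvg_lim (@Rhausdorff R)); rewrite (cvg_lim _ (simplex_cvg y))// => /eqP.
by rewrite oner_eq0.
Qed.

Lemma measurable_coord (i : nat) : measurable_fun setT (fun y : simplex R => y i).
Proof.
move=> _ B mB; rewrite setTI; apply: sub_sigma_algebra.
by exists i, B.
Qed.

Lemma measurable_to_simplex d (T : measurableType d) (D : set T) (f : T -> simplex R) :
  (forall i, measurable_fun D (fun x => f x i)) -> measurable_fun D f.
Proof.
move=> mf.
pose G := [set A | exists i (B : set R), measurable B /\ A = [set y : simplex R | B (y i)]].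
move=> mD; apply: (@measurability _ _ _ _ D f G) => //.
by move=> _ [_ [i [B [mB ->]]] <-]; exact: mf.
Qed.

End simplex_facts.

(** * Symmetric products determine a ranked sequence *)

Lemma expR_le_quad {R : realType} (x : R) : 0 <= x -> expR (- x) <= 1 - x + x ^+ 2.
Proof.
move=> x0; rewrite expRN.
have h : 1 + x <= expR x by exact: expR_ge1Dx.
have x1 : 0 < 1 + x by rewrite ltr_wpDr.
apply: (@le_trans _ _ (1 + x)^-1); first by rewrite lef_pV2// posrE expR_gt0.
rewrite -[leLHS]mul1r ler_pdivrMr//.
have : 0 <= x ^+ 3 by exact: exprn_ge0.
rewrite (_ : (1 - x + x ^+ 2) * (1 + x) = 1 + x ^+ 3); first by lra.
by ring.
Qed.

Section avgexp.
Context {R : realType}.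
Implicit Types (x : nat -> R) (q : R).

(** The Laplace transform of the uniform law on the points x_0, ..., x_n. *)
Definition avgexp (n : nat) x q : R :=
  n.+1%:R^-1 * \sum_(k < n.+1) expR (- (x k * q)).

Lemma avgexp_cst (n : nat) (c : R) : n.+1%:R^-1 * \sum_(k < n.+1) c = c.
Proof.
by rewrite sumr_const card_ord -[c *+ _]mulr_natl mulKf// pnatr_eq0.
Qed.

Lemma avgexp_unit n x q : (forall k, 0 <= x k) -> 0 <= q -> 0 <= avgexp n x q <= 1.
Proof.
move=> x0 q0; rewrite /avgexp mulr_ge0 ?invr_ge0//=; last first.
  by apply: sumr_ge0 => i _; exact: expR_ge0.
rewrite -[leRHS](avgexp_cst n) ler_wpM2l ?invr_ge0//.
by apply: ler_sum => k _; rewrite -expR0 ler_expR oppr_le0 mulr_ge0.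
Qed.

Lemma sum_divmod (F : nat -> nat -> R) (n m : nat) : (0 < m)%N ->
  \sum_(0 <= k < n * m) F (k %/ m)%N (k %% m)%N =
  \sum_(0 <= i < n) \sum_(0 <= j < m) F i j.
Proof.
move=> m0; elim: n => [|n IH]; first by rewrite mul0n !big_geq.
rewrite mulSnr (@big_cat_nat _ _ _ (n * m)%N) ?leq_addr//= IH big_nat_recr//=.
congr +%R; rewrite -{1}[(n * m)%N]add0n big_addn addKn.
apply: eq_big_nat => j /andP[_ jm].
by rewrite addnC divnMDl// modnMDl divn_small// modn_small// addn0.
Qed.

(** The pairs of indices are listed along a single one by division with
    remainder. *)
Lemma avgexpM n m x x' q : avgexp n x q * avgexp m x' q =
  avgexp (n.+1 * m.+1).-1 (fun k => x (k %/ m.+1)%N + x' (k %% m.+1)%N) q.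
Proof.
rewrite /avgexp prednK ?muln_gt0// natrM invfM mulrACA; congr (_ * _).
rewrite -(big_mkord xpredT (fun k => expR (- ((x (k %/ m.+1)%N + x' (k %% m.+1)%N) * q)))).
rewrite (sum_divmod (fun i j => expR (- ((x i + x' j) * q))))// big_distrlr/=.
rewrite big_mkord; apply: eq_bigr => i _; rewrite big_mkord; apply: eq_bigr => j _.
by rewrite -expRD mulrDl opprD.
Qed.

Lemma measurable_avgexp d (T : measurableType d) (D : set T) n x (f : T -> R) :
  measurable_fun D f -> measurable_fun D (fun t => avgexp n x (f t)).
Proof.
move=> mf; apply: measurable_funM; first exact: measurable_cst.
apply: measurable_sum => k; apply: measurableT_comp; first exact: measurable_expR.
by apply: measurable_funN; apply: measurable_funM => //; exact: measurable_cst.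
Qed.

(** A pair p = (y, u) stands for the unnormalized masses e^u y_i. *)
Definition symmetric_product n x (p : simplex R * R) : R :=
  iprod (fun i => avgexp n x (expR p.2 * p.1 i)).

Definition symmetric_products : set (simplex R * R -> R) :=
  [set h | exists n x, (forall k, 0 <= x k) /\ h = symmetric_product n x].

Lemma simplex_scale_ge0 (p : simplex R * R) i : 0 <= expR p.2 * p.1 i.
Proof. by rewrite mulr_ge0 ?expR_ge0// coords_ge0. Qed.

Lemma symmetric_products1 : symmetric_products (fun=> 1).
Proof.
exists 0%N, (fun=> 0); split => //; apply/funext => p.
rewrite /symmetric_product (_ : (fun _ => _) = (fun=> 1)).
  by apply/esym/cvg_lim => //; under eq_cvg do rewrite big1//; exact: cvg_cst.
by apply/funext => i; rewrite /avgexp big_ord1 invr1 mul0r oppr0 expR0 mulr1.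
Qed.

Lemma symmetric_productsM f g : symmetric_products f -> symmetric_products g ->
  symmetric_products (fun p => f p * g p).
Proof.
move=> [n [x [x0 ->]]] [m [x' [x'0 ->]]].
exists (n.+1 * m.+1).-1, (fun k => x (k %/ m.+1)%N + x' (k %% m.+1)%N).
split; first by move=> k; rewrite addr_ge0.
apply/funext => p; rewrite /symmetric_product -iprodM.
- by congr iprod; apply/funext => i; rewrite avgexpM.
- by move=> i; apply: avgexp_unit => //; exact: simplex_scale_ge0.
- by move=> i; apply: avgexp_unit => //; exact: simplex_scale_ge0.
Qed.

Lemma symmetric_product_unit n x p : (forall k, 0 <= x k) ->
  0 <= symmetric_product n x p <= 1.
Proof.
move=> x0; apply: iprod_unit => i; apply: avgexp_unit => //.
exact: simplex_scale_ge0.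
Qed.

Lemma symmetric_products_bounded g : symmetric_products g ->
  exists M : R, forall p, `|g p| <= M.
Proof.
move=> [n [x [x0 ->]]]; exists 1 => p.
by have /andP[a b] := symmetric_product_unit n p x0; rewrite ger0_norm.
Qed.

End avgexp.

Section recover.
Context {R : realType}.

Lemma prod_onem_ge (c : nat -> R) n : unit_seq c ->
  1 - series c n <= \prod_(i < n) (1 - c i).
Proof.
move=> c01; elim: n => [|n IH].
  by rewrite big_ord0 /series/= big_geq// subr0.
rewrite big_ord_recr/= seriesSr.
have /andP[c0 c1] := c01 n.
have : 0 <= \prod_(i < n) (1 - c i) <= 1.
  apply: (@prod_unit _ (fun i => 1 - c i)) => i; have /andP[a b] := c01 i.
  by rewrite subr_ge0 b gerBl.
by set p := \prod_(_ < _) _ in IH * => /andP[p0 p1]; nra.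
Qed.

(** The first-order term of the product in 1 / N extracts the sum of the b_i;
    the product lies between 1 - s / N and e^(- s / N). *)
Lemma iprod_first_order (b : nat -> R) (s : R) : unit_seq b -> series b @ \oo --> s ->
  n.+1%:R * (1 - iprod (fun i => 1 - b i / n.+1%:R)) @[n --> \oo] --> s.
Proof.
move=> b01 bs.
have b0 i : 0 <= b i by have /andP[] := b01 i.
have sb n : series b n <= s.
  rewrite -(cvg_lim (@Rhausdorff R) bs); apply: nondecreasing_cvgn_le.
    by apply: nondecreasing_series => i _ _.
  by apply/cvg_ex; exists s.
have s0 : 0 <= s by apply: le_trans (sb 0%N); rewrite /series/= big_geq.
have b1 n i : 0 <= b i / n.+1%:R <= 1.
  rewrite divr_ge0//= ler_pdivrMr// mul1r.
  by have /andP[_ /le_trans->//] := b01 i; rewrite ler1n.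
have b1' n i : 0 <= 1 - b i / n.+1%:R <= 1.
  by have /andP[u v] := b1 n i; rewrite subr_ge0 v gerBl.
apply: (@squeeze_cvgr _ _ _ _ (fun n => s - s ^+ 2 * n.+1%:R^-1) (fun=> s)).
- near=> n; have N0 : 0 < n.+1%:R :> R by [].
  have lo : 1 - s / n.+1%:R <= iprod (fun i => 1 - b i / n.+1%:R).
    apply: iprod_ge => // m; apply: le_trans (prod_onem_ge m (b1 n)).
    rewrite lerB// /series/= -mulr_suml ler_pM2r ?invr_gt0//.
    exact: sb.
  have hi : iprod (fun i => 1 - b i / n.+1%:R) <= expR (- (s / n.+1%:R)).
    rewrite -(@iprod_expR _ (fun i => b i / n.+1%:R)); last first.
      rewrite (_ : series _ = (fun m => series b m * n.+1%:R^-1)).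
        exact: cvgMl.
      by apply/funext => m; rewrite /series/= -mulr_suml.
    apply: iprod_mono => //.
      by apply: unit_seq_expR => i; have /andP[] := b1 n i.
    by move=> i; exact: expR_ge1Dx.
  have : iprod (fun i => 1 - b i / n.+1%:R) <= 1 - s / n.+1%:R + (s / n.+1%:R) ^+ 2.
    by apply: (le_trans hi); apply: expR_le_quad; rewrite divr_ge0.
  move: lo; set p := iprod _; set N := n.+1%:R in N0 *.
  move=> lo up; apply/andP; split.
    have -> : s - s ^+ 2 / N = N * (s / N - (s / N) ^+ 2) by field; rewrite gt_eqF.
    rewrite ler_pM2l//; move: lo up; move: (s / N) => t lo up.
    by rewrite lerBrDr -lerBrDl opprB addrA addrAC.
  have sN : s = N * (s / N) by field; rewrite gt_eqF.
  rewrite [leRHS]sN ler_pM2l//; move: lo; move: (s / N) => t lo.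
  by rewrite lerBlDr addrC -lerBlDr.
- rewrite -[X in _ --> X](subr0 s); apply: cvgB; first exact: cvg_cst.
  rewrite -[X in _ --> X](mulr0 (s ^+ 2)); apply: cvgMr.
  by have := @cvg_harmonic R.
- exact: cvg_cst.
Unshelve. all: by end_near. Qed.

Context d (T : measurableType d) (Psi : T -> simplex R * R).
Hypothesis Psi_sym : forall h, symmetric_products h -> measurable_fun setT (h \o Psi).

Let q i w : R := expR (Psi w).2 * (Psi w).1 i.

Let q_ge0 i w : 0 <= q i w. Proof. exact: simplex_scale_ge0. Qed.

Let q_series w : series (q^~ w) @ \oo --> expR (Psi w).2.
Proof.
rewrite (_ : series _ = (fun n => expR (Psi w).2 * series (Psi w).1 n)).
  rewrite -[X in _ --> X]mulr1; apply: cvgMr; exact: simplex_cvg.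
by apply/funext => m; rewrite /series/= -mulr_sumr.
Qed.

Let q_noninc i j w : (i <= j)%N -> q j w <= q i w.
Proof. by move=> ij; rewrite ler_pM2l ?expR_gt0// simplex_antimono. Qed.

Definition linear_bound (psi : R -> R) :=
  exists C : R, forall t, 0 <= t -> `|psi t| <= C * t.

Let sumq (psi : R -> R) w : R := limn (series (fun i => psi (q i w))).

Let sumq_cvg psi w : linear_bound psi -> series (fun i => psi (q i w)) @ \oo --> sumq psi w.
Proof.
move=> [C psiC]; apply: normed_cvg.
apply: (@series_le_cvg _ _ (fun i => C * q i w)) => //.
- by move=> i /=.
- by move=> i; rewrite (le_trans _ (psiC _ (q_ge0 i w))).
- by move=> i; exact: psiC.
- apply/cvg_ex; exists (C * expR (Psi w).2).
  rewrite (_ : series _ = (fun n => C * series (q^~ w) n)); first exact: cvgMr.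
  by apply/funext => m; rewrite /series/= -mulr_sumr.
Qed.

Let sumqB psi phi w : linear_bound psi -> linear_bound phi ->
  sumq (fun t => psi t - phi t) w = sumq psi w - sumq phi w.
Proof.
move=> lpsi lphi; apply: cvg_lim => //.
rewrite (_ : series _ = (series (fun i => psi (q i w)) \- series (fun i => phi (q i w)))).
  by apply: cvgB; exact: sumq_cvg.
by apply/funext => m; rewrite /series/= sumrB.
Qed.

Lemma linear_bound_exp (x : R) : 0 <= x -> linear_bound (fun t => 1 - expR (- (x * t))).
Proof.
move=> x0; exists x => t t0; have xt : 0 <= x * t by rewrite mulr_ge0.
rewrite ger0_norm.
  by have := expR_ge1Dx (- (x * t)); lra.
by rewrite subr_ge0 -expR0 ler_expR oppr_le0.
Qed.

(** Take one point x and n points 0: the average of exponentials is then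
    1 - b_i / (n + 1). *)
Let msumq1 (x : R) : 0 <= x -> measurable_fun setT (sumq (fun t => 1 - expR (- (x * t)))).
Proof.
move=> x0; pose b i w := 1 - expR (- (x * q i w)).
have b01 w : unit_seq (b^~ w).
  move=> i; rewrite /b gerBl expR_ge0 andbT subr_ge0 -expR0 ler_expR oppr_le0.
  by rewrite mulr_ge0.
apply: (measurable_fun_cvg (h := fun n w =>
  n.+1%:R * (1 - iprod (fun i => 1 - b i w / n.+1%:R)))).
  move=> n; apply: measurable_funM; first exact: measurable_cst.
  apply: measurable_funB; first exact: measurable_cst.
  pose X k : R := if k == 0%N then x else 0.
  have X0 k : 0 <= X k by rewrite /X; case: ifP.
  have := @Psi_sym (symmetric_product n X) (ex_intro _ n (ex_intro _ X (conj X0 erefl))).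
  congr measurable_fun; apply/funext => w /=.
  rewrite /symmetric_product; congr iprod; apply/funext => i; rewrite /avgexp.
  rewrite big_ord_recl/= {1}/X/= (eq_bigr (fun=> 1)); last first.
    by move=> k _; rewrite /X/= mul0r oppr0 expR0.
  rewrite sumr_const card_ord /b -/(q i w) -(natr1 n).
  have n0 : n%:R + 1 != 0 :> R by rewrite natr1 pnatr_eq0.
  by field.
move=> w _; apply: iprod_first_order => //.
exact: sumq_cvg (linear_bound_exp x0).
Qed.

Let W k (x t : R) : R := expR (- (x * t)) * (1 - expR (- t)) ^+ k.+1.

Let onem_exp (t : R) : 0 <= t -> 0 <= 1 - expR (- t) <= 1.
Proof.
by move=> t0; rewrite gerBl expR_ge0 andbT subr_ge0 -expR0 ler_expR oppr_le0.
Qed.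

Let linear_bound_W k (x : R) : 0 <= x -> linear_bound (W k x).
Proof.
move=> x0; exists 1 => t t0; have /andP[r0 r1] := onem_exp t0.
have e1 : expR (- (x * t)) <= 1 by rewrite -expR0 ler_expR oppr_le0 mulr_ge0.
rewrite ger0_norm ?mulr_ge0 ?expR_ge0 ?exprn_ge0// mul1r.
have rt : 1 - expR (- t) <= t by have := expR_ge1Dx (- t); lra.
apply: (le_trans _ rt); rewrite -[leRHS]mul1r ler_pM ?expR_ge0 ?exprn_ge0//.
by rewrite exprS -[leRHS]mulr1 ler_wpM2l// exprn_ile1.
Qed.

(** Multiplying the summand by 1 - e^(- t) amounts to a difference in x. *)
Let msumqW k (x : R) : 0 <= x -> measurable_fun setT (sumq (W k x)).
Proof.
elim: k x => [|k IH] x x0.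
  have x10 : 0 <= x + 1 by rewrite addr_ge0.
  have := measurable_funB (msumq1 x10) (msumq1 x0).
  congr measurable_fun; apply/funext => w /=.
  rewrite -(sumqB _ (linear_bound_exp x10) (linear_bound_exp x0)).
  congr sumq; apply/funext => t.
  rewrite /W expr1 mulrDl mul1r opprD expRD; ring.
have x10 : 0 <= x + 1 by rewrite addr_ge0.
have := measurable_funB (IH _ x0) (IH _ x10).
congr measurable_fun; apply/funext => w /=.
rewrite -(sumqB _ (linear_bound_W k x0) (linear_bound_W k x10)).
congr sumq; apply/funext => t.
rewrite /W mulrDl mul1r opprD expRD [in RHS]exprS; ring.
Qed.

Let r i w : R := 1 - expR (- q i w).

Let r_unit i w : 0 <= r i w <= 1. Proof. exact: onem_exp. Qed.

Let power_sum k w : R := sumq (W k 0) w.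

Let power_sum_cvg k w :
  series (fun i => r i w ^+ k.+1) @ \oo --> power_sum k w.
Proof.
have -> : (fun i => r i w ^+ k.+1) = (fun i => W k 0 (q i w)).
  by apply/funext => i; rewrite /W mul0r oppr0 expR0 mul1r.
exact: sumq_cvg (linear_bound_W k (lexx 0)).
Qed.

Let power_sum_ge k n w : series (fun i => r i w ^+ k.+1) n <= power_sum k w.
Proof.
rewrite -(cvg_lim (@Rhausdorff R) (@power_sum_cvg k w)).
apply: nondecreasing_cvgn_le.
  by apply: nondecreasing_series => i _ _; rewrite exprn_ge0//; have /andP[] := r_unit i w.
by apply/cvg_ex; eexists; exact: power_sum_cvg.
Qed.

(** The n-th term is the largest of those that remain, so the tail of the power
    sum grows at most like its k-th power. *)
Let power_sum_tail k n w : power_sum k w <=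
  series (fun i => r i w ^+ k.+1) n + r n w ^+ k * power_sum 0 w.
Proof.
have r0 i : 0 <= r i w by have /andP[] := r_unit i w.
rewrite -(cvg_lim (@Rhausdorff R) (@power_sum_cvg k w)).
apply: limr_le; first by apply/cvg_ex; eexists; exact: power_sum_cvg.
near=> m; have nm : (n <= m)%N by near: m; exact: nbhs_infty_ge.
rewrite /series/= (@big_cat_nat _ _ _ n)//= lerD2l.
apply: (@le_trans _ _ (r n w ^+ k * series (fun i => r i w ^+ 1) m)); last first.
  by rewrite ler_wpM2l ?exprn_ge0// power_sum_ge.
rewrite /series/= (@big_cat_nat _ _ _ n 0 m)//= mulrDr.
rewrite ler_wpDl//; first by rewrite mulr_ge0 ?exprn_ge0// sumr_ge0// => i _; rewrite exprn_ge0.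
rewrite mulr_sumr !big_nat ler_sum// => i /andP[ni _].
rewrite expr1 exprSr ler_wpM2r// lerXn2r ?nnegrE//.
by rewrite lerB// ler_expR lerN2 q_noninc.
Unshelve. all: by end_near. Qed.

(** The n-th term is at least s exactly when, for every k, the power sum
    without its first n terms is at least s^k. *)
Let mr n : measurable_fun setT (r n).
Proof.
elim/ltn_ind: n => n IH.
have mset s : measurable [set w | s <= r n w].
  have [s0|s0] := leP s 0.
    rewrite (_ : [set _ | _] = setT); first exact: measurableT.
    apply/seteqP; split => // w _ /=; apply: (le_trans s0).
    by have /andP[] := r_unit n w.
  rewrite (_ : [set _ | _] = \bigcap_k
      [set w | s ^+ k.+1 <= power_sum k w - series (fun i => r i w ^+ k.+1) n]).
    apply: bigcapT_measurable => k; rewrite -[X in measurable X]setTI.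
    apply: measurable_fun_le => //.
    apply: measurable_funB; first exact: msumqW.
    rewrite /series/=; under eq_fun do rewrite big_mkord.
    by apply: measurable_sum => i; apply: measurable_funX; exact: IH.
  apply/seteqP; split => w /=.
    move=> sr k _ /=; rewrite lerBrDl; apply: le_trans (power_sum_ge k n.+1 w).
    rewrite seriesSr lerD2l lerXn2r ?nnegrE ?(ltW s0)//.
    by have /andP[] := r_unit n w.
  move=> h; rewrite leNgt; apply/negP => rs.
  have rn0 : 0 <= r n w by have /andP[] := r_unit n w.
  have key k : s <= (r n w / s) ^+ k * power_sum 0 w.
    have := h k I; rewrite /= => hk.
    have := le_trans hk (_ : _ <= r n w ^+ k * power_sum 0 w) => /(_ _).
    rewrite expr_div_n mulrAC ler_pdivlMr ?exprn_gt0// -exprS; apply.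
    by have := power_sum_tail k n w; lra.
  have : (r n w / s) ^+ k * power_sum 0 w @[k --> \oo] --> 0 * power_sum 0 w.
    apply: cvgMl; apply: cvg_expr.
    by rewrite ger0_norm ?divr_ge0 ?(ltW s0)// ltr_pdivrMr// mul1r.
  rewrite mul0r => /cvgrPdist_lt/(_ _ s0)[k _ /(_ k (leqnn k))].
  rewrite sub0r normrN => /(le_lt_trans (ler_norm _)).
  by rewrite ltNge key.
move=> mT; apply: (measurability _ (RGenCInfty.measurableE R)) => //.
move=> _ [_ [s ->] <-]; rewrite setTI.
rewrite (_ : _ @^-1` _ = [set w | s <= r n w]); first exact: mset.
by apply/seteqP; split => w /=; rewrite in_itv/= andbT.
Qed.

Let mq i : measurable_fun setT (q i).
Proof.
have := measurable_funN (measurableT_comp (@measurable_ln R) (measurable_funB (measurable_cst (1 : R)) (mr i))).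
congr measurable_fun; apply/funext => w /=.
by rewrite /r opprB addrC subrK expRK opprK.
Qed.

(** The first-order expansion yields the sums of 1 - e^(- x q_i) over the masses
    q_i, differences in x yield the power sums of 1 - e^(- q_i), and the terms
    are read off from these in decreasing order. *)
Lemma measurable_from_symmetric_products : measurable_fun setT Psi.
Proof.
have mT : measurable_fun setT (fun w => expR (Psi w).2).
  apply: (measurable_fun_cvg (h := fun n w => series (q^~ w) n)).
    move=> n; rewrite /series/=; under eq_fun do rewrite big_mkord.
    by apply: measurable_sum => i; exact: mq.
  by move=> w _; exact: q_series.
have m2 : measurable_fun setT (fun w => (Psi w).2).
  have := measurableT_comp (@measurable_ln R) mT.
  by congr measurable_fun; apply/funext => w /=; rewrite expRK.
have m1 : measurable_fun setT (fun w => (Psi w).1).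
  apply: measurable_to_simplex => i.
  have := measurable_funM (mq i) (measurableT_comp (@measurable_expR R) (measurable_funN m2)).
  congr measurable_fun; apply/funext => w /=.
  by rewrite /q mulrAC -expRD subrr expR0 mul1r.
have := measurable_fun_pair m1 m2.
by congr measurable_fun; apply/funext => w /=; case: (Psi w).
Qed.

End recover.

Lemma symmetric_products_determine {R : realType} (A : set (simplex R * R)) :
  measurable A -> bclosure symmetric_products (\1_A).
Proof.
apply: bclosure_indic.
- exact: symmetric_products1.
- exact: symmetric_productsM.
- exact: symmetric_products_bounded.
- by move=> d' T' Psi; exact: measurable_from_symmetric_products.
Qed.

(** * Laplace transforms on a probability space *)

Section bounded_on_probability.
Context {R : realType} d (T : measurableType d) (P : probability T R).
Implicit Types F : T -> R.

Lemma bounded_integrable F M : measurable_fun setT F -> (forall x, `|F x| <= M) ->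
  P.-integrable setT (EFin \o F).
Proof.
move=> mF FM; apply: measurable_bounded_integrable => //.
  by rewrite (le_lt_trans (probability_le1 P measurableT))// ltry.
exists M; split; first by rewrite num_real.
by move=> y My x _ /=; rewrite (le_trans (FM x))// ltW.
Qed.

Lemma unit_integrable F : measurable_fun setT F -> (forall x, 0 <= F x <= 1) ->
  P.-integrable setT (EFin \o F).
Proof.
move=> mF F01; apply: (@bounded_integrable F 1) => // x.
by have /andP[F0 F1] := F01 x; rewrite ger0_norm.
Qed.

Lemma EFin_Rintegral F : P.-integrable setT (EFin \o F) ->
  (\int[P]_x F x)%:E = (\int[P]_x (F x)%:E)%E.
Proof. by move=> iF; rewrite /Rintegral fineK//; exact: integrable_fin_num. Qed.

Lemma bounded_cvg_integral (F_ : nat -> T -> R) F M :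
  (forall n, measurable_fun setT (F_ n)) -> (forall n x, `|F_ n x| <= M) ->
  (forall x, F_ n x @[n --> \oo] --> F x) ->
  (\int[P]_x (F_ n x)%:E)%E @[n --> \oo] --> (\int[P]_x (F x)%:E)%E.
Proof.
move=> mF FM FF.
apply: (@dominated_cvg _ _ _ P setT measurableT (fun n => EFin \o F_ n) _ (cst M%:E)) => //.
- by move=> n; exact/measurable_EFinP.
- by move=> x _; apply: cvg_EFin; [near=> n|exact: FF].
- by apply: (@bounded_integrable (cst M) `|M|).
- by move=> n x _; rewrite lee_fin.
Unshelve. all: by end_near. Qed.

Lemma probability_integral_cst (c : R) : (\int[P]_x c%:E = c%:E)%E.
Proof. by rewrite (integral_cst P measurableT c%:E)/= probability_setT mule1. Qed.

Lemma probability_Rintegral_cst (c : R) : \int[P]_x c = c.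
Proof.
apply: EFin_inj; rewrite EFin_Rintegral ?probability_integral_cst//.
exact: (@bounded_integrable _ `|c|).
Qed.

End bounded_on_probability.

Section laplace_transform.
Context {R : realType} d (S : measurableType d) (U : probability S R).
Variable f : S -> R.
Hypotheses (mf : measurable_fun setT f) (f0 : forall s, 0 <= f s).

Definition laplace (q : R) : R := \int[U]_s expR (- (q * f s)).

Let mexp q : measurable_fun setT (fun s => expR (- (q * f s))).
Proof.
by apply: measurable_exp_scaled.
Qed.

Lemma laplaceE q : 0 <= q -> ((laplace q)%:E = \int[U]_s (expR (- (q * f s)))%:E)%E.
Proof.
move=> q0; rewrite EFin_Rintegral//; apply: unit_integrable => // s.
exact: exp_unit.
Qed.

Lemma laplace_unit q : 0 <= q -> 0 <= laplace q <= 1.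
Proof.
move=> q0; rewrite Rintegral_ge0/=; last by move=> s _; exact: expR_ge0.
rewrite -lee_fin laplaceE// -(probability_integral_cst U 1).
apply: ge0_le_integral => //.
- exact/measurable_EFinP.
- by move=> s _; rewrite lee_fin; have /andP[] := exp_unit q0 (f0 s).
Qed.

Lemma laplace0 : laplace 0 = 1.
Proof.
apply: EFin_inj; rewrite laplaceE// -(probability_integral_cst U 1).
by apply: eq_integral => s _; rewrite mul0r oppr0 expR0.
Qed.

Lemma laplace_noninc q q' : 0 <= q -> q <= q' -> laplace q' <= laplace q.
Proof.
move=> q0 qq'; have q'0 := le_trans q0 qq'.
rewrite -lee_fin !laplaceE//; apply: ge0_le_integral => //.
- exact/measurable_EFinP.
- exact/measurable_EFinP.
- by move=> s _; rewrite lee_fin ler_expR lerN2 ler_wpM2r.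
Qed.

(** A bound on f limits how fast its Laplace transform can decrease. *)
Lemma laplace_superexp M q q' : (forall s, f s <= M) -> 0 <= q -> 0 <= q' ->
  expR (- (M * q')) * laplace q <= laplace (q + q').
Proof.
move=> fM q0 q'0; rewrite -lee_fin EFinM !laplaceE ?addr_ge0//.
rewrite -ge0_integralZl_EFin//.
- apply: ge0_le_integral => //.
  + by apply/measurable_EFinP; apply: measurable_funM => //; exact: measurable_cst.
  + exact/measurable_EFinP.
  + move=> s _; rewrite -EFinM lee_fin -expRD ler_expR mulrDl opprD addrC lerD2l.
    by rewrite lerN2 mulrC ler_wpM2r.
- exact/measurable_EFinP.
Qed.

Lemma measurable_exp_pair d' (T : measurableType d') (g : T -> R) :
  measurable_fun setT g ->
  measurable_fun setT (fun z : T * S => expR (- (g z.1 * f z.2))).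
Proof.
move=> mg; apply: measurableT_comp => //; apply: measurable_funN.
apply: measurable_funM; first exact: measurableT_comp mg measurable_fst.
exact: measurableT_comp mf measurable_snd.
Qed.

Lemma measurable_laplace d' (T : measurableType d') (g : T -> R) :
  measurable_fun setT g -> measurable_fun setT (fun x => laplace (g x)).
Proof.
move=> mg.
apply: (measurableT_comp (f := fine) (g := fubini_F U
  (fun z : T * S => (expR (- (g z.1 * f z.2)))%:E))) => //.
apply: measurable_fun_fubini_tonelli_F => [|z]; last by rewrite lee_fin expR_ge0.
by apply/measurable_EFinP; exact: measurable_exp_pair.
Qed.

(** The hypothesis is linear in each e^(- t_j Z_j), so each t_j may be replaced
    by an independent sample of f, one index after the other. *)
Lemma laplace_product d' (T : measurableType d') (P : probability T R)
    (N : nat) (Z : nat -> T -> R) (e : nat -> R) :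
  (forall j, measurable_fun setT (Z j)) -> (forall j w, 0 <= Z j w) ->
  (forall t : nat -> R, (forall j, 0 <= t j) ->
    (\int[P]_w (\prod_(j < N) expR (- (t j * Z j w)))%:E =
     (\prod_(j < N) expR (- (e j * ln (1 + t j))))%:E)%E) ->
  (forall j, 0 <= e j) ->
  (\int[P]_w (\prod_(j < N) laplace (Z j w))%:E =
   (\prod_(j < N) \int[U]_s expR (- (e j * ln (1 + f s))))%:E)%E.
Proof.
move=> mZ Z0 PZ e0.
pose G k (t : nat -> R) j w :=
  if (j < k)%N then laplace (Z j w) else expR (- (t j * Z j w)).
pose H k (t : nat -> R) j : R :=
  if (j < k)%N then \int[U]_s expR (- (e j * ln (1 + f s)))
  else expR (- (e j * ln (1 + t j))).
have G01 k t j w : (forall j, 0 <= t j) -> 0 <= G k t j w <= 1.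
  move=> t0; rewrite /G; case: ifP => _; first exact: laplace_unit.
  exact: exp_unit.
have mG k t j : measurable_fun setT (G k t j).
  rewrite /G; case: (j < k)%N; first exact: measurable_laplace.
  by apply: measurable_exp_scaled.
have mln : measurable_fun setT (fun s => ln (1 + f s)).
  by apply: measurableT_comp => //; apply: measurable_funD => //; exact: measurable_cst.
have ie j : U.-integrable setT (EFin \o (fun s => expR (- (e j * ln (1 + f s))))).
  apply: unit_integrable.
    by apply: measurable_exp_scaled.
  move=> s; rewrite expR_ge0/= -[leRHS]expR0 ler_expR oppr_le0 mulr_ge0// ln_ge0//.
  by rewrite lerDl.
suff main k : (k <= N)%N -> forall t, (forall j, 0 <= t j) ->
    (\int[P]_w (\prod_(j < N) G k t j w)%:E = (\prod_(j < N) H k t j)%:E)%E.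
  have := main N (leqnn N) (fun=> 0) (fun=> lexx 0).
  congr (_ = _).
    by apply: eq_integral => w _; congr EFin; apply: eq_bigr => j _; rewrite /G ltn_ord.
  by congr EFin; apply: eq_bigr => j _; rewrite /H ltn_ord.
elim: k => [_ t t0|k IH kN t t0]; first exact: PZ.
pose t_ s j := if j == k then f s else t j.
have t_0 s j : 0 <= t_ s j by rewrite /t_; case: ifP.
pose k_ := Ordinal kN.
pose rest w := \prod_(j < N | j != k_) G k t j w.
have rest01 w : 0 <= rest w.
  by apply: prodr_ge0 => j _; have /andP[] := G01 k t j w t0.
have mrest : measurable_fun setT rest.
  rewrite /rest; under eq_fun do rewrite big_mkcond/=.
  by apply: measurable_prod => j _; case: (j != k_).
have GS w : \prod_(j < N) G k.+1 t j w = laplace (Z k w) * rest w.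
  rewrite (bigD1 k_)//= {1}/G ltnSn; congr (_ * _); apply: eq_bigr => j jk.
  rewrite /G ltnS leq_eqVlt (_ : (j == k :> nat) = false)//.
  by apply/negbTE; apply: contra jk => /eqP jk; apply/eqP/val_inj.
have Gs s w : \prod_(j < N) G k (t_ s) j w = expR (- (f s * Z k w)) * rest w.
  rewrite (bigD1 k_)//= {1}/G ltnn {1}/t_ eqxx; congr (_ * _); apply: eq_bigr => j jk.
  rewrite /G /t_ (_ : (j == k :> nat) = false)//.
  by apply/negbTE; apply: contra jk => /eqP jk; apply/eqP/val_inj.
pose hrest := \prod_(j < N | j != k_) H k t j.
have HS : \prod_(j < N) H k.+1 t j =
    (\int[U]_s expR (- (e k * ln (1 + f s)))) * hrest.
  rewrite (bigD1 k_)//= {1}/H ltnSn; congr (_ * _); apply: eq_bigr => j jk.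
  rewrite /H ltnS leq_eqVlt (_ : (j == k :> nat) = false)//.
  by apply/negbTE; apply: contra jk => /eqP jk; apply/eqP/val_inj.
have Hs s : \prod_(j < N) H k (t_ s) j = expR (- (e k * ln (1 + f s))) * hrest.
  rewrite (bigD1 k_)//= {1}/H ltnn {1}/t_ eqxx; congr (_ * _); apply: eq_bigr => j jk.
  rewrite /H /t_ (_ : (j == k :> nat) = false)//.
  by apply/negbTE; apply: contra jk => /eqP jk; apply/eqP/val_inj.
have hrest0 : 0 <= hrest.
  apply: prodr_ge0 => j _; rewrite /H; case: ifP => _; last exact: expR_ge0.
  by apply: Rintegral_ge0 => s _; exact: expR_ge0.
under eq_integral do rewrite GS.
transitivity (\int[P]_w \int[U]_s (expR (- (Z k w * f s)) * rest w)%:E)%E.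
  apply: eq_integral => w _; rewrite mulrC EFinM laplaceE// -ge0_integralZl_EFin//.
  - by apply: eq_integral => s _; rewrite -EFinM mulrC.
  - by apply/measurable_EFinP; exact: mexp.
rewrite (fubini_tonelli (fun z : T * S => (expR (- (Z k z.1 * f z.2)) * rest z.1)%:E))/=.
- transitivity (\int[U]_s (expR (- (e k * ln (1 + f s))) * hrest)%:E)%E.
    apply: eq_integral => s _; rewrite -Hs -IH ?(ltnW kN)//.
    by apply: eq_integral => w _; rewrite Gs (mulrC (f s)).
  rewrite HS mulrC EFinM (EFin_Rintegral (ie k)) -ge0_integralZl_EFin//.
  + by apply: eq_integral => s _; rewrite -EFinM mulrC.
  + exact: (measurable_int _ (ie k)).
- apply/measurable_EFinP; apply: measurable_funM; first exact: measurable_exp_pair.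
  exact: measurableT_comp mrest measurable_fst.
- by move=> z; rewrite lee_fin mulr_ge0 ?expR_ge0.
Qed.

(** The lower bound is Jensen inequality, from the tangent of the exponential at
    the mean; the upper bound integrates e^(- x) <= 1 - x + x^2.  The n-th
    powers of the two differ by a factor e^(G^2 / n). *)
Lemma cvg_mean_exp (g : S -> R) (G : R) : measurable_fun setT g ->
  (forall s, 0 <= g s <= G) ->
  (\int[U]_s expR (- (n.+1%:R^-1 * g s))) ^+ n.+1 @[n --> \oo] -->
  expR (- \int[U]_s g s).
Proof.
move=> mg gG; have g0 s : 0 <= g s by have /andP[] := gG s.
have gl s : g s <= G by have /andP[] := gG s.
have G0 : 0 <= G by apply: le_trans (gl point).
have ig : U.-integrable setT (EFin \o g).
  by apply: (@bounded_integrable _ _ _ _ _ G) => // s; rewrite ger0_norm.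
set m := \int[U]_s g s.
have ie n : U.-integrable setT (EFin \o (fun s => expR (- (n.+1%:R^-1 * g s)))).
  apply: unit_integrable.
    by apply: measurable_exp_scaled.
  by move=> s; rewrite expR_ge0/= -expR0 ler_expR oppr_le0 mulr_ge0// invr_ge0.
have icst (c : R) : U.-integrable setT (EFin \o cst c).
  by apply: (@bounded_integrable _ _ _ _ _ `|c|).
have iZ (c : R) : U.-integrable setT (EFin \o (fun s => c * g s)).
  apply: (@bounded_integrable _ _ _ _ _ (`|c| * G)).
    by apply: measurable_funM => //; exact: measurable_cst.
  by move=> s; rewrite normrM ler_wpM2l// ger0_norm.
have IZ (c : R) : \int[U]_s (c * g s) = c * m by rewrite RintegralZl.
have affine (a c : R) : \int[U]_s (a + c * g s) = a + c * m.
  by rewrite RintegralD// ?probability_Rintegral_cst ?IZ//; exact: icst.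
apply: (@squeeze_cvgr _ _ _ _ (fun=> expR (- m)) (fun n => expR (- m + G ^+ 2 * n.+1%:R^-1))).
- near=> n; have N0 : 0 < n.+1%:R :> R by [].
  set A := Rintegral _ _ _.
  have A1 : expR (- (n.+1%:R^-1 * m)) <= A.
    have -> : expR (- (n.+1%:R^-1 * m)) = \int[U]_s (
        expR (- (n.+1%:R^-1 * m)) * (1 + n.+1%:R^-1 * m) +
        (- (expR (- (n.+1%:R^-1 * m)) * n.+1%:R^-1)) * g s).
      by rewrite affine; ring.
    apply: le_Rintegral => //.
      apply: (@bounded_integrable _ _ _ _ _
          (`|expR (- (n.+1%:R^-1 * m)) * (1 + n.+1%:R^-1 * m)| +
           `|- (expR (- (n.+1%:R^-1 * m)) * n.+1%:R^-1)| * G)).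
        by apply: measurable_funD => //; apply: measurable_funM => //; exact: measurable_cst.
      move=> s; rewrite (le_trans (ler_normD _ _))// lerD2l normrM ler_wpM2l//.
      by rewrite ger0_norm.
    move=> s _; set c := n.+1%:R^-1.
    rewrite (_ : - (c * g s) = - (c * m) + (c * m - c * g s)); last by ring.
    rewrite expRD.
    rewrite (_ : _ + _ = expR (- (c * m)) * (1 + (c * m - c * g s))); last by ring.
    by rewrite ler_pM2l ?expR_gt0// expR_ge1Dx.
  have A2 : A <= expR (- (n.+1%:R^-1 * m) + (n.+1%:R^-1 * G) ^+ 2).
    apply: le_trans (expR_ge1Dx _).
    have -> : 1 + (- (n.+1%:R^-1 * m) + (n.+1%:R^-1 * G) ^+ 2) =
        \int[U]_s (1 + (n.+1%:R^-1 * G) ^+ 2 + (- n.+1%:R^-1) * g s).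
      by rewrite affine; ring.
    apply: le_Rintegral => //.
      apply: (@bounded_integrable _ _ _ _ _
          (`|1 + (n.+1%:R^-1 * G) ^+ 2| + `|- n.+1%:R^-1| * G)).
        by apply: measurable_funD => //; apply: measurable_funM => //; exact: measurable_cst.
      move=> s; rewrite (le_trans (ler_normD _ _))// lerD2l normrM ler_wpM2l//.
      by rewrite ger0_norm.
    move=> s _; set c := n.+1%:R^-1.
    have c0 : 0 <= c by rewrite invr_ge0.
    have cg0 : 0 <= c * g s by rewrite mulr_ge0.
    apply: (le_trans (expR_le_quad cg0)).
    rewrite mulNr addrAC lerD2r lerD2l.
    by rewrite lerXn2r ?nnegrE ?mulr_ge0// ler_wpM2l.
  have e1 : expR (- m) = expR (- (n.+1%:R^-1 * m)) ^+ n.+1.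
    rewrite -expRM_natl; congr expR; rewrite mulrN mulrA divff ?mul1r//.
  have e2 : expR (- m + G ^+ 2 * n.+1%:R^-1) =
      expR (- (n.+1%:R^-1 * m) + (n.+1%:R^-1 * G) ^+ 2) ^+ n.+1.
    rewrite -expRM_natl; congr expR.
    by field; rewrite gt_eqF.
  rewrite e1 e2 !lerXn2r// ?nnegrE ?expR_ge0//.
  + by apply: le_trans A1; exact: expR_ge0.
  + by apply: le_trans A1; exact: expR_ge0.
- exact: cvg_cst.
- apply: continuous_cvg; first exact: continuous_expR.
  rewrite -[X in _ --> X]addr0; apply: cvgD; first exact: cvg_cst.
  rewrite -[X in _ --> X](mulr0 (G ^+ 2)); apply: cvgMr.
  by have := @cvg_harmonic R.
Unshelve. all: by end_near. Qed.

End laplace_transform.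

(** * Atoms and cells of a gamma random measure *)

Section cells.
Context {R : realType} d (S : measurableType d) (U : probability S R).
Variables (f : S -> R) (M : R).
Hypotheses (mf : measurable_fun setT f) (f0 : forall s, 0 <= f s).
Hypothesis fM : forall s, f s <= M.
Local Notation phi := (laplace U f).

(** A cell contains at most one of the first k atoms, and an empty cell
    contributes a factor 1. *)
Lemma prod_cells (c : nat -> nat) (m : nat) (q : nat -> R) k :
  (forall i, (c i < m)%N) -> {in [pred i | (i < k)%N] &, injective c} ->
  \prod_(j < m) phi (series (fun i => q i * (c i == j)%:R) k) =
  \prod_(i < k) phi (q i).
Proof.
move=> cm; elim: k => [|k IH] cinj.
  rewrite big_ord0 big1// => j _.
  by rewrite /series/= big_geq// laplace0.
rewrite big_ord_recr/= -IH; last first.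
  by move=> i i' ik i'k; apply: cinj; rewrite inE ltnS ltnW.
pose j0 := Ordinal (cm k).
rewrite (bigD1 j0)//= [X in _ = X * _](bigD1 j0)//= mulrAC; congr (_ * _); last first.
  apply: eq_bigr => j jj0; rewrite seriesSr (_ : (c k == j) = false) ?mulr0 ?addr0//.
  by apply/negbTE; apply: contra jj0 => /eqP ckj; apply/eqP/val_inj.
rewrite seriesSr eqxx mulr1 (_ : series _ k = 0) ?add0r ?laplace0 ?mul1r//.
rewrite /series/= big_nat big1// => i /andP[_ ik].
rewrite (_ : (c i == c k) = false) ?mulr0//.
apply/negbTE/eqP => /cinj; rewrite !inE => /(_ (ltnW ik) (ltnSn k)) ik'.
by rewrite ik' ltnn in ik.
Qed.

(** The cells eventually separate the first k atoms.  The other atoms have total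
    mass [tau k], and by [laplace_superexp] they change the product over cells
    by a factor at least e^(- M tau k). *)
Lemma cells_cvg (q : nat -> R) (T : R) (c : nat -> nat -> nat) (m : nat -> nat)
    (Z : nat -> nat -> R) :
  (forall i, 0 <= q i) -> series q @ \oo --> T ->
  (forall N i, (c N i < m N)%N) ->
  (forall i i', i != i' -> \forall N \near \oo, c N i != c N i') ->
  (forall N j, series (fun i => q i * (c N i == j)%:R) @ \oo --> Z N j) ->
  \prod_(j < m N) phi (Z N j) @[N --> \oo] --> iprod (fun i => phi (q i)).
Proof.
move=> q0 qT cm cdist qZ.
have M0 : 0 <= M by apply: le_trans (fM point).
pose tau k := T - series q k.
have tau0 k : 0 <= tau k.
  rewrite subr_ge0 -(cvg_lim (@Rhausdorff R) qT); apply: nondecreasing_cvgn_le.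
    by apply: nondecreasing_series => i _ _.
  by apply/cvg_ex; exists T.
have phi01 : unit_seq (fun i => phi (q i)) by move=> i; exact: laplace_unit.
have phi_exp t : 0 <= t -> expR (- (M * t)) <= phi t.
  move=> t0; have := laplace_superexp U mf f0 fM (lexx 0) t0.
  by rewrite (laplace0 U mf f0) mulr1 add0r.
pose p k := \prod_(i < k) phi (q i).
have p01 k : 0 <= p k <= 1 by exact: (@prod_unit _ (fun i => phi (q i))).
have lo_iprod k : expR (- (M * tau k)) * p k <= iprod (fun i => phi (q i)).
  apply: iprod_ge => // n; have /andP[pk0 pk1] := p01 k.
  have [nk|kn] := leqP n k.
    apply: (@le_trans _ _ (p k)); last exact: (@prod_unit_noninc _ (fun i => phi (q i))).
    rewrite -[leRHS]mul1r ler_wpM2r// -[leRHS]expR0 ler_expR oppr_le0.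
    by rewrite mulr_ge0.
  rewrite /p -!(big_mkord xpredT (fun i => phi (q i))).
  rewrite (@big_cat_nat _ _ _ k 0 n)//= ?(ltnW kn)// mulrC ler_wpM2l//.
    by rewrite big_mkord.
  apply: (@le_trans _ _ (\prod_(k <= i < n) expR (- (M * q i)))).
    rewrite -expR_sum ler_expR sumrN lerN2 -mulr_sumr ler_wpM2l//.
    rewrite -[leLHS](addKr (series q k)) addrC lerB//.
    have -> : series q k + \sum_(k <= i < n) q i = series q n.
      by rewrite /series/= [RHS](@big_cat_nat _ _ _ k 0 n)//= ltnW.
    by have := tau0 n; rewrite subr_ge0.
  by rewrite !big_nat; apply: ler_prod => i _; rewrite expR_ge0/= phi_exp.
have cells k : \forall N \near \oo,
    expR (- (M * tau k)) * p k <= \prod_(j < m N) phi (Z N j) <= p k.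
  have inj : \forall N \near \oo, {in [pred i | (i < k)%N] &, injective (c N)}.
    suff : \forall N \near \oo, forall i i' : 'I_k, i != i' -> c N i != c N i'.
      apply: filterS => N cN i i' /= ik i'k cii'; apply/eqP.
      apply: contraT => ii'; have := cN (Ordinal ik) (Ordinal i'k).
      by rewrite cii' eqxx; apply; apply: contra ii' => /eqP/(congr1 val)/= ->.
    apply: filter_forall => i; apply: filter_forall => i'.
    have [ii'|ii'] := eqVneq i i'; first by near=> N.
    by have /cdist := ii'; apply: filterS.
  near=> N; have cinj : {in [pred i | (i < k)%N] &, injective (c N)} by near: N.
  have pE : p k = \prod_(j < m N) phi (series (fun i => q i * (c N i == j)%:R) k).
    by rewrite prod_cells.
  set Z' := fun j : nat => series (fun i => q i * (c N i == j)%:R) k in pE.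
  have Z'0 j : 0 <= Z' j by apply: sumr_ge0 => i _; rewrite mulr_ge0.
  have Z'Z j : Z' j <= Z N j.
    rewrite /Z' -(cvg_lim (@Rhausdorff R) (qZ N j)); apply: nondecreasing_cvgn_le.
      by apply: nondecreasing_series => i _ _; rewrite mulr_ge0.
    by apply/cvg_ex; exists (Z N j); exact: qZ.
  have sumc n : \sum_(j < m N) series (fun i => q i * (c N i == j)%:R) n = series q n.
    rewrite /series/= exchange_big/=; apply: eq_bigr => i _.
    rewrite -mulr_sumr (bigD1 (Ordinal (cm N i)))//= eqxx big1 ?addr0 ?mulr1// => j jc.
    rewrite (_ : (c N i == j) = false)//; apply/negbTE; apply: contra jc.
    by move=> /eqP cij; apply/eqP/val_inj.
  have sumZ : \sum_(j < m N) Z N j = T.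
    apply: (cvg_unique (@Rhausdorff R) _ qT).
    rewrite -(funext sumc)/=.
    elim: (m N) => [|k' IH].
      by rewrite big_ord0; under eq_cvg do rewrite big_ord0; exact: cvg_cst.
    rewrite big_ord_recr/=; under eq_cvg do rewrite big_ord_recr/=.
    exact: cvgD.
  have sumZZ' : \sum_(j < m N) (Z N j - Z' j) = tau k.
    by rewrite sumrB sumZ /Z' sumc.
  rewrite pE; apply/andP; split.
    rewrite -sumZZ' mulr_sumr -sumrN expR_sum -big_split/=.
    apply: ler_prod => j _; rewrite mulr_ge0 ?expR_ge0//=; last first.
      by have /andP[] := laplace_unit U mf f0 (Z'0 j).
    rewrite -[X in _ <= phi X](subrKC (Z' j)).
    by apply: (laplace_superexp U mf f0 fM (Z'0 j)); rewrite subr_ge0.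
  apply: ler_prod => j _; have Zj0 := le_trans (Z'0 j) (Z'Z j).
  have /andP[-> _] := laplace_unit U mf f0 Zj0.
  exact: (laplace_noninc U mf f0 (Z'0 j) (Z'Z j)).
have tau_cvg : M * tau k @[k --> \oo] --> 0.
  rewrite -[X in _ --> X](mulr0 M); apply: cvgMr; rewrite -[X in _ --> X](subrr T).
  by apply: cvgB => //; exact: cvg_cst.
apply/cvgrPdist_lt => e e0.
have /cvgrPdist_lt/(_ _ e0)[k _ /(_ k (leqnn k))] := tau_cvg.
rewrite /= sub0r normrN ger0_norm ?mulr_ge0// => taue.
have := cells k; apply: filterS => N /andP[h1 h2].
have h3 := lo_iprod k; have h4 : iprod (fun i => phi (q i)) <= p k by exact: iprod_le.
have h5 : 1 - M * tau k <= expR (- (M * tau k)) by exact: expR_ge1Dx.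
have /andP[pk0 pk1] := p01 k.
have h6 : p k - expR (- (M * tau k)) * p k <= M * tau k.
  have : expR (- (M * tau k)) <= 1 by rewrite -expR0 ler_expR oppr_le0 mulr_ge0.
  by move: (expR _) h5 => E h5 E1; nra.
by rewrite ltr_norml; apply/andP; split; lra.
Unshelve. all: by end_near. Qed.

End cells.

Lemma Rintegral_step {R : realType} d (T : measurableType d)
    (mu : {measure set T -> \bar R}) (D : set T) (C : nat -> set T) (t : nat -> R) N :
  measurable D -> (mu D < +oo)%E -> (forall j, measurable (C j)) ->
  (forall j, 0 <= t j) ->
  \int[mu]_(x in D) (\sum_(j < N) t j * \1_(C j) x) =
  \sum_(j < N) t j * fine (mu (C j `&` D)).
Proof.
move=> mD muD mC t0.
have fin j : (mu (C j `&` D) \is a fin_num)%E.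
  rewrite ge0_fin_numE//; apply: le_lt_trans muD.
  by apply: le_measure => //; rewrite ?inE//; exact: measurableI.
rewrite /Rintegral.
under eq_integral do rewrite -sumEFin.
rewrite ge0_integral_sum//.
- rewrite (eq_bigr (fun j : 'I_N => (t j * fine (mu (C j `&` D)))%:E)).
    by rewrite sumEFin.
  move=> j _; rewrite EFinM fineK//.
  under eq_integral do rewrite EFinM.
  rewrite ge0_integralZl_EFin//; first by rewrite integral_indic.
  by apply/measurable_EFinP; exact: measurable_indic.
- move=> j; apply/measurable_EFinP; apply: measurable_funM; first exact: measurable_cst.
  exact: measurable_indic.
- by move=> j x _; rewrite lee_fin mulr_ge0.
Qed.

Section gamma_random_measure_laplace.
Context {R : realType} (theta : R) d (Om : measurableType d) (P : probability Om R).
Variables (eta : R.-ker Om ~> R) (Q X : nat -> {RV P >-> R}).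
Hypothesis theta_gt0 : 0 < theta.
Hypothesis eta_gamma : gamma_random_measure theta eta Q X.

Let mass_finite : forall w, (eta w setT < +oo)%E.
Proof. by case: eta_gamma. Qed.

Lemma mass_ge0 i w : 0 <= Q i w.
Proof. by case: eta_gamma => _ /(_ w i) /andP[a b] _ _ _; exact: le_trans b. Qed.

Lemma position_itv i w : 0 <= X i w <= 1.
Proof. by case: eta_gamma => _ _ /(_ w) [_ /(_ i)]. Qed.

Lemma measurable_unit_itv : measurable (unit_itv R).
Proof. exact: measurable_itv. Qed.

Lemma unit_itvE (x : R) : unit_itv R x <-> 0 <= x <= 1.
Proof. by rewrite /unit_itv /= in_itv. Qed.

Lemma lebesgue_unit_itv_lty : (@lebesgue_measure R (unit_itv R) < +oo)%E.
Proof. by rewrite /unit_itv lebesgue_measure_itv/= lte_fin ltr01 sube0 ltry. Qed.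

Definition cell_mass (C : set R) w : R := fine (eta w (C `&` unit_itv R)).

Lemma cell_mass_cvg C w : measurable C ->
  series (fun i => Q i w * \1_C (X i w)) @ \oo --> cell_mass C w.
Proof.
move=> mC; have [_ _ _ etaE _] := eta_gamma.
have mCI : measurable (C `&` unit_itv R).
  by apply: measurableI => //; exact: measurable_unit_itv.
have fin : (eta w (C `&` unit_itv R) \is a fin_num)%E.
  rewrite ge0_fin_numE//; apply: le_lt_trans (mass_finite w).
  by apply: le_measure; rewrite ?inE//; exact: measurableT.
have : (\sum_(0 <= i < n) ((Q i w)%:E * \d_(X i w) (C `&` unit_itv R))%E)%R @[n --> \oo] -->
    (cell_mass C w)%:E.
  rewrite /cell_mass fineK// etaE//; apply: is_cvg_nneseries => i _ _.
  by rewrite mule_ge0// lee_fin mass_ge0.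
move/fine_cvgP => [_]; apply: cvg_trans; apply: near_eq_cvg; near=> n => /=.
rewrite /series/= (eq_bigr (fun i => (Q i w * \1_C (X i w))%:E)) ?sumEFin//.
move=> i _; rewrite diracE EFinM indicE; congr (_ * (_%:R)%:E)%E; congr (nat_of_bool _).
rewrite in_setI andb_idr// => _; rewrite inE.
by apply/unit_itvE; exact: position_itv.
Unshelve. all: by end_near. Qed.

Lemma cell_mass_ge0 C w : 0 <= cell_mass C w.
Proof. exact: fine_ge0. Qed.

Lemma measurable_cell_mass C : measurable C -> measurable_fun setT (cell_mass C).
Proof.
move=> mC; apply: measurableT_comp => //; apply: measurable_kernel.
by apply: measurableI => //; exact: measurable_unit_itv.
Qed.

(** The masses of disjoint cells are independent gamma variables. *)
Lemma step_laplace (C : nat -> set R) (t : nat -> R) N :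
  (forall j, measurable (C j)) -> trivIset setT C -> (forall j, 0 <= t j) ->
  (\int[P]_w (\prod_(j < N) expR (- (t j * cell_mass (C j) w)))%:E =
   (\prod_(j < N) expR (- (theta * fine (@lebesgue_measure R (C j `&` unit_itv R))
      * ln (1 + t j))))%:E)%E.
Proof.
move=> mC tC t0; have [_ _ _ _ lap] := eta_gamma.
pose a x := \sum_(j < N) t j * \1_(C j) x.
have a0 x : 0 <= a x by apply: sumr_ge0 => j _; rewrite mulr_ge0.
have ma : measurable_fun setT a.
  apply: measurable_sum => j; apply: measurable_funM; first exact: measurable_cst.
  exact: measurable_indic.
have := lap a (measurable_funTS ma).
have aM x : a x <= \sum_(j < N) t j.
  apply: ler_sum => j _; rewrite -[leRHS]mulr1 ler_wpM2l//.
have aB : exists M : R, forall x : R, 0 <= x <= 1 -> 0 <= a x <= M.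
  by exists (\sum_(j < N) t j) => x _; rewrite a0 aM.
move=> /(_ aB).
rewrite unlock; congr (_ = _).
  apply: eq_integral => w _; congr EFin.
  rewrite Rintegral_step//; first by rewrite -sumrN expR_sum.
    exact: measurable_unit_itv.
  by apply: le_lt_trans (mass_finite w); apply: le_measure; rewrite ?inE//; exact: measurable_unit_itv.
congr EFin; rewrite -expR_sum sumrN; congr (expR (- _)).
have lnE x : ln (1 + a x) = \sum_(j < N) ln (1 + t j) * \1_(C j) x.
  have [[j0 Cj0]|none] := pselect (exists j : 'I_N, C j x).
    have Cj j : j != j0 -> \1_(C j) x = 0 :> R.
      move=> jj0; rewrite indicE memNset// => Cjx; move/eqP : jj0; apply.
      by apply/val_inj; apply: (tC _ _ I I); exists x.
    rewrite /a !(bigD1 j0 (P := xpredT))//= !big1 ?addr0; last 2 first.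
      by move=> j /Cj ->; rewrite mulr0.
      by move=> j /Cj ->; rewrite mulr0.
    by rewrite indicE mem_set// !mulr1.
  have Cj (j : 'I_N) : \1_(C j) x = 0 :> R.
    by rewrite indicE memNset// => Cjx; apply: none; exists j.
  rewrite /a !big1 ?addr0 ?ln1//.
    by move=> j _; rewrite Cj mulr0.
  by move=> j _; rewrite Cj mulr0.
under eq_Rintegral do rewrite lnE.
rewrite (@Rintegral_step _ _ _ (@lebesgue_measure R) _ C (fun j => ln (1 + t j)))//.
- by rewrite mulr_sumr; apply: eq_bigr => j _; rewrite -mulrA [_ * ln _]mulrC.
- exact: measurable_unit_itv.
- exact: lebesgue_unit_itv_lty.
- by move=> j; rewrite ln_ge0// lerDl.
Qed.

End gamma_random_measure_laplace.

(** * The marked Laplace functional of the gamma measure *)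

Section grid.
Context {R : realType}.

Definition grid_cell (N j : nat) : set R :=
  `[j%:R / N.+1%:R, j.+1%:R / N.+1%:R[%classic.

Lemma measurable_grid_cell N j : measurable (grid_cell N j).
Proof. exact: measurable_itv. Qed.

Lemma grid_cellE N j x : 0 <= x -> grid_cell N j x <-> Num.trunc (N.+1%:R * x) = j.
Proof.
move=> x0; rewrite /grid_cell /= in_itv/= ler_pdivrMr// ltr_pdivlMr// mulrC.
by split => [/truncn_def//|<-]; apply: truncn_itv; rewrite mulr_ge0.
Qed.

Lemma trivIset_grid_cell N : trivIset setT (grid_cell N).
Proof.
move=> i j _ _ [x [xi xj]].
have x0 : 0 <= x.
  by move: xi; rewrite /grid_cell /= in_itv/= => /andP[h _]; apply: le_trans h; exact: divr_ge0.
by move/(grid_cellE _ _ x0) : xi => <-; move/(grid_cellE _ _ x0) : xj.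
Qed.

Lemma lebesgue_grid_cell N j :
  @lebesgue_measure R (grid_cell N j) = (N.+1%:R^-1)%:E.
Proof.
rewrite lebesgue_measure_itv/= lte_fin ltr_pM2r ?invr_gt0// ltr_nat ltnSn/=.
by rewrite -EFinB -mulrBl -natrB// subSnn mul1r.
Qed.

Lemma grid_cell_measure N j : (j < N.+1)%N ->
  fine (@lebesgue_measure R (grid_cell N j `&` unit_itv R)) = N.+1%:R^-1.
Proof.
move=> jN; rewrite setIidl; first by rewrite lebesgue_grid_cell.
move=> x; rewrite /grid_cell /unit_itv /= !in_itv/= => /andP[jx xj].
rewrite (le_trans _ jx) ?divr_ge0//= ltW// (lt_le_trans xj)//.
by rewrite ler_pdivrMr// mul1r ler_nat.
Qed.

(** An atom at the right end of the unit interval falls in this additional cell. *)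
Lemma grid_cell_measure_last N :
  fine (@lebesgue_measure R (grid_cell N N.+1 `&` unit_itv R)) = 0.
Proof.
rewrite (_ : _ `&` _ = [set 1]) ?lebesgue_measure_set1//.
apply/seteqP; split => x; rewrite /grid_cell /unit_itv /= !in_itv/= divff ?pnatr_eq0//.
  by move=> [/andP[x1 _] /andP[_ x1']]; apply/le_anti; rewrite x1 x1'.
move=> ->; rewrite !lexx ler01/=; split => //.
by rewrite ltr_pdivlMr// mul1r ltr_nat.
Qed.

Lemma grid_separates (x y : R) : 0 <= x -> 0 <= y -> x != y ->
  \forall N \near \oo, Num.trunc (N.+1%:R * x) != Num.trunc (N.+1%:R * y).
Proof.
move=> x0 y0 xy; have d0 : 0 < `|x - y| by rewrite normr_gt0 subr_eq0.
near=> N; apply/eqP => txy.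
have /andP[a b] := @truncn_itv R (N.+1%:R * x) (mulr_ge0 (ler0n _ _) x0).
have /andP[c e] := @truncn_itv R (N.+1%:R * y) (mulr_ge0 (ler0n _ _) y0).
have : `|x - y|^-1 < N.+1%:R.
  apply: (lt_le_trans (truncnS_gt _)); rewrite ler_nat ltnS.
  by near: N; exact: nbhs_infty_ge.
rewrite -[X in X < _]mul1r ltr_pdivrMr//.
rewrite -(ger0_norm (ler0n R N.+1)) -normrM mulrBr.
rewrite txy in a b; move: a b c e; rewrite -(natr1 (Num.trunc _)) => a b c e.
by rewrite ltNge ltW// ltr_norml; apply/andP; split; lra.
Unshelve. all: by end_near. Qed.

End grid.

Section gamma_laplace_functional.
Context {R : realType} (theta : R) d (Om : measurableType d) (P : probability Om R).
Variables (eta : R.-ker Om ~> R) (Q X : nat -> {RV P >-> R}).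
Hypothesis theta_gt0 : 0 < theta.
Hypothesis eta_gamma : gamma_random_measure theta eta Q X.
Context d' (S : measurableType d') (U : probability S R).

Let Q0 := mass_ge0 eta_gamma.

Lemma measurable_mass i : measurable_fun setT (Q i).
Proof. exact: measurable_funP. Qed.

(** Replace the product over atoms by a product over the cells of a grid, where
    [laplace_product] computes the expectation, and refine the grid. *)
Lemma laplace_functional_bounded (f : S -> R) M : measurable_fun setT f ->
  (forall s, 0 <= f s <= M) ->
  (\int[P]_w (iprod (fun i => laplace U f (Q i w)))%:E =
   (expR (- (theta * \int[U]_s ln (1 + f s))))%:E)%E.
Proof.
move=> mf f01.
have f0 s : 0 <= f s by have /andP[] := f01 s.
have fM s : f s <= M by have /andP[] := f01 s.
pose Z N j := cell_mass eta (grid_cell N j).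
have Z0 N j w : 0 <= Z N j w by exact: cell_mass_ge0.
have mZ N j : measurable_fun setT (Z N j).
  by apply: measurable_cell_mass; exact: measurable_grid_cell.
have mln : measurable_fun setT (fun s => ln (1 + f s)).
  by apply: measurableT_comp => //; apply: measurable_funD => //; exact: measurable_cst.
have ln0 s : 0 <= ln (1 + f s) by rewrite ln_ge0// lerDl.
have lhs : (\int[P]_w (\prod_(j < N.+2) laplace U f (Z N j w))%:E)%E @[N --> \oo] -->
    (\int[P]_w (iprod (fun i => laplace U f (Q i w)))%:E)%E.
  apply: (@bounded_cvg_integral _ _ _ _ _ _ 1).
  - move=> N; apply: measurable_prod => j _; exact: measurable_laplace.
  - move=> N w; rewrite ger0_norm.
      by apply: prodr_ile1 => j _; exact: laplace_unit.
    by apply: prodr_ge0 => j _; have /andP[] := laplace_unit U mf f0 (Z0 N j w).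
  - move=> w.
    have sQ := cell_mass_cvg eta_gamma (w := w) (@measurableT _ R).
    apply: (cells_cvg mf f0 fM (m := fun N => N.+2)
      (Z := fun N j => Z N j w) (q := fun i => Q i w) (T := cell_mass eta setT w)
      (c := fun N i => Num.trunc (N.+1%:R * X i w))).
    + by [].
    + move: sQ; rewrite (_ : (fun i => _) = (fun i => Q i w))//.
      by apply/funext => i; rewrite indicT mulr1.
    + move=> N i; have /andP[x0 x1] := position_itv eta_gamma i w.
      rewrite truncn_lt_nat ?mulr_ge0//.
      apply: (@le_lt_trans _ _ N.+1%:R); last by rewrite ltr_nat.
      by rewrite -[leRHS]mulr1 ler_wpM2l.
    + move=> i i' ii'.
      have /andP[x0 _] := position_itv eta_gamma i w.
      have /andP[x'0 _] := position_itv eta_gamma i' w.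
      apply: grid_separates => //; apply: contra ii' => /eqP xx'.
      have [_ _ /(_ w) [inj _] _ _] := eta_gamma.
      by apply/eqP; apply: inj.
    + move=> N j; have := cell_mass_cvg eta_gamma (w := w) (measurable_grid_cell N j).
      rewrite (_ : (fun i => _) =
        (fun i => Q i w * (Num.trunc (N.+1%:R * X i w) == j)%:R))//.
      apply/funext => i; have /andP[x0 _] := position_itv eta_gamma i w.
      rewrite indicE; congr (_ * (nat_of_bool _)%:R).
      by apply/idP/eqP; rewrite inE => /(grid_cellE _ _ x0).
have rhs N : (\int[P]_w (\prod_(j < N.+2) laplace U f (Z N j w))%:E)%E =
    ((\int[U]_s expR (- (N.+1%:R^-1 * (theta * ln (1 + f s))))) ^+ N.+1)%:E.
  rewrite (laplace_product U mf f0 (e := fun j => theta *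
    fine (@lebesgue_measure R (grid_cell N j `&` unit_itv R))))//.
  - rewrite big_ord_recr/= grid_cell_measure_last.
    under [X in _ * X]eq_Rintegral do rewrite mulr0 mul0r oppr0 expR0.
    rewrite probability_Rintegral_cst mulr1.
    congr EFin; rewrite -[in RHS](card_ord N.+1) -prodr_const; apply: eq_bigr => j _.
    apply: eq_Rintegral => s _; rewrite grid_cell_measure ?ltn_ord//.
    by rewrite card_ord mulrA (mulrC theta).
  - move=> t t0; rewrite (step_laplace eta_gamma)//.
    + by move=> j; exact: measurable_grid_cell.
    + exact: trivIset_grid_cell.
  - by move=> j; rewrite mulr_ge0 ?(ltW theta_gt0)// fine_ge0.
have : ((\int[U]_s expR (- (n.+1%:R^-1 * (theta * ln (1 + f s))))) ^+ n.+1)%:E @[n --> \oo]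
    --> (expR (- \int[U]_s (theta * ln (1 + f s))))%:E.
  apply: cvg_EFin; first by near=> n.
  apply: (@cvg_mean_exp _ _ _ _ _ (theta * ln (1 + M))).
    by apply: measurable_funM => //; exact: measurable_cst.
  move=> s; rewrite mulr_ge0 ?(ltW theta_gt0)//= ler_wpM2l ?(ltW theta_gt0)//.
  by rewrite ler_ln ?posrE ?lerD2l// ltr_pwDl//; apply: le_trans (fM s).
rewrite RintegralZl//; last first.
  apply: (@bounded_integrable _ _ _ _ _ (ln (1 + M))) => // s.
  rewrite ger0_norm//.
  by rewrite ler_ln ?posrE ?lerD2l// ltr_pwDl//; apply: le_trans (fM s).
move=> h; rewrite (funext rhs) in lhs.
exact: (cvg_unique _ lhs h).
Unshelve. all: by end_near. Qed.

(** Truncate f and let the level of truncation grow. *)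
Lemma laplace_functional (f : S -> R) : measurable_fun setT f ->
  (forall s, 0 <= f s) -> U.-integrable setT (EFin \o (fun s => ln (1 + f s))) ->
  (\int[P]_w (iprod (fun i => laplace U f (Q i w)))%:E =
   (expR (- (theta * \int[U]_s ln (1 + f s))))%:E)%E.
Proof.
move=> mf f0 iln.
pose fm (m : nat) s := Num.min (f s) m%:R.
have fm0 m s : 0 <= fm m s by rewrite le_min f0/=.
have fmf m s : fm m s <= f s by rewrite ge_min lexx.
have mfm m : measurable_fun setT (fm m).
  by apply: measurable_minr => //; exact: measurable_cst.
have fm_cvg s : fm m s @[m --> \oo] --> f s.
  apply: cvg_near_cst; near=> m; rewrite /fm min_l//.
  by apply: (le_trans (ltW (truncnS_gt _))); rewrite ler_nat; near: m; exact: nbhs_infty_ge.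
have e01 (g : S -> R) q s : 0 <= q -> (forall s, 0 <= g s) -> 0 <= expR (- (q * g s)) <= 1.
  by move=> q0 g0; rewrite expR_ge0/= -expR0 ler_expR oppr_le0 mulr_ge0.
have mexp (g : S -> R) q : measurable_fun setT g ->
    measurable_fun setT (fun s => expR (- (q * g s))).
  move=> mg; by apply: measurable_exp_scaled.
have lap_cvg q : 0 <= q -> laplace U (fm m) q @[m --> \oo] --> laplace U f q.
  move=> q0; apply: (@fine_cvg _ _ _ _ (fun m => (\int[U]_s (expR (- (q * fm m s)))%:E)%E)).
  rewrite -/(laplace U f q) laplaceE//.
  apply: (@bounded_cvg_integral _ _ _ _ _ _ 1).
  - by move=> n; exact: mexp.
  - by move=> n s; have /andP[? ?] := e01 (fm n) q s q0 (fm0 n); rewrite ger0_norm.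
  - move=> s; apply: continuous_cvg; first exact: continuous_expR.
    by apply: cvgN; apply: cvgMr; exact: fm_cvg.
have lhs : (\int[P]_w (iprod (fun i => laplace U (fm m) (Q i w)))%:E)%E @[m --> \oo] -->
    (\int[P]_w (iprod (fun i => laplace U f (Q i w)))%:E)%E.
  apply: (@bounded_cvg_integral _ _ _ _ _ _ 1).
  - move=> m; apply: measurable_iprod => //.
      by move=> i; apply: measurable_laplace => //; exact: measurable_mass.
    by move=> w _ i; exact: laplace_unit.
  - move=> m w; have /andP[? ?] : 0 <= iprod (fun i => laplace U (fm m) (Q i w)) <= 1.
      by apply: iprod_unit => i; exact: laplace_unit.
    by rewrite ger0_norm.
  - move=> w; apply: iprod_cvg_above.
    + by move=> i; exact: laplace_unit.
    + by move=> m i; exact: laplace_unit.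
    + move=> m i; rewrite -lee_fin !laplaceE//.
      apply: ge0_le_integral => //; [exact/measurable_EFinP/mexp|exact/measurable_EFinP/mexp|].
      by move=> s _; rewrite lee_fin ler_expR lerN2 ler_wpM2l.
    + by move=> i; exact: lap_cvg.
have ln_mono (x y : R) : 0 <= x -> x <= y -> ln (1 + x) <= ln (1 + y).
  move=> x0 xy; rewrite ler_ln ?posrE ?lerD2l// ltr_pwDl//.
  exact: le_trans xy.
have ln_ge (x : R) : 0 <= x -> 0 <= ln (1 + x) by move=> x0; rewrite ln_ge0// lerDl.
have mln (g : S -> R) : measurable_fun setT g -> measurable_fun setT (fun s => ln (1 + g s)).
  by move=> mg; apply: measurableT_comp => //; apply: measurable_funD => //; exact: measurable_cst.
have rhs : \int[U]_s ln (1 + fm m s) @[m --> \oo] --> \int[U]_s ln (1 + f s).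
  apply: (@fine_cvg _ _ _ _ (fun m => (\int[U]_s (ln (1 + fm m s))%:E)%E)).
  rewrite EFin_Rintegral//.
  apply: (@dominated_cvg _ _ _ U setT measurableT
     (fun m s => (ln (1 + fm m s))%:E) _ (EFin \o (fun s => ln (1 + f s)))) => //.
  - by move=> m; apply/measurable_EFinP; exact: mln.
  - move=> s _; apply: cvg_EFin; first by near=> m.
    apply: continuous_cvg; last by apply: cvgD; [exact: cvg_cst|exact: fm_cvg].
    by apply: continuous_ln; rewrite ltr_pwDl.
  - by move=> m s _ /=; rewrite lee_fin ger0_norm ?ln_ge// ln_mono.
have hm m : (\int[P]_w (iprod (fun i => laplace U (fm m) (Q i w)))%:E)%E =
    (expR (- (theta * \int[U]_s ln (1 + fm m s))))%:E.
  apply: (@laplace_functional_bounded (fm m) m%:R) => // s.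
  by rewrite fm0/= ge_min lexx orbT.
rewrite (funext hm) in lhs; apply: (cvg_unique _ lhs) => //.
apply: cvg_EFin; first by near=> m.
apply: continuous_cvg; first exact: continuous_expR.
by apply: cvgN; apply: cvgMr; exact: rhs.
Unshelve. all: by end_near. Qed.

End gamma_laplace_functional.

(** * Integrals that agree on a determining class *)

Section weighted_integrals.
Context {R : realType} d (T : measurableType d) (m : {measure set T -> \bar R}).
Variable w : T -> R.
Hypothesis iw : m.-integrable setT (EFin \o w).

Lemma weighted_integrable (h : T -> R) M : measurable_fun setT h ->
  (forall x, `|h x| <= M) -> m.-integrable setT (EFin \o (fun x => w x * h x)).
Proof.
move=> mh hM.
have mw : measurable_fun setT w by apply/measurable_EFinP; exact: measurable_int iw.
apply: (@le_integrable _ _ _ m _ measurableT _ (fun x => M%:E * (w x)%:E)%E).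
- by apply/measurable_EFinP; exact: measurable_funM.
- move=> x _ /=; rewrite lee_fin !normrM mulrC ler_wpM2r//.
  by rewrite (le_trans (hM x))// ler_norm.
- exact: integrableZl.
Qed.

Lemma weighted_cvg (F : nat -> T -> R) h M : (forall n, measurable_fun setT (F n)) ->
  (forall n x, `|F n x| <= M) -> (forall x, F n x @[n --> \oo] --> h x) ->
  \int[m]_x (w x * F n x) @[n --> \oo] --> \int[m]_x (w x * h x).
Proof.
move=> mF FM Fh.
have mw : measurable_fun setT w by apply/measurable_EFinP; exact: measurable_int iw.
have mh : measurable_fun setT h.
  by apply: (measurable_fun_cvg mF) => x _; exact: Fh.
have hM x : `|h x| <= M.
  rewrite -(cvg_lim (@Rhausdorff R) (cvg_norm (Fh x))).
  apply: limr_le; first by apply/cvg_ex; eexists; exact: cvg_norm (Fh x).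
  by near=> n.
apply: (@fine_cvg _ _ _ _ (fun n => (\int[m]_x (w x * F n x)%:E)%E)).
rewrite fineK; last by apply: integrable_fin_num => //; exact: weighted_integrable hM.
apply: (@dominated_cvg _ _ _ m setT measurableT (fun n x => (w x * F n x)%:E) _
  (fun x => `|M%:E * (w x)%:E|)%E) => //.
- by move=> n; apply/measurable_EFinP; exact: measurable_funM.
- move=> x _; apply: cvg_EFin; first by near=> n.
  by apply: cvgMr; exact: Fh.
- by apply: integrable_abse; exact: integrableZl.
- move=> n x _; rewrite /= lee_fin !normrM mulrC ler_wpM2r//.
  by rewrite (le_trans (FM n x))// ler_norm.
Unshelve. all: by end_near. Qed.

End weighted_integrals.

Section determining.
Context {R : realType} d (T : measurableType d) (G : set (T -> R)).
Hypothesis Gmeas : forall g, G g -> measurable_fun setT g.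
Hypothesis Gbd : forall g, G g -> exists M : R, forall x, `|g x| <= M.

Lemma bclosure_measurable h : bclosure G h -> measurable_fun setT h.
Proof.
elim=> {h} [g /Gmeas//|a f g _ mf _ mg|F f M _ mF _ Ff].
  by apply: measurable_funD => //; apply: measurable_funM => //; exact: measurable_cst.
by apply: (measurable_fun_cvg mF) => x _; exact: Ff.
Qed.

Context d1 (T1 : measurableType d1) (m1 : {measure set T1 -> \bar R}).
Context d2 (T2 : measurableType d2) (m2 : {measure set T2 -> \bar R}).
Variables (Z1 : T1 -> T) (Z2 : T2 -> T) (w1 : T1 -> R) (w2 : T2 -> R).
Hypotheses (mZ1 : measurable_fun setT Z1) (mZ2 : measurable_fun setT Z2).
Hypotheses (iw1 : m1.-integrable setT (EFin \o w1)).
Hypotheses (iw2 : m2.-integrable setT (EFin \o w2)).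

(** The equality is stable under linear combinations and, by dominated
    convergence, under bounded limits. *)
Lemma bclosure_integral_eq :
  (forall g, G g -> \int[m1]_x (w1 x * g (Z1 x)) = \int[m2]_x (w2 x * g (Z2 x))) ->
  forall h, bclosure G h ->
    \int[m1]_x (w1 x * h (Z1 x)) = \int[m2]_x (w2 x * h (Z2 x)).
Proof.
move=> Gint h; elim=> {h} [g /Gint//|a f g Gf If Gg Ig|F f M GF IF FM Ff].
- have [Mf fM] := bclosure_bounded Gbd Gf; have [Mg gM] := bclosure_bounded Gbd Gg.
  have mf := bclosure_measurable Gf; have mg := bclosure_measurable Gg.
  have lin e (T' : measurableType e) (m : {measure set T' -> \bar R}) (Z : T' -> T)
      (w : T' -> R) : measurable_fun setT Z -> m.-integrable setT (EFin \o w) ->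
      \int[m]_x (w x * (a * f (Z x) + g (Z x))) =
      a * \int[m]_x (w x * f (Z x)) + \int[m]_x (w x * g (Z x)).
    move=> mZ iw.
    have i1 : m.-integrable setT (EFin \o (fun x => w x * f (Z x))).
      apply: (weighted_integrable iw (M := Mf)) => //.
      exact: measurableT_comp mf mZ.
    have i2 : m.-integrable setT (EFin \o (fun x => w x * g (Z x))).
      apply: (weighted_integrable iw (M := Mg)) => //.
      exact: measurableT_comp mg mZ.
    rewrite -RintegralZl// -RintegralD//; last exact: (integrableZl measurableT a i1).
    by apply: eq_Rintegral => x _; ring.
  by rewrite !lin// If Ig.
- have c1 : \int[m1]_x (w1 x * F n (Z1 x)) @[n --> \oo] --> \int[m1]_x (w1 x * f (Z1 x)).
    apply: (weighted_cvg (F := fun n x => F n (Z1 x)) iw1 (M := M)) => //.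
    + by move=> n; apply: measurableT_comp mZ1; exact: bclosure_measurable.
  have c2 : \int[m2]_x (w2 x * F n (Z2 x)) @[n --> \oo] --> \int[m2]_x (w2 x * f (Z2 x)).
    apply: (weighted_cvg (F := fun n x => F n (Z2 x)) iw2 (M := M)) => //.
    + by move=> n; apply: measurableT_comp mZ2; exact: bclosure_measurable.
  rewrite (funext IF) in c1.
  exact: (cvg_unique (@Rhausdorff R) c1 c2).
Qed.

End determining.

Section laplace_uniqueness.
Context {R : realType}.

Definition log_exponentials : set (R -> R) :=
  [set h | exists2 l, 0 <= l & h = fun u => expR (- (l * expR u))].

Lemma log_exponentials_unit h u : log_exponentials h -> 0 <= h u <= 1.
Proof.
move=> [l l0 ->]; rewrite expR_ge0/= -expR0 ler_expR oppr_le0 mulr_ge0//.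
Qed.

Lemma log_exponentials_bounded h : log_exponentials h ->
  exists M : R, forall u, `|h u| <= M.
Proof.
by move=> Eh; exists 1 => u; have /andP[? ?] := log_exponentials_unit u Eh;
  rewrite ger0_norm.
Qed.

Lemma log_exponentials_measurable h : log_exponentials h -> measurable_fun setT h.
Proof.
move=> [l _ ->]; by apply: measurable_exp_scaled.
Qed.

Lemma log_exponentials_determine (A : set R) : measurable A ->
  bclosure log_exponentials (\1_A).
Proof.
apply: bclosure_indic.
- by exists 0 => //; apply/funext => u; rewrite mul0r oppr0 expR0.
- move=> f g [l l0 ->] [k k0 ->]; exists (l + k); first exact: addr_ge0.
  by apply/funext => u; rewrite -expRD; congr expR; ring.
- exact: log_exponentials_bounded.
- move=> d' T' Psi /(_ (fun u => expR (- (1 * expR u)))) mPsi.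
  have {}mPsi := mPsi (ex_intro2 _ _ 1 ler01 erefl).
  have := measurableT_comp (@measurable_ln R) (measurable_funN
    (measurableT_comp (@measurable_ln R) mPsi)).
  by congr measurable_fun; apply/funext => u /=; rewrite expRK mul1r opprK expRK.
Qed.

End laplace_uniqueness.

Lemma symmetric_product_measurable {R : realType} (g : simplex R * R -> R) :
  symmetric_products g -> measurable_fun setT g.
Proof.
move=> [n [x [x0 ->]]]; apply: measurable_iprod => //.
- move=> i; apply: measurable_avgexp; apply: measurable_funM.
    by apply: measurableT_comp => //; exact: measurable_snd.
  exact: measurableT_comp (measurable_coord i) measurable_fst.
- by move=> p _ i; apply: avgexp_unit => //; exact: simplex_scale_ge0.
Qed.

Section step_functions.
Context {R : realType}.

(** The law is typed over the Borel space that carries Lebesgue measure, so that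
    integrals against both can be compared. *)
Definition unif : probability (measurableTypeR R) R := uniform_prob (@ltr01 R).

Definition grid_step (n : nat) (x : nat -> R) (s : R) : R :=
  \sum_(k < n.+1) x k * \1_(grid_cell n k) s.

Lemma grid_step_ge0 n x s : (forall k, 0 <= x k) -> 0 <= grid_step n x s.
Proof. by move=> x0; apply: sumr_ge0 => k _; rewrite mulr_ge0. Qed.

Lemma measurable_grid_step n x : measurable_fun setT (grid_step n x).
Proof.
apply: measurable_sum => k; apply: measurable_funM; first exact: measurable_cst.
by apply: measurable_indic; exact: measurable_grid_cell.
Qed.

Lemma grid_stepE n x s k : 0 <= s -> (k < n.+1)%N -> grid_cell n k s ->
  grid_step n x s = x k.
Proof.
move=> s0 kn sk; rewrite /grid_step (bigD1 (Ordinal kn))//=.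
rewrite indicE mem_set// mulr1 big1 ?addr0// => j jk.
rewrite indicE memNset ?mulr0// => sj; move/eqP : jk; apply; apply/val_inj => /=.
by move/(grid_cellE _ _ s0) : sj => <-; move/(grid_cellE _ _ s0) : sk.
Qed.

Lemma unif_integral_step (F : R -> R) n x : measurable_fun setT F -> (forall y, 0 <= y -> 0 <= F y) ->
  (forall k, 0 <= x k) ->
  (\int[unif]_s (F (grid_step n x s))%:E =
   (n.+1%:R^-1 * \sum_(k < n.+1) F (x k))%:E)%E.
Proof.
move=> mF F0 x0; have mFg : measurable_fun setT (fun s => F (grid_step n x s)).
  by apply: measurableT_comp => //; exact: measurable_grid_step.
have Fg0 s : 0 <= F (grid_step n x s) by apply: F0; exact: grid_step_ge0.
rewrite (@integral_uniform R 0 1 ltr01 (fun s => (F (grid_step n x s))%:E))//; last exact/measurable_EFinP.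
rewrite subr0 invr1 mul1e.
rewrite -integral_itv_bndo_bndc//; last first.
  by apply/measurable_EFinP; exact: measurable_funTS.
have FE : forall s : R, s \in `[0, 1[%classic ->
    (F (grid_step n x s))%:E = (\sum_(k < n.+1) (F (x k) * \1_(grid_cell n k) s)%:E)%E.
  move=> s; rewrite inE /= in_itv/= => /andP[s0 s1].
  pose k := Num.trunc (n.+1%:R * s).
  have kn : (k < n.+1)%N.
    by rewrite truncn_lt_nat ?mulr_ge0// -[ltRHS]mulr1 ltr_pM2l.
  have sk : grid_cell n k s by apply/grid_cellE.
  rewrite (grid_stepE x s0 kn sk) sumEFin (bigD1 (Ordinal kn))//=.
  rewrite indicE mem_set// mulr1 big1 ?addr0// => j jk.
  rewrite indicE memNset ?mulr0// => sj; move/eqP : jk; apply; apply/val_inj => /=.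
  by move/(grid_cellE _ _ s0) : sj => <-.
transitivity (\int[@lebesgue_measure R]_(s in `[0%R, 1%R[)
    (\sum_(k < n.+1) (F (x k) * \1_(grid_cell n k) s)%:E))%E.
  by apply: eq_integral => s; exact: FE.
rewrite ge0_integral_sum//.
- rewrite mulr_sumr -sumEFin; apply: eq_bigr => k _.
  under eq_integral do rewrite EFinM.
  rewrite ge0_integralZl_EFin//; last 2 first.
  + by apply/measurable_EFinP; apply: measurable_indic; exact: measurable_grid_cell.
  + exact: F0.
  rewrite integral_indic//; last exact: measurable_grid_cell.
  rewrite EFinM muleC; congr (_ * _)%E.
  rewrite (_ : _ `&` _ = grid_cell n k).
    exact: lebesgue_grid_cell.
  apply/setIidl => s; rewrite /grid_cell /= !in_itv/= => /andP[ks sk].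
  rewrite (le_trans _ ks) ?divr_ge0//= (lt_le_trans sk)//.
  by rewrite ler_pdivrMr// mul1r ler_nat.
- move=> k; apply/measurable_EFinP; apply: measurable_funM; first exact: measurable_cst.
  by apply: measurable_indic; exact: measurable_grid_cell.
- by move=> k s _; rewrite lee_fin mulr_ge0// F0.
Qed.

Lemma laplace_step n x q : (forall k, 0 <= x k) -> 0 <= q ->
  laplace unif (grid_step n x) q = avgexp n x q.
Proof.
move=> x0 q0; apply: EFin_inj.
rewrite laplaceE//; [|exact: measurable_grid_step|by move=> s; exact: grid_step_ge0].
rewrite (unif_integral_step (F := fun y => expR (- (q * y))))//.
- by congr (_ * _)%:E; apply: eq_bigr => k _; rewrite mulrC.
- by apply: measurable_exp_scaled.
Qed.

End step_functions.

(** * Independence of the normalized masses and the total mass *)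

Section symmetric_laplace.
Context {R : realType} d (S : measurableType d) (U : probability S R).
Implicit Types f : S -> R.

(** The expectation of exp (- sum_i e^u y_i f(S_i)) over independent marks S_i
    of law [U]. *)
Definition symmetric_laplace f (p : simplex R * R) : R :=
  iprod (fun i => laplace U f (expR p.2 * p.1 i)).

Lemma symmetric_laplace_seq f (p : simplex R * R) : measurable_fun setT f -> (forall s, 0 <= f s) ->
  unit_seq (fun i => laplace U f (expR p.2 * p.1 i)).
Proof. by move=> mf f0 i; apply: laplace_unit => //; exact: simplex_scale_ge0. Qed.

Lemma symmetric_laplace_unit f p : measurable_fun setT f -> (forall s, 0 <= f s) ->
  0 <= symmetric_laplace f p <= 1.
Proof. by move=> mf f0; apply: iprod_unit; exact: symmetric_laplace_seq. Qed.

Lemma measurable_symmetric_laplace f : measurable_fun setT f -> (forall s, 0 <= f s) ->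
  measurable_fun setT (symmetric_laplace f).
Proof.
move=> mf f0; apply: measurable_iprod => //.
- move=> i; apply: measurable_laplace => //; apply: measurable_funM.
    by apply: measurableT_comp => //; exact: measurable_snd.
  exact: measurableT_comp (measurable_coord i) measurable_fst.
- by move=> p _; exact: symmetric_laplace_seq.
Qed.

Lemma scaled_series (y : simplex R) (c : R) : series (fun i => c * y i) @ \oo --> c.
Proof.
rewrite (_ : series _ = (fun n => c * series y n)).
  by rewrite -[X in _ --> X]mulr1; apply: cvgMr; exact: simplex_cvg.
by apply/funext => n; rewrite /series/= mulr_sumr.
Qed.

Lemma laplaceD_cst f l q : measurable_fun setT f -> (forall s, 0 <= f s) -> 0 <= q ->
  laplace U (fun s => f s + l) q = expR (- (l * q)) * laplace U f q.
Proof.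
move=> mf f0 q0; rewrite /laplace -RintegralZl//.
  by apply: eq_Rintegral => s _; rewrite -expRD; congr expR; ring.
apply: unit_integrable.
  by apply: measurable_exp_scaled.
by move=> s; rewrite expR_ge0/= -expR0 ler_expR oppr_le0 mulr_ge0.
Qed.

(** The coordinates of y add up to 1, so a shift of f by a constant only
    involves the total mass e^u. *)
Lemma symmetric_laplaceD_cst f l p : measurable_fun setT f -> (forall s, 0 <= f s) ->
  0 <= l ->
  symmetric_laplace (fun s => f s + l) p = expR (- (l * expR p.2)) * symmetric_laplace f p.
Proof.
move=> mf f0 l0; rewrite -(@iprod_expR _ (fun i => l * expR p.2 * p.1 i)); last first.
  exact: scaled_series.
rewrite -iprodM.
- rewrite /symmetric_laplace; congr iprod; apply/funext => i.
  by rewrite laplaceD_cst// ?simplex_scale_ge0// mulrA.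
- apply: unit_seq_expR => i; rewrite !mulr_ge0 ?expR_ge0//.
  exact: coords_ge0.
- exact: symmetric_laplace_seq.
Qed.

Lemma symmetric_laplace_shift f c y u : 0 < c ->
  symmetric_laplace f (y, u + ln c) = symmetric_laplace (fun s => c * f s) (y, u).
Proof.
move=> c0; congr iprod; apply/funext => i /=; rewrite expRD lnK ?posrE//.
by apply: eq_Rintegral => s _; congr expR; ring.
Qed.

Lemma bounded_ln_integrable f M : measurable_fun setT f -> (forall s, 0 <= f s <= M) ->
  U.-integrable setT (EFin \o (fun s => ln (1 + f s))).
Proof.
move=> mf fM; have f0 s : 0 <= f s by have /andP[] := fM s.
have fl s : f s <= M by have /andP[] := fM s.
apply: (@bounded_integrable _ _ _ _ _ (ln (1 + M))).
  by apply: measurableT_comp => //; apply: measurable_funD => //; exact: measurable_cst.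
move=> s; rewrite ger0_norm; last by rewrite ln_ge0// lerDl.
by rewrite ler_ln ?posrE ?lerD2l// ltr_pwDl//; apply: le_trans (fl s).
Qed.

End symmetric_laplace.

Lemma symmetric_product_laplace {R : realType} n x (p : simplex R * R) :
  (forall k, 0 <= x k) ->
  symmetric_product n x p = symmetric_laplace unif (grid_step n x) p.
Proof.
move=> x0; congr iprod; apply/funext => i.
by rewrite laplace_step// simplex_scale_ge0.
Qed.

Lemma grid_step_bounded {R : realType} n (x : nat -> R) : (forall k, 0 <= x k) ->
  exists M, forall s, 0 <= grid_step n x s <= M.
Proof.
move=> x0; exists (\sum_(k < n.+1) x k) => s; rewrite grid_step_ge0//=.
apply: ler_sum => k _; rewrite -[leRHS]mulr1 ler_wpM2l//.
Qed.

(** [lam] is the law of the logarithm of the total mass, independent of the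
    normalized masses.  The universe of marks is arbitrary because products of
    uniform laws will be needed as well as the uniform law itself. *)
Definition laplace_identity {R : realType} (theta : R) (PD : probability (simplex R) R)
    (lam : probability R R) :=
  forall d (S : measurableType d) (U : probability S R) (f : S -> R),
    measurable_fun setT f -> (forall s, 0 <= f s) ->
    U.-integrable setT (EFin \o (fun s => ln (1 + f s))) ->
    (\int[PD \x lam]_p (symmetric_laplace U f p)%:E =
     (expR (- (theta * \int[U]_s ln (1 + f s))))%:E)%E.

Section split.
Context {R : realType} (theta : R) (PD : probability (simplex R) R).
Hypothesis theta_gt0 : 0 < theta.
Context d (Om : measurableType d) (P : probability Om R).
Variables (eta : R.-ker Om ~> R) (Q X : nat -> {RV P >-> R}) (Y : {RV P >-> simplex R}).
Hypothesis eta_gamma : gamma_random_measure theta eta Q X.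
Hypothesis YQ : {ae P, forall w, forall i, Y w i = Q i w / fine (eta w (unit_itv R))}.
Hypothesis PDY : forall A, measurable A -> PD A = distribution P Y A.

Let T w := fine (eta w (unit_itv R)).
Let u w := ln (T w).

Let mT : measurable_fun setT T.
Proof.
have := measurable_cell_mass eta (@measurableT _ R).
by congr measurable_fun; apply/funext => w; rewrite /cell_mass setTI.
Qed.

Let mu : measurable_fun setT u.
Proof. exact: measurableT_comp. Qed.

Let mY : measurable_fun setT Y. Proof. exact: measurable_funP. Qed.

Let mYu : measurable_fun setT (fun w => (Y w, u w)).
Proof. exact: measurable_fun_pair. Qed.

Let QE : {ae P, forall w, forall i, Q i w = expR (u w) * Y w i}.
Proof.
move: YQ; apply: filterS => w YQw i.
have T0 : 0 < T w.
  rewrite lt_neqAle fine_ge0 ?andbT//; apply/eqP => T0.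
  have := simplex_gt0 (Y w); rewrite YQw -/(T w) -T0 invr0 mulr0.
  by rewrite ltxx.
by rewrite /u lnK ?posrE// YQw -/(T w) mulrC divfK// gt_eqF.
Qed.

Let laplace_Yu d' (S : measurableType d') (U : probability S R) (f : S -> R) :
    measurable_fun setT f -> (forall s, 0 <= f s) ->
    U.-integrable setT (EFin \o (fun s => ln (1 + f s))) ->
  (\int[P]_w (symmetric_laplace U f (Y w, u w))%:E =
     (expR (- (theta * \int[U]_s ln (1 + f s))))%:E)%E.
Proof.
move=> mf f0 iln; rewrite -(laplace_functional theta_gt0 eta_gamma mf f0 iln).
apply: ge0_ae_eq_integral => //.
- apply/measurable_EFinP.
  exact: measurableT_comp (measurable_symmetric_laplace U mf f0) mYu.
- apply/measurable_EFinP; apply: measurable_iprod => //.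
    by move=> i; apply: measurable_laplace => //; exact: measurable_mass.
  by move=> w _ i; apply: laplace_unit => //; exact: (mass_ge0 eta_gamma).
- by move=> w _; rewrite lee_fin; have /andP[] := symmetric_laplace_unit U (Y w, u w) mf f0.
- move=> w _; rewrite lee_fin.
  suff /andP[] : 0 <= iprod (fun i => laplace U f (Q i w)) <= 1 by [].
  by apply: iprod_unit => i; apply: laplace_unit => //; exact: (mass_ge0 eta_gamma).
- move: QE; apply: filterS => w Qw _; rewrite /symmetric_laplace/=.
  by under [in RHS]eq_fun do rewrite Qw.
Qed.

Let exp_weight l w := expR (- (l * expR (u w))).

Let exp_weight_integrable l : 0 <= l -> P.-integrable setT (EFin \o exp_weight l).
Proof.
move=> l0; apply: unit_integrable.
  apply: measurableT_comp => //; apply: measurable_funN; apply: measurable_funM => //.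
  exact: measurableT_comp.
by move=> w; rewrite expR_ge0/= -expR0 ler_expR oppr_le0 mulr_ge0 ?expR_ge0.
Qed.

(** Weighting by e^(- l T) and dividing T by 1 + l have the same effect on every
    symmetric product, since ln (1 + g + l) = ln (1 + l) + ln (1 + g / (1 + l)). *)
Let tilt l (A : set (simplex R * R)) : 0 <= l -> measurable A ->
  \int[P]_w (exp_weight l w * \1_A (Y w, u w)) =
  \int[P]_w (expR (- (theta * ln (1 + l))) * \1_A (Y w, u w + ln (1 + l)^-1)).
Proof.
move=> l0 mA; have l1 : 0 < 1 + l by rewrite ltr_pwDl.
have l1V : 0 < (1 + l)^-1 by rewrite invr_gt0.
pose Z2 w := (Y w, u w + ln (1 + l)^-1).
have mZ2 : measurable_fun setT Z2.
  by apply: measurable_fun_pair => //; apply: measurable_funD => //; exact: measurable_cst.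
apply: (@bclosure_integral_eq _ _ _ _ symmetric_product_measurable
  symmetric_products_bounded _ _ P _ _ P (fun w => (Y w, u w)) Z2
  (exp_weight l) (fun=> expR (- (theta * ln (1 + l))))) => //.
- exact: exp_weight_integrable.
- by apply: (@bounded_integrable _ _ _ _ _ (expR (- (theta * ln (1 + l))))) => // w;
    rewrite ger0_norm ?expR_ge0.
- move=> _ [n [x [x0 ->]]].
  have [M gM] := grid_step_bounded n x0.
  set g := grid_step n x in gM; have mg : measurable_fun setT g by exact: measurable_grid_step.
  have g0 s : 0 <= g s by have /andP[] := gM s.
  have mgl : measurable_fun setT (fun s => g s + l).
    by apply: measurable_funD => //; exact: measurable_cst.
  have mgc : measurable_fun setT (fun s => (1 + l)^-1 * g s).
    by apply: measurable_funM => //; exact: measurable_cst.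
  have igl : unif.-integrable setT (EFin \o (fun s => ln (1 + (g s + l)))).
    apply: (@bounded_ln_integrable _ _ _ _ _ (M + l)) => // s.
    by have /andP[a b] := gM s; rewrite addr_ge0//= lerD2r.
  have igc : unif.-integrable setT (EFin \o (fun s => ln (1 + (1 + l)^-1 * g s))).
    apply: (@bounded_ln_integrable _ _ _ _ _ ((1 + l)^-1 * M)) => // s.
    by have /andP[a b] := gM s; rewrite mulr_ge0 ?(ltW l1V)//= ler_wpM2l ?(ltW l1V).
  have E1 : \int[P]_w (exp_weight l w * symmetric_product n x (Y w, u w)) =
      expR (- (theta * \int[unif]_s ln (1 + (g s + l)))).
    apply: EFin_inj; rewrite -laplace_Yu//; last by move=> s; rewrite addr_ge0.
    rewrite EFin_Rintegral.
      apply: eq_integral => w _; congr EFin.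
      by rewrite symmetric_laplaceD_cst// symmetric_product_laplace.
    apply: (weighted_integrable (exp_weight_integrable l0) (M := 1)).
      apply: measurableT_comp mYu; apply: symmetric_product_measurable.
      by exists n, x.
    by move=> w; have /andP[a b] := symmetric_product_unit n (Y w, u w) x0; rewrite ger0_norm.
  have E2 : \int[P]_w (expR (- (theta * ln (1 + l))) * symmetric_product n x (Z2 w)) =
      expR (- (theta * ln (1 + l))) *
      expR (- (theta * \int[unif]_s ln (1 + (1 + l)^-1 * g s))).
    have i2 : P.-integrable setT (EFin \o (fun w => symmetric_product n x (Z2 w))).
      apply: unit_integrable.
        apply: measurableT_comp mZ2; apply: symmetric_product_measurable.
        by exists n, x.
      by move=> w; exact: symmetric_product_unit.
    rewrite RintegralZl//; congr (_ * _); apply: EFin_inj.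
    rewrite -laplace_Yu//; last by move=> s; rewrite mulr_ge0 ?(ltW l1V).
    rewrite EFin_Rintegral//; apply: eq_integral => w _; congr EFin.
    rewrite (symmetric_product_laplace n (Z2 w) x0).
    exact: (symmetric_laplace_shift unif g (Y w) (u w) l1V).
  have E3 : \int[unif]_s ln (1 + (g s + l)) =
      ln (1 + l) + \int[unif]_s ln (1 + (1 + l)^-1 * g s).
    rewrite -[X in _ = X + _](probability_Rintegral_cst (@unif R)) -RintegralD//.
      apply: eq_Rintegral => s _; rewrite -lnM ?posrE//; last first.
        by rewrite ltr_pwDl// mulr_ge0 ?(ltW l1V).
      by congr ln; field; rewrite gt_eqF.
    by apply: (@bounded_integrable _ _ _ _ _ `|ln (1 + l)|).
  have alg (A' B C : R) : A' = B + C ->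
      expR (- (theta * A')) = expR (- (theta * B)) * expR (- (theta * C)).
    by move=> ->; rewrite -expRD mulrDr opprD.
  exact: (etrans E1 (etrans (alg _ _ _ E3) (esym E2))).
- exact: symmetric_products_determine.
Qed.

Let PD_Y A : measurable A -> (PD A = P (Y @^-1` A))%E.
Proof. exact: PDY. Qed.

(** Apply [tilt] to sets of the form B x R. *)
Let indep_laplace l (B : set (simplex R)) : 0 <= l -> measurable B ->
  \int[P]_w (\1_B (Y w) * expR (- (l * expR (u w)))) =
  \int[P]_w (fine (PD B) * expR (- (l * expR (u w)))).
Proof.
move=> l0 mB.
have key C : measurable C -> \int[P]_w (\1_C (Y w) * expR (- (l * expR (u w)))) =
    expR (- (theta * ln (1 + l))) * fine (PD C).
  move=> mC; have := tilt l0 (measurableX mC (@measurableT _ R)).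
  have -> : \int[P]_w (exp_weight l w * \1_(C `*` setT) (Y w, u w)) =
      \int[P]_w (\1_C (Y w) * expR (- (l * expR (u w)))).
    apply: eq_Rintegral => w _; rewrite mulrC; congr (_ * _).
    by rewrite !indicE in_setX in_setT andbT.
  move=> ->.
  have mYC : measurable (Y @^-1` C) by rewrite -[X in measurable X]setTI; exact: mY.
  have i1 : P.-integrable setT (EFin \o (\1_(Y @^-1` C) : Om -> R)).
    by apply: unit_integrable => // w; rewrite indicE ler0n lern1 leq_b1.
  rewrite PD_Y// (_ : fine _ = \int[P]_w (\1_(Y @^-1` C) w)); last first.
    by rewrite /Rintegral integral_indic// setIT.
  rewrite -RintegralZl//; apply: eq_Rintegral => w _; congr (_ * _).
  by rewrite !indicE in_setX in_setT andbT.
rewrite key// RintegralZl//; last exact: exp_weight_integrable.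
rewrite mulrC; congr (_ * _).
have := key setT (@measurableT _ _); rewrite probability_setT mulr1 => <-.
by apply: eq_Rintegral => w _; rewrite indicT mul1r.
Qed.

Definition log_mass : Om -> R := u.
Let mlog_mass : measurable_fun setT log_mass := mu.
HB.instance Definition _ := @isMeasurableFun.Build _ _ _ _ log_mass mlog_mass.
Definition log_mass_law : probability R R := distribution P log_mass.

Let indep A B : measurable A -> measurable B ->
  (P ((fun w => (Y w, u w)) @^-1` (A `*` B)) = PD A * log_mass_law B)%E.
Proof.
move=> mA mB.
have mYA : measurable (Y @^-1` A) by rewrite -[X in measurable X]setTI; exact: mY.
have muB : measurable (u @^-1` B) by rewrite -[X in measurable X]setTI; exact: mu.
have i1 D : measurable D -> P.-integrable setT (EFin \o (\1_D : Om -> R)).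
  by move=> mD; apply: unit_integrable => // w; rewrite indicE ler0n lern1 leq_b1.
have : \int[P]_w (\1_(Y @^-1` A) w * \1_B (u w)) = \int[P]_w (fine (PD A) * \1_B (u w)).
  apply: (@bclosure_integral_eq _ _ _ _ log_exponentials_measurable
    log_exponentials_bounded _ _ P _ _ P u u
    (\1_(Y @^-1` A)) (fun=> fine (PD A))) => //.
  - exact: i1.
  - by apply: (@bounded_integrable _ _ _ _ _ `|fine (PD A)|).
  - by move=> _ [l l0 ->]; exact: indep_laplace.
  - exact: log_exponentials_determine.
move=> h; have := congr1 EFin h; rewrite EFin_Rintegral; last first.
  apply: (weighted_integrable (i1 _ mYA) (M := 1)).
    rewrite (_ : (fun w => \1_B (u w)) = \1_(u @^-1` B)); first exact: measurable_indic.
    by apply/funext => w; rewrite !indicE.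
  by move=> w; rewrite indicE ger0_norm// lern1 leq_b1.
rewrite RintegralZl//; last exact: i1 muB.
rewrite EFinM EFin_Rintegral; last exact: i1 muB.
rewrite fineK; last exact: fin_num_measure.
rewrite (_ : (\int[P]_x (\1_B (u x))%:E)%E = log_mass_law B); last first.
  by rewrite (integral_indic P measurableT muB) setIT.
move=> <-.
transitivity (\int[P]_w (\1_((fun w => (Y w, u w)) @^-1` (A `*` B)) w)%:E)%E.
  rewrite integral_indic ?setIT//.
  rewrite -[X in measurable X]setTI; apply: mYu => //.
  exact: measurableX.
apply: eq_integral => w _; congr EFin; rewrite !indicE -natrM mulnb; congr (nat_of_bool _)%:R.
by apply/idP/andP; rewrite !inE.
Qed.

Lemma split_law :
  exists lam : probability R R, laplace_identity theta PD lam.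
Proof.
exists log_mass_law => d' S U f mf f0 iln; rewrite -laplace_Yu//.
pose Z w := (Y w, u w).
have mZ : measurable_fun setT Z by exact: mYu.
transitivity (\int[pushforward P Z]_p (symmetric_laplace U f p)%:E)%E.
  apply: eq_measure_integral => A mA _.
  by apply: product_measure_unique => // B C mB mC; exact: indep.
rewrite ge0_integral_pushforward//.
- by apply/measurable_EFinP; exact: measurable_symmetric_laplace.
- by move=> p; rewrite lee_fin; have /andP[] := symmetric_laplace_unit U p mf f0.
Qed.

End split.

Lemma poisson_dirichlet_split {R : realType} (theta : R) (PD : probability (simplex R) R) :
  0 < theta -> poisson_dirichlet theta PD ->
  exists lam : probability R R, laplace_identity theta PD lam.
Proof.
move=> theta0 [d [Om [P [eta [Q [X [Y [eg YQ PDY]]]]]]]].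
exact: (split_law theta0 eg YQ PDY).
Qed.

(** * The gamma integral *)

Section lebesgue_scale.
Context {R : realType}.
Local Notation pos := (`]0%R, +oo[%classic : set (measurableTypeR R)).
Local Notation mu := (@lebesgue_measure R).

Let dilation (c : R) : measurableTypeR R -> measurableTypeR R := fun x => (c * x)%R.

Let measurable_dilation c : measurable_fun setT (dilation c).
Proof. by apply: measurable_funM => //; exact: measurable_cst. Qed.

Let dilated (c : R) (c0 : 0 < c) : {measure set (measurableTypeR R) -> \bar R} :=
  mscale (NngNum (ltW c0)) (measure_function_pushforward__canonical__measure_function_Measure
    (@lebesgue_measure R) (measurable_dilation c)).

Let lebesgue_measure_dilated (c : R) (c0 : 0 < c) (A : set R) : measurable A ->
  mu A = dilated c0 A.
Proof.
move=> mA; apply: lebesgue_measure_unique => //.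
move=> _ [[a b]] _ <-; rewrite /dilated/= /mscale/= /pushforward.
rewrite (_ : dilation c @^-1` _ = `](a / c), (b / c)]%classic); last first.
  apply/seteqP; split => x; rewrite /dilation /= !in_itv/= ltr_pdivrMr// ler_pdivlMr//;
    by rewrite (mulrC x).
rewrite !lebesgue_measure_itv/= !lte_fin ltr_pM2r ?invr_gt0//.
case: ifPn => [ab|_]; last by rewrite mule0.
by rewrite -!EFinB -EFinM -mulrBl mulrC divfK// gt_eqF.
Qed.

Lemma ge0_integral_scale (c : R) (f : R -> \bar R) : 0 < c -> measurable_fun setT f ->
  (forall x, 0 <= f x)%E ->
  (\int[mu]_(t in `]0%R, +oo[) f t = c%:E * \int[mu]_(t in `]0%R, +oo[) f (c * t)%R)%E.
Proof.
move=> c0 mf f0.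
have mfD : measurable_fun pos f by exact: measurable_funTS.
rewrite [in RHS](_ : `]0%R, +oo[%classic = dilation c @^-1` `]0%R, +oo[%classic); last first.
  by apply/seteqP; split => x; rewrite /dilation /= !in_itv/= !andbT pmulr_rgt0.
have h := @ge0_integral_pushforward _ _ _ _ _ _ (measurable_dilation c)
  (@lebesgue_measure R) pos f (measurable_itv _) mfD (fun x _ => f0 x).
have h2 := @ge0_integral_mscale _ _ _
  (measure_function_pushforward__canonical__measure_function_Measure
    (@lebesgue_measure R) (measurable_dilation c)) pos (measurable_itv _)
  (NngNum (ltW c0)) f mfD (fun x _ => f0 x).
rewrite -[X in (_ = _ * X)%E]h -h2.
by apply: eq_measure_integral => A mA _; exact: lebesgue_measure_dilated.
Qed.

End lebesgue_scale.

Section gamma_function.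
Context {R : realType} (theta : R).
Hypothesis theta_gt0 : 0 < theta.
Local Notation pos := (`]0%R, +oo[%classic : set (measurableTypeR R)).
Local Notation mu := (@lebesgue_measure R).

Definition gamma_weight (t : R) : R := t `^ (theta - 1) * expR (- t).

Lemma gamma_weight_ge0 t : 0 <= gamma_weight t.
Proof. by rewrite mulr_ge0 ?powR_ge0 ?expR_ge0. Qed.

Lemma measurable_gamma_weight : measurable_fun setT gamma_weight.
Proof.
apply: measurable_funM; first exact: measurable_powR.
by apply: measurableT_comp => //; exact: measurable_funN.
Qed.

Lemma integral_powR_itv (a : R) : 0 < a -> a < 1 ->
  (\int[mu]_(t in `[a, 1%R]) (t `^ (theta - 1))%:E <= (theta^-1)%:E)%E.
Proof.
move=> a0 a1.
have dF (x : R) : 0 < x -> is_derive x 1 (fun t : R => theta^-1 * t `^ theta) (x `^ (theta - 1)).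
  move=> x0; have h := @is_derive1_powR R theta x x0.
  have := @is_deriveZ _ _ _ (fun t => t `^ theta) theta^-1 x 1 _ h.
  by rewrite /GRing.scale/= mulrA mulVf ?mul1r// gt_eqF.
rewrite (@continuous_FTC2 _ _ (fun t => theta^-1 * t `^ theta))//.
- rewrite -EFinB lee_fin powR1 mulr1 gerBl mulr_ge0 ?powR_ge0// invr_ge0 ltW//.
- apply: continuous_in_subspaceT => x; rewrite inE/= in_itv/= => /andP[ax _].
  have x0 : 0 < x by exact: lt_le_trans ax.
  apply: differentiable_continuous; apply/derivable1_diffP.
  by apply: derivable_powR; rewrite in_itv/= andbT.
- have cF x : 0 < x -> {for x, continuous (fun t => theta^-1 * t `^ theta)}.
    move=> x0; apply: differentiable_continuous; apply/derivable1_diffP.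
    by have h := dF x x0; exact: ex_derive.
  split.
  + move=> x; rewrite in_itv/= => /andP[ax _].
    by have h := dF x (lt_trans a0 ax); exact: ex_derive.
  + by apply: cvg_at_right_filter; exact: cF.
  + by apply: cvg_at_left_filter; exact: cF.
- move=> x; rewrite in_itv/= => /andP[ax _].
  by have h := dF x (lt_trans a0 ax); rewrite derive1E derive_val.
Qed.

Lemma integral_powR01 :
  (\int[mu]_(t in `]0%R, 1%R]) (t `^ (theta - 1))%:E <= (theta^-1)%:E)%E.
Proof.
pose F (n : nat) : set (measurableTypeR R) := `[n.+2%:R^-1, 1]%classic.
have bF : \bigcup_n F n = `]0%R, 1%R]%classic.
  apply/seteqP; split => x.
    move=> [n _]; rewrite /F /= !in_itv/= => /andP[nx ->]; rewrite andbT.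
    by apply: lt_le_trans nx; rewrite invr_gt0.
  rewrite /= in_itv/= => /andP[x0 x1]; exists (Num.trunc x^-1) => //.
  rewrite /F /= in_itv/= x1 andbT invf_ple ?posrE//.
  apply: (le_trans (ltW (truncnS_gt _))).
  by rewrite ler_nat.
have mF n : measurable (F n) by exact: measurable_itv.
have ndF : nondecreasing_seq F.
  apply/nondecreasing_seqP => n; apply/subsetPset => x; rewrite /F /= !in_itv/=.
  move=> /andP[nx ->]; rewrite andbT; apply: le_trans nx.
  by rewrite lef_pV2 ?posrE// ler_nat.
rewrite -bF.
have mp (D : set (measurableTypeR R)) : measurable D ->
    measurable_fun D (fun t : measurableTypeR R => (t `^ (theta - 1))%:E).
  by move=> mD; apply/measurable_EFinP; apply: measurable_funTS; exact: measurable_powR.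
have := @ge0_nondecreasing_set_cvg_integral _ _ _ F (fun t => (t `^ (theta - 1))%:E) (@lebesgue_measure R) ndF mF.
move=> /(_ _ _)/(cvg_lim _) <-//; last 2 first.
- by move=> n; exact: mp.
- by move=> n x _; rewrite lee_fin powR_ge0.
apply: lime_le.
  apply: ereal_nondecreasing_is_cvgn; apply: ge0_nondecreasing_set_nondecreasing_integral => //.
    by move=> n; exact: mp.
  by move=> n x _; rewrite lee_fin powR_ge0.
near=> n; apply: integral_powR_itv; first by rewrite invr_gt0.
by rewrite invf_lt1// ltr1n.
Unshelve. all: by end_near. Qed.

(** The inequality ln x <= x at x = t / (2 theta) lets half of the exponential
    decay absorb the power of t. *)
Lemma gamma_weight_tail (t : R) : 1 <= t ->
  gamma_weight t <= expR (theta * ln (2 * theta)) * expR (- (2^-1 * t)).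
Proof.
move=> t1; have t0 : 0 < t by exact: lt_le_trans t1.
rewrite /gamma_weight -expRD.
apply: (@le_trans _ _ (t `^ theta * expR (- t))).
  by rewrite ler_wpM2r ?expR_ge0// ler_powR// gerBl.
rewrite /powR gt_eqF// -expRD ler_expR.
have h : ln (t / (2 * theta)) <= t / (2 * theta).
  by apply/ltW/ln_sublinear; rewrite divr_gt0// mulr_gt0.
have -> : ln t = ln (t / (2 * theta)) + ln (2 * theta).
  by rewrite -lnM ?posrE ?divr_gt0 ?mulr_gt0// divfK// gt_eqF// mulr_gt0.
have -> : theta * (ln (t / (2 * theta)) + ln (2 * theta)) - t =
   (theta * ln (t / (2 * theta)) - 2^-1 * t) + (theta * ln (2 * theta) - 2^-1 * t).
  by field.
rewrite -[leRHS]add0r lerD2r subr_le0.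
apply: (@le_trans _ _ (theta * (t / (2 * theta)))).
  by rewrite ler_wpM2l// ltW.
rewrite le_eqVlt; apply/orP; left; apply/eqP; field.
by rewrite gt_eqF.
Qed.

Lemma gamma_integral_lty : (\int[mu]_(t in `]0%R, +oo[) (gamma_weight t)%:E < +oo)%E.
Proof.
have mW D : measurable D -> measurable_fun D (fun t : R => (gamma_weight t)%:E).
  by move=> mD; apply/measurable_EFinP; apply: measurable_funTS; exact: measurable_gamma_weight.
have -> : `]0%R, +oo[%classic = `]0%R, 1%R]%classic `|` `]1%R, +oo[%classic :> set R.
  apply/seteqP; split => x /=; rewrite !in_itv/= !andbT.
    by move=> x0; have [x1|x1] := leP x 1; [left; rewrite x0|right].
  by case => [/andP[]//|]; apply: lt_trans.
rewrite ge0_integral_setU//=.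
- apply: lte_add_pinfty.
    apply: le_lt_trans (ltry theta^-1); apply: le_trans integral_powR01.
    apply: ge0_le_integral => //.
    + by move=> t _; rewrite lee_fin gamma_weight_ge0.
    + exact: mW.
    + by apply/measurable_EFinP; apply: measurable_funTS; exact: measurable_powR.
    + move=> t; rewrite /= in_itv/= => /andP[t0 _]; rewrite lee_fin.
      rewrite -[leRHS]mulr1 ler_wpM2l ?powR_ge0// -expR0 ler_expR oppr_le0 ltW//.
  pose C := expR (theta * ln (2 * theta)).
  have mexp : measurable_fun setT (fun t => (exponential_pdf (2^-1 : R) t)%:E).
    by apply/measurable_EFinP; exact: measurable_exponential_pdf.
  have half0 : 0 < 2^-1 :> R by rewrite invr_gt0.
  apply: (@le_lt_trans _ _ (\int[mu]_t ((2 * C)%:E * (exponential_pdf (2^-1 : R) t)%:E))%E); last first.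
    rewrite ge0_integralZl_EFin//.
    + by rewrite integral_exponential_pdf// mule1 ltry.
    + by move=> t _; rewrite lee_fin exponential_pdf_ge0// ltW.
    + by rewrite mulr_ge0 ?expR_ge0.
  apply: (@le_trans _ _ (\int[mu]_(t in `]1%R, +oo[) ((2 * C)%:E * (exponential_pdf (2^-1 : R) t)%:E))%E).
    apply: ge0_le_integral => //.
    + by move=> t _; rewrite lee_fin gamma_weight_ge0.
    + exact: mW.
    + by apply: measurable_funeM; exact: measurable_funTS.
    + move=> t; rewrite /= in_itv/= andbT => t1; rewrite -EFinM lee_fin.
      apply: (le_trans (gamma_weight_tail (ltW t1))).
      rewrite exponential_pdfE; last by rewrite ltW// (lt_trans _ t1).
      by rewrite le_eqVlt; apply/orP; left; apply/eqP; rewrite /C mulNr; field.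
  apply: ge0_subset_integral => //; first exact: measurable_funeM.
  move=> t _; rewrite mule_ge0// lee_fin ?mulr_ge0 ?expR_ge0//.
  by rewrite exponential_pdf_ge0// ltW.
- by apply: mW; exact: measurableU.
- by move=> t _; rewrite lee_fin gamma_weight_ge0.
- apply/disj_setPS => x [/=]; rewrite !in_itv/= => /andP[_ x1]; rewrite andbT => /lt_le_trans.
  by move=> /(_ _ x1); rewrite ltxx.
Qed.

Lemma gamma_weight_integrable : mu.-integrable `]0%R, +oo[ (EFin \o gamma_weight).
Proof.
apply/integrableP; split.
  by apply/measurable_EFinP; apply: measurable_funTS; exact: measurable_gamma_weight.
under eq_integral do rewrite /= ger0_norm ?gamma_weight_ge0//.
exact: gamma_integral_lty.
Qed.

Lemma EFin_Gamma : (Gamma theta)%:E = (\int[mu]_(t in `]0%R, +oo[) (gamma_weight t)%:E)%E.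
Proof.
rewrite /Gamma /Rintegral fineK//; apply: integrable_fin_num => //.
exact: gamma_weight_integrable.
Qed.

Lemma Gamma_gt0 : 0 < Gamma theta.
Proof.
rewrite -lte_fin EFin_Gamma.
rewrite lt_neqAle integral_ge0 ?andbT; last by move=> t _; rewrite lee_fin gamma_weight_ge0.
apply/eqP => /esym W0.
have mD : measurable (`]0%R, +oo[%classic : set (measurableTypeR R)) by exact: measurable_itv.
have mW : measurable_fun pos (fun t : measurableTypeR R => (gamma_weight t)%:E).
  by apply/measurable_EFinP; apply: measurable_funTS; exact: measurable_gamma_weight.
have := (ae_eq_integral_abs (@lebesgue_measure R) mD mW).1.
under eq_integral do rewrite gee0_abs ?lee_fin ?gamma_weight_ge0//.
move=> /(_ W0)[N [mN N0 DN]].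
have : (mu `]0%R, +oo[ <= mu N)%E.
  apply: le_measure; rewrite ?inE//; apply: subset_trans DN => t t0 /= /(_ t0).
  have tp : 0 < t by move: t0; rewrite /= in_itv/= andbT.
  have Wt : 0 < gamma_weight t by rewrite mulr_gt0 ?powR_gt0 ?expR_gt0.
  by case=> Wt0; rewrite Wt0 ltxx in Wt.
by rewrite N0 lebesgue_measure_itv/= ltry sube0 leye_eq.
Qed.

End gamma_function.

(** * The law of the logarithm of the total mass *)

Section bclosure_bounded.
Context {R : realType} d (T : measurableType d) (G : set (T -> R)).
Hypothesis Gindic : forall A, measurable A -> bclosure G (\1_A).
Hypothesis G1 : G (fun=> 1).

(** The functions trunc (n h) / n are averages of indicators of superlevel sets
    of h, and converge to h. *)
Lemma bclosure_unit_measurable (h : T -> R) : measurable_fun setT h ->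
  (forall x, 0 <= h x <= 1) -> bclosure G h.
Proof.
move=> mh h01; have h0 x : 0 <= h x by have /andP[] := h01 x.
pose A n k := [set x | k.+1%:R <= n%:R * h x].
pose H n x : R := n%:R^-1 * \sum_(k < n) \1_(A n k) x.
have mA n k : measurable (A n k).
  rewrite -[X in measurable X]setTI; apply: measurable_fun_le => //.
  by apply: measurable_funM => //; exact: measurable_cst.
have sumE n x : \sum_(k < n) \1_(A n k) x = (Num.trunc (n%:R * h x))%:R :> R.
  have nh0 : 0 <= n%:R * h x by rewrite mulr_ge0.
  have tn : (Num.trunc (n%:R * h x) <= n)%N.
    rewrite -(ler_nat R) (le_trans (_ : _ <= n%:R * h x))// ?truncn_le//.
    by rewrite -[leRHS]mulr1 ler_wpM2l//; have /andP[] := h01 x.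
  rewrite (eq_bigr (fun k : 'I_n => (k < Num.trunc (n%:R * h x))%N%:R)); last first.
    move=> k _; rewrite indicE; congr (nat_of_bool _)%:R; rewrite truncn_gt_nat.
    by apply/idP/idP => [/set_mem//|?]; exact/mem_set.
  rewrite -natr_sum; congr (_%:R).
  rewrite -(big_mkord xpredT (fun k => (k < Num.trunc (n%:R * h x))%N : nat)).
  rewrite (@big_cat_nat _ _ _ (Num.trunc (n%:R * h x)))//=.
  rewrite [X in (X + _)%N](_ : _ = Num.trunc (n%:R * h x)); last first.
    rewrite big_nat (eq_bigr (fun=> 1%N)); last by move=> i /andP[_ ->].
    by rewrite -big_nat sum_nat_const_nat subn0 muln1.
  rewrite big_nat big1 ?addn0// => i /andP[ti _].
  by rewrite ltnNge ti.
have cS n m : bclosure G (fun x => \sum_(k < m) \1_(A n k) x).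
  elim: m => [|m IH]; first by under eq_fun do rewrite big_ord0; exact: bclosure_cst.
  under eq_fun do rewrite big_ord_recr/=.
  by apply: bclosureD => //; exact: Gindic.
have cH n : bclosure G (H n) by exact: bclosureZ (cS n n).
apply: (bclosure_lim (M := 1) cH) => [n x|x].
  rewrite /H sumE; have [->|n0] := posnP n; first by rewrite invr0 mul0r normr0.
  have n0' : 0 < n%:R :> R by rewrite ltr0n.
  rewrite ger0_norm ?mulr_ge0 ?invr_ge0// ler_pdivrMl// mulr1.
  rewrite (le_trans (_ : _ <= n%:R * h x))// ?truncn_le ?mulr_ge0//.
  by rewrite -[leRHS]mulr1 ler_wpM2l//; have /andP[] := h01 x.
rewrite -cvg_shiftS/=.
apply: (@squeeze_cvgr _ _ _ _ (fun n => h x - n.+1%:R^-1) (fun=> h x)).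
- near=> n; rewrite /H sumE; have n0 : 0 < n.+1%:R :> R by [].
  have nh0 : 0 <= n.+1%:R * h x by rewrite mulr_ge0.
  have /andP[a b] := truncn_itv nh0; rewrite ler_pdivrMl// a andbT.
  rewrite ler_pdivlMl// mulrBr divff ?gt_eqF// lerBlDr ltW//.
  by rewrite natr1.
- rewrite -[X in _ --> X]subr0; apply: cvgB; first exact: cvg_cst.
  by have := @cvg_harmonic R.
- exact: cvg_cst.
Unshelve. all: by end_near. Qed.

End bclosure_bounded.

Section log_gamma_law.
Context {R : realType} (theta : R).
Hypothesis theta_gt0 : 0 < theta.
Local Notation pos := (`]0%R, +oo[%classic : set (measurableTypeR R)).
Local Notation mu := (@lebesgue_measure R).
Local Notation W := (gamma_weight theta).

(** Substitute (1 + l) t for t in the integral that defines Gamma. *)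
Lemma gamma_weight_laplace l : 0 <= l ->
  (\int[mu]_(t in `]0%R, +oo[) (expR (- (l * t)) * W t)%:E =
   (expR (- (theta * ln (1 + l))) * Gamma theta)%:E)%E.
Proof.
move=> l0; have c0 : 0 < 1 + l by rewrite ltr_pwDl.
have mE : measurable_fun setT (fun t : R => (expR (- (l * t)) * W t)).
  apply: measurable_funM; last exact: measurable_gamma_weight.
  by apply: measurable_exp_scaled.
have E0 t : 0 <= expR (- (l * t)) * W t by rewrite mulr_ge0 ?expR_ge0 ?gamma_weight_ge0.
set X := (LHS).
have : (Gamma theta)%:E = ((1 + l)%:E * ((expR ((theta - 1) * ln (1 + l)))%:E * X))%E.
  rewrite (EFin_Gamma theta_gt0) (ge0_integral_scale c0)//; last 2 first.
  - by apply/measurable_EFinP; exact: measurable_gamma_weight.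
  - by move=> t; rewrite lee_fin gamma_weight_ge0.
  congr (_ * _)%E; rewrite /X -ge0_integralZl_EFin//; last 2 first.
  - by move=> t _; rewrite lee_fin.
  - by apply/measurable_EFinP; apply: measurable_funTS.
  apply: eq_integral => t; rewrite inE/= in_itv/= andbT => t0; rewrite -EFinM; congr EFin.
  rewrite /gamma_weight powRM ?(ltW c0) ?(ltW t0)// {1}/powR gt_eqF//.
  rewrite (_ : - ((1 + l) * t) = - (l * t) + - t); last by ring.
  by rewrite expRD; ring.
move=> GX; rewrite EFinM GX muleA -EFinM muleA -EFinM.
rewrite (_ : _ * _ * _ = 1) ?mul1e//.
rewrite -[X in _ * X * _](lnK (_ : 1 + l \is Num.pos)) ?posrE// -!expRD.
rewrite -[RHS]expR0; congr expR; ring.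
Qed.

Variable lam : probability R R.
Hypothesis lam_laplace : forall l, 0 <= l ->
  (\int[lam]_u (expR (- (l * expR u)))%:E = (expR (- (theta * ln (1 + l))))%:E)%E.

Let w : measurableTypeR R -> R := (fun t => W t / Gamma theta) \_ pos.

Let w_ge0 t : 0 <= w t.
Proof.
rewrite /w patchE; case: ifPn => // _.
by rewrite divr_ge0 ?gamma_weight_ge0// ltW// Gamma_gt0.
Qed.

Let mwd : measurable_fun setT (fun t : measurableTypeR R => W t / Gamma theta).
Proof. by apply: measurable_funM; [exact: measurable_gamma_weight|exact: measurable_cst]. Qed.

Let mw : measurable_fun setT w.
Proof.
apply/(measurable_restrictT _ (measurable_itv _)).
exact: measurable_funTS.
Qed.

Let iw : mu.-integrable setT (EFin \o w).
Proof.
have -> : EFin \o w = (EFin \o (fun t : measurableTypeR R => W t / Gamma theta)) \_ pos.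
  by apply/funext => t; rewrite /= /w !patchE; case: ifPn.
have mpos : measurable pos by exact: measurable_itv.
apply: (iffLR (integrable_mkcond _ _)) => //.
move: (integrableZl mpos (Gamma theta)^-1 (gamma_weight_integrable theta_gt0)).
by apply: eq_integrable => // t _ /=; rewrite -EFinM mulrC.
Qed.

Let mln : measurable_fun setT (@ln R : measurableTypeR R -> R).
Proof. exact: measurable_ln. Qed.

Let w_integral (h : R -> R) : measurable_fun setT h -> (forall x, 0 <= h x) ->
  (\int[mu]_t (w t * h (ln t))%:E =
   \int[mu]_(t in `]0%R, +oo[) (W t / Gamma theta * h (ln t))%:E)%E.
Proof.
move=> mh h0; rewrite [in RHS]integral_mkcond; apply: eq_integral => t _.
by rewrite /w !patchE; case: ifPn => // _; rewrite mul0r.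
Qed.

(** The Laplace transform of e^u determines the law of u, and the one of [lam] is
    that of a gamma variable. *)
Lemma log_gamma_integral (h : R -> R) : measurable_fun setT h ->
  (forall x, 0 <= h x <= 1) ->
  (\int[lam]_u (h u)%:E =
   \int[mu]_(t in `]0%R, +oo[) (W t / Gamma theta * h (ln t))%:E)%E.
Proof.
move=> mh h01; have h0 x : 0 <= h x by have /andP[] := h01 x.
have hN x : `|h x| <= 1 by rewrite ger0_norm//; have /andP[] := h01 x.
have G0 := Gamma_gt0 theta_gt0.
have i1 : lam.-integrable setT (EFin \o (fun=> 1 : R)).
  by apply: unit_integrable => // u; rewrite ler01 lexx.
have : \int[lam]_u (1 * h u) = \int[mu]_t (w t * h (ln t)).
  apply: (@bclosure_integral_eq _ _ _ _ log_exponentials_measurable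
    log_exponentials_bounded _ _ lam _ _ _ id (@ln R : measurableTypeR R -> R) (fun=> 1) w) => //.
  - move=> _ [l l0 ->]; apply: EFin_inj.
    have mE : measurable_fun setT (fun u : R => expR (- (l * expR u))).
      by apply: measurable_exp_scaled.
    have E01 (u : R) : 0 <= expR (- (l * expR u)) <= 1.
      by rewrite expR_ge0/= -expR0 ler_expR oppr_le0 mulr_ge0 ?expR_ge0.
    rewrite EFin_Rintegral; last first.
      by under eq_fun do rewrite mul1r; exact: unit_integrable.
    under eq_integral do rewrite mul1r.
    rewrite lam_laplace// /Rintegral fineK; last first.
      apply: integrable_fin_num => //.
      apply: (weighted_integrable iw (M := 1)).
        exact: (measurableT_comp mE mln).
      by move=> t; have /andP[? ?] := E01 (ln t); rewrite ger0_norm.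
    have E0 (u : R) : 0 <= expR (- (l * expR u)) by have /andP[] := E01 u.
    apply: (etrans _ (esym (w_integral mE E0))).
    transitivity (\int[mu]_(t in `]0%R, +oo[)
        ((Gamma theta)^-1%:E * (expR (- (l * t)) * W t)%:E))%E.
      rewrite ge0_integralZl_EFin//.
      + by rewrite gamma_weight_laplace// -EFinM; congr EFin; rewrite [RHS]mulrC mulfK// gt_eqF.
      + by move=> t _; rewrite lee_fin mulr_ge0 ?expR_ge0 ?gamma_weight_ge0.
      + apply/measurable_EFinP; apply: measurable_funTS; apply: measurable_funM.
          by apply: measurable_exp_scaled.
        exact: measurable_gamma_weight.
      + by rewrite invr_ge0 ltW.
    apply: eq_integral => t; rewrite inE/= in_itv/= andbT => t0.
    by rewrite -EFinM lnK ?posrE//; congr EFin; ring.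
  - apply: bclosure_unit_measurable => //; first exact: log_exponentials_determine.
    by exists 0 => //; apply/funext => u; rewrite mul0r oppr0 expR0.
move=> e; have := congr1 EFin e.
rewrite EFin_Rintegral; last first.
  by under eq_fun do rewrite mul1r; exact: unit_integrable.
under eq_integral do rewrite mul1r.
move=> ->; rewrite /Rintegral fineK; last first.
  apply: integrable_fin_num => //.
  by apply: (weighted_integrable iw (M := 1)) => //; exact: (measurableT_comp mh mln).
by rewrite w_integral.
Qed.

End log_gamma_law.

(** * Mixtures over the scale *)

Section gamma_mixture.
Context {R : realType} (theta : R) (PD : probability (simplex R) R)
  (lam : probability R R).
Hypothesis theta_gt0 : 0 < theta.
Hypothesis lamP : laplace_identity theta PD lam.
Local Notation pos := (`]0%R, +oo[%classic : set (measurableTypeR R)).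
Local Notation mu := (@lebesgue_measure R).
Local Notation W := (gamma_weight theta).

(** For a constant f the symmetric product is e^(- l T). *)
Lemma lam_laplace l : 0 <= l ->
  (\int[lam]_u (expR (- (l * expR u)))%:E = (expR (- (theta * ln (1 + l))))%:E)%E.
Proof.
move=> l0.
have mf : measurable_fun setT ((fun=> l) : measurableTypeR R -> R) by exact: (measurable_cst (l : R)).
have iln : (@unif R).-integrable setT (EFin \o (fun=> ln (1 + l))).
  by apply: (@bounded_integrable _ _ _ _ _ `|ln (1 + l)|).
have := lamP mf (fun=> l0) iln; rewrite probability_Rintegral_cst => <-.
have E p : symmetric_laplace (@unif R) (fun=> l) p = expR (- (l * expR p.2)).
  rewrite -(@iprod_expR _ (fun i => l * expR p.2 * p.1 i)); last exact: scaled_series.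
  congr iprod; apply/funext => i; rewrite /laplace probability_Rintegral_cst.
  by congr expR; ring.
have mE : measurable_fun setT (fun u : R => expR (- (l * expR u))).
  by apply: measurable_exp_scaled.
under [RHS]eq_integral do rewrite E.
rewrite (fubini_tonelli1 (fun p : simplex R * R => (expR (- (l * expR p.2)))%:E))//=.
- rewrite /fubini_F/=.
  rewrite (_ : (\int[lam]_u _)%E = (fine (\int[lam]_u (expR (- (l * expR u)))%:E))%:E)%E.
    by rewrite probability_integral_cst.
  rewrite fineK//; apply: integrable_fin_num => //; apply: unit_integrable => // u.
  by rewrite expR_ge0/= -expR0 ler_expR oppr_le0 mulr_ge0 ?expR_ge0.
- by apply/measurable_EFinP; exact: measurableT_comp mE measurable_snd.
Qed.

Context d (S : measurableType d) (U : probability S R).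

Lemma laplace_identity_tonelli (f : S -> R) : measurable_fun setT f ->
  (forall s, 0 <= f s) -> U.-integrable setT (EFin \o (fun s => ln (1 + f s))) ->
  (\int[PD]_y \int[lam]_u (symmetric_laplace U f (y, u))%:E =
   (expR (- (theta * \int[U]_s ln (1 + f s))))%:E)%E.
Proof.
move=> mf f0 iln; rewrite -(lamP mf f0 iln).
rewrite (fubini_tonelli1 (fun p => (symmetric_laplace U f p)%:E))//.
- by apply/measurable_EFinP; exact: measurable_symmetric_laplace.
- by move=> p; rewrite lee_fin; have /andP[] := symmetric_laplace_unit U p mf f0.
Qed.

Definition gamma_kernel (c : R) (t : R) : R :=
  t `^ (theta - 1) / Gamma theta * expR (- (c * t)).

Lemma gamma_kernel_ge0 c t : 0 <= gamma_kernel c t.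
Proof.
by rewrite mulr_ge0 ?expR_ge0// divr_ge0 ?powR_ge0// ltW// Gamma_gt0.
Qed.

Lemma measurable_gamma_kernel c : measurable_fun setT (gamma_kernel c).
Proof.
apply: measurable_funM.
  by apply: measurable_funM; [exact: measurable_powR|exact: measurable_cst].
by apply: measurable_exp_scaled.
Qed.

Lemma measurable_symmetric_ln (f : S -> R) : measurable_fun setT f ->
  (forall s, 0 <= f s) ->
  measurable_fun setT (fun z : simplex R * measurableTypeR R =>
    symmetric_laplace U f (z.1, ln z.2)).
Proof.
move=> mf f0.
apply: (measurableT_comp (measurable_symmetric_laplace U mf f0)
  (g := fun z : simplex R * measurableTypeR R => (z.1, ln z.2))).
apply: measurable_fun_pair; first exact: measurable_fst.
exact: measurableT_comp (@measurable_ln R) measurable_snd.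
Qed.

Lemma pos_integral_scaled_eq (k l : R) (g h : measurableTypeR R -> R) :
  0 <= k -> 0 <= l -> (forall t, 0 <= g t) -> (forall t, 0 <= h t) ->
  measurable_fun setT g -> measurable_fun setT h ->
  (forall t : R, 0 < t -> k * g t = l * h t) ->
  (k%:E * \int[mu]_(t in `]0%R, +oo[) (g t)%:E = l%:E * \int[mu]_(t in `]0%R, +oo[) (h t)%:E)%E.
Proof.
move=> k0 l0 g0 h0 mg mh e.
have ZE (m : R) (f : measurableTypeR R -> R) : 0 <= m -> (forall t, 0 <= f t) -> measurable_fun setT f ->
    (m%:E * \int[mu]_(t in `]0%R, +oo[) (f t)%:E = \int[mu]_(t in `]0%R, +oo[) (m%:E * (f t)%:E))%E.
  move=> m0 f0 mf; rewrite ge0_integralZl_EFin//.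
    by move=> t _; rewrite lee_fin.
  by apply/measurable_EFinP; exact: measurable_funTS.
rewrite !ZE//.
by apply: eq_integral => t; rewrite inE/= in_itv/= andbT => t0; rewrite -!EFinM e.
Qed.

(** Substituting t / c for t brings the kernel e^(- c t) back to the gamma
    density, and divides f by c. *)
Lemma gamma_mixture_scaled (f : S -> R) (c : R) : measurable_fun setT f ->
  (forall s, 0 <= f s) -> U.-integrable setT (EFin \o (fun s => ln (1 + c^-1 * f s))) ->
  0 < c ->
  (\int[PD]_y \int[mu]_(t in `]0%R, +oo[)
     (gamma_kernel c t * symmetric_laplace U f (y, ln t))%:E =
   (expR (- (theta * \int[U]_s ln (c + f s))))%:E)%E.
Proof.
move=> mf f0 iln c0.
have cV0 : 0 < c^-1 by rewrite invr_gt0.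
have mfc : measurable_fun setT (fun s => c^-1 * f s).
  by apply: measurable_funM => //; exact: measurable_cst.
have fc0 s : 0 <= c^-1 * f s by rewrite mulr_ge0 ?(ltW cV0).
have G0 := Gamma_gt0 theta_gt0.
have mS y : measurable_fun setT (fun t : measurableTypeR R => symmetric_laplace U f (y, ln t)).
  exact: (measurableT_comp (measurable_symmetric_ln mf f0) (pair1_measurable y)).
have S0 (g : S -> R) p : measurable_fun setT g -> (forall s, 0 <= g s) -> 0 <= symmetric_laplace U g p.
  by move=> mg g0; have /andP[] := symmetric_laplace_unit U p mg g0.
have inner y : (\int[mu]_(t in `]0%R, +oo[)
     (gamma_kernel c t * symmetric_laplace U f (y, ln t))%:E =
   (expR (- (theta * ln c)))%:E * \int[lam]_u (symmetric_laplace U (fun s => c^-1 * f s) (y, u))%:E)%E.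
  have mh : measurable_fun setT (fun u : R => symmetric_laplace U (fun s => c^-1 * f s) (y, u)).
    exact: (measurableT_comp (measurable_symmetric_laplace U mfc fc0) (pair1_measurable y)).
  rewrite (log_gamma_integral theta_gt0 lam_laplace mh); last by move=> u; exact: symmetric_laplace_unit.
  have mK : measurable_fun setT (fun t : measurableTypeR R => (gamma_kernel c t * symmetric_laplace U f (y, ln t))%:E).
    by apply/measurable_EFinP; apply: measurable_funM; [exact: measurable_gamma_kernel|exact: mS].
  have K0 t : (0 <= (gamma_kernel c t * symmetric_laplace U f (y, ln t))%:E)%E.
    by rewrite lee_fin mulr_ge0 ?gamma_kernel_ge0// S0.
  apply: (etrans (ge0_integral_scale cV0 mK K0)).
  apply: (pos_integral_scaled_eq
    (g := fun t : measurableTypeR R => gamma_kernel c (c^-1 * t) * symmetric_laplace U f (y, ln (c^-1 * t)))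
    (h := fun t : measurableTypeR R => W t / Gamma theta * symmetric_laplace U (fun s => c^-1 * f s) (y, ln t))).
  - exact: ltW.
  - exact: expR_ge0.
  - move=> t; apply: mulr_ge0; [exact: gamma_kernel_ge0|exact: S0].
  - move=> t; apply: mulr_ge0; last exact: S0.
    by rewrite divr_ge0 ?gamma_weight_ge0// ltW.
  - apply: (measurableT_comp (f := fun t : measurableTypeR R => gamma_kernel c t * symmetric_laplace U f (y, ln t)) (g := fun t : measurableTypeR R => c^-1 * t : measurableTypeR R)).
      by apply: measurable_funM; [exact: measurable_gamma_kernel|exact: mS].
    by apply: measurable_funM => //; exact: measurable_cst.
  - apply: measurable_funM.
      by apply: measurable_funM; [exact: measurable_gamma_weight|exact: measurable_cst].
    exact: (measurableT_comp mh (@measurable_ln R)).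
  move=> t t0.
  rewrite -(symmetric_laplace_shift U f y (ln t) cV0) addrC -lnM ?posrE//.
  move: (symmetric_laplace _ _ _) => s.
  rewrite /gamma_kernel /gamma_weight powRM ?(ltW cV0) ?(ltW t0)//.
  rewrite (mulrA c c^-1) divff ?gt_eqF// mul1r.
  rewrite {1}/powR gt_eqF// lnV ?posrE//.
  rewrite -{1}[c^-1](lnK (_ : c^-1 \is Num.pos)) ?posrE// lnV ?posrE//.
  rewrite (_ : - (theta * ln c) = - ln c + (theta - 1) * - ln c); last by ring.
  by rewrite expRD; ring.
under eq_integral do rewrite inner.
rewrite ge0_integralZl_EFin//; last 2 first.
- by move=> y _; apply: integral_ge0 => u _; rewrite lee_fin S0.
- have := @measurable_fun_fubini_tonelli_F _ _ _ _ R lam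
    (fun p => (symmetric_laplace U (fun s => c^-1 * f s) p)%:E).
  apply; first by apply/measurable_EFinP; exact: measurable_symmetric_laplace.
  by move=> p; rewrite lee_fin S0.
rewrite laplace_identity_tonelli// -EFinM -expRD; congr EFin.
have e : \int[U]_s ln (c + f s) = ln c + \int[U]_s ln (1 + c^-1 * f s).
  rewrite -[X in _ = X + _](probability_Rintegral_cst U) -RintegralD//.
    apply: eq_Rintegral => s _; rewrite -lnM ?posrE// ?ltr_pwDl//.
    by congr ln; field; rewrite gt_eqF.
  by apply: (@bounded_integrable _ _ _ _ _ `|ln c|).
by rewrite e mulrDr opprD.
Qed.

End gamma_mixture.

Section log_integrals.
Context {R : realType} d (S : measurableType d) (U : probability S R) (f : S -> R).
Hypotheses (mf : measurable_fun setT f).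

Lemma ln_mono (x y : R) : 0 < x -> x <= y -> ln x <= ln y.
Proof. by move=> x0 xy; rewrite ler_ln ?posrE//; exact: lt_le_trans xy. Qed.

Lemma ln_onepM_le (k x : R) : 0 <= k -> 0 < x -> ln (1 + k * x) <= ln (1 + k) + `|ln x|.
Proof.
move=> k0 x0; have k1 : 0 < 1 + k by lra.
have [x1|/ltW x1] := leP x 1.
  rewrite -[leLHS]addr0 lerD//; apply: ln_mono; first by rewrite ltr_pwDl// mulr_ge0// ltW.
  by rewrite lerD2l ler_piMr.
rewrite ger0_norm ?ln_ge0// -lnM ?posrE//.
by apply: ln_mono; [rewrite ltr_pwDl// mulr_ge0// ltW|nra].
Qed.

Lemma onepM_ln_integrable k : 0 <= k -> (forall s, 0 < f s) ->
  U.-integrable setT (EFin \o (fun s => ln (f s))) ->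
  U.-integrable setT (EFin \o (fun s => ln (1 + k * f s))).
Proof.
move=> k0 f0 il.
have ib : U.-integrable setT (EFin \o (fun s => ln (1 + k) + `|ln (f s)|)).
  have -> : EFin \o (fun s => ln (1 + k) + `|ln (f s)|) =
    (EFin \o cst (ln (1 + k))) \+ (fun s => `|(ln (f s))%:E|)%E by [].
  apply: integrableD => //; last exact: integrable_abse.
  by apply: (@bounded_integrable _ _ _ _ _ `|ln (1 + k)|).
apply: (le_integrable measurableT _ _ ib).
- apply/measurable_EFinP; apply: (measurableT_comp (@measurable_ln R)).
  by apply: measurable_funD => //; apply: measurable_funM => //; exact: measurable_cst.
- move=> s _; rewrite lee_fin.
  have h1 : 0 <= ln (1 + k * f s) by rewrite ln_ge0// lerDl mulr_ge0// ltW.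
  rewrite (ger0_norm h1) ger0_norm; first exact: ln_onepM_le.
  by rewrite addr_ge0// ln_ge0// lerDl.
Qed.

Lemma ln_shift_integral_cvg : (forall s, 0 < f s) ->
  U.-integrable setT (EFin \o (fun s => ln (f s))) ->
  \int[U]_s ln (n.+1%:R^-1 + f s) @[n --> \oo] --> \int[U]_s ln (f s).
Proof.
move=> f0 il.
have ib : U.-integrable setT (EFin \o (fun s => ln 2 + `|ln (f s)|)).
  have -> : EFin \o (fun s => ln 2 + `|ln (f s)|) =
    (EFin \o cst (ln 2)) \+ (fun s => `|(ln (f s))%:E|)%E by [].
  apply: integrableD => //; last exact: integrable_abse.
  by apply: (@bounded_integrable _ _ _ _ _ `|ln 2|).
have h := @dominated_cvg _ _ _ U setT measurableT
  (fun n s => (ln (n.+1%:R^-1 + f s))%:E) (fun s => (ln (f s))%:E) _ _ _ _ ib.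
apply: fine_cvg; rewrite fineK; last exact: integrable_fin_num.
apply: h => //.
- move=> n; apply/measurable_EFinP; apply: (measurableT_comp (@measurable_ln R)).
  by apply: measurable_funD => //; exact: measurable_cst.
- move=> s _; apply: cvg_EFin; first by near=> n.
  apply: (continuous_cvg _ (@continuous_ln R _ (f0 s))).
  rewrite -[X in _ --> X]add0r; apply: cvgD; [exact: cvg_harmonic|exact: cvg_cst].
- move=> n s _; rewrite lee_fin.
  have n0 : 0 < n.+1%:R^-1 :> R by rewrite invr_gt0.
  have n1 : n.+1%:R^-1 <= 1 :> R by rewrite invf_le1 ?ler1n// ltr0n.
  have u : ln (n.+1%:R^-1 + f s) <= ln 2 + `|ln (f s)|.
    have := @ln_onepM_le 1 (f s) ler01 (f0 s); rewrite mul1r.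
    apply: le_trans; apply: ln_mono; first by rewrite addr_gt0.
    by rewrite lerD2r.
  have l : ln (f s) <= ln (n.+1%:R^-1 + f s) by apply: ln_mono => //; rewrite lerDr ltW.
  rewrite ler_norml u andbT; have := ler_norm (- ln (f s)); rewrite normrN.
  have := @ln_ge0 R 2 ltac:(lra); lra.
Unshelve. all: by end_near. Qed.

Lemma ln_scaled_integral_cvg0 : (forall s, 0 <= f s) ->
  U.-integrable setT (EFin \o (fun s => ln (1 + f s))) ->
  \int[U]_s ln (1 + n.+1%:R^-1 * f s) @[n --> \oo] --> (0 : R).
Proof.
move=> f0 il.
have h := @dominated_cvg _ _ _ U setT measurableT
  (fun n s => (ln (1 + n.+1%:R^-1 * f s))%:E) (fun s => 0%:E) _ _ _ _ il.
apply: fine_cvg; rewrite -(probability_integral_cst U 0).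
apply: h => //.
- move=> n; apply/measurable_EFinP; apply: (measurableT_comp (@measurable_ln R)).
  by apply: measurable_funD => //; apply: measurable_funM => //; exact: measurable_cst.
- move=> s _; apply: cvg_EFin; first by near=> n.
  rewrite -[X in _ --> X](@ln1 R).
  apply: (continuous_cvg _ (@continuous_ln R 1 ltr01)).
  rewrite -[X in _ --> X]addr0; apply: cvgD; first exact: cvg_cst.
  by rewrite -(mul0r (f s)); apply: cvgMl; exact: cvg_harmonic.
- move=> n s _; rewrite lee_fin.
  have n0 : 0 < n.+1%:R^-1 :> R by rewrite invr_gt0.
  have n1 : n.+1%:R^-1 <= 1 :> R by rewrite invf_le1 ?ler1n// ltr0n.
  have nf0 : 0 <= n.+1%:R^-1 * f s by rewrite mulr_ge0// ltW.
  rewrite ger0_norm; last by rewrite ln_ge0// lerDl.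
  by apply: ln_mono; [rewrite ltr_pwDl|rewrite lerD2l ler_piMl].
Unshelve. all: by end_near. Qed.

End log_integrals.

(** Otherwise the functions, bounded by 1, would all vanish on a set of positive
    measure, which would keep their integrals away from 1. *)
Lemma ae_exists_gt0 {R : realType} d (T : measurableType d) (P : probability T R)
    (h : nat -> T -> R) : (forall n, measurable_fun setT (h n)) ->
  (forall n x, 0 <= h n x <= 1) ->
  (\int[P]_x (h n x)%:E)%E @[n --> \oo] --> 1%:E ->
  {ae P, forall x, exists n, 0 < h n x}.
Proof.
move=> mh h01 h1.
pose N := \bigcap_n [set x | h n x = 0].
have mZ n : measurable [set x | h n x = 0].
  by rewrite -[X in measurable X]setTI; exact: (mh n measurableT [set 0] (measurable_set1 0)).
have mN : measurable N by apply: bigcapT_measurable.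
exists N; split => //; last first.
  move=> x /= nx n _ /=; apply/eqP; have /andP[h0 _] := h01 n x.
  rewrite eq_le h0 andbT leNgt; apply/negP => hx; apply: nx; by exists n.
apply/eqP; rewrite eq_le measure_ge0 andbT.
have le n : (\int[P]_x (h n x)%:E <= 1 - P N)%E.
  rewrite -(probability_setC P mN).
  rewrite -(mul1e (P (~` N))) -integral_cst; last exact: measurableC.
  rewrite [leRHS]integral_mkcond.
  apply: ge0_le_integral => //.
  - by move=> x _; rewrite lee_fin; have /andP[] := h01 n x.
  - by apply/measurable_EFinP.
  - by apply/(measurable_restrictT _ (measurableC mN)); exact: measurable_cst.
  - move=> x _; rewrite /patch; case: ifPn => [_|].
      by rewrite lee_fin; have /andP[] := h01 n x.
    by rewrite notin_setE /= => /contrapT Nx; rewrite (Nx n I).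
have : (1%:E <= 1 - P N)%E.
  apply: (cvge_le _ h1); first exact: nearW. 
have fN : P N \is a fin_num by exact: fin_num_measure.
rewrite -(fineK fN) -EFinB !lee_fin; lra.
Qed.

Lemma increasing_cvg_integral {R : realType} d (T : measurableType d)
    (m : {measure set T -> \bar R}) (D : set T) (g : nat -> T -> \bar R) (f : T -> \bar R) :
  measurable D -> (forall n, measurable_fun D (g n)) ->
  (forall n x, D x -> 0 <= g n x)%E ->
  (forall x, D x -> {homo g ^~ x : n k / (n <= k)%N >-> (n <= k)%E}) ->
  (forall x, D x -> g n x @[n --> \oo] --> f x) ->
  (\int[m]_(x in D) g n x)%E @[n --> \oo] --> (\int[m]_(x in D) f x)%E.
Proof.
move=> mD mg g0 g_mono gf.
rewrite (_ : (\int[m]_(x in D) f x = \int[m]_(x in D) limn (g ^~ x))%E); last first.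
  by apply: eq_integral => x; rewrite inE => Dx; apply/esym/cvg_lim => //; exact: gf.
by apply: cvg_monotone_convergence => // x Dx n k; exact: g_mono.
Qed.

Lemma measurable_pos_integral {R : realType} d (T : measurableType d)
    (F : T * measurableTypeR R -> \bar R) :
  measurable_fun setT F -> (forall z, 0 <= F z)%E ->
  measurable_fun setT (fun y => \int[@lebesgue_measure R]_(t in `]0%R, +oo[) F (y, t))%E.
Proof.
move=> mF F0.
pose D : set (T * measurableTypeR R) := snd @^-1` (`]0%R, +oo[%classic : set (measurableTypeR R)).
have mD : measurable D.
  by rewrite -[D]setTI; apply: measurable_snd => //; exact: measurable_itv.
have mFD : measurable_fun setT (F \_ D).
  by apply/(measurable_restrictT _ mD); exact: measurable_funTS.
have FD0 z : (0 <= (F \_ D) z)%E by rewrite /patch; case: ifP.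
have := @measurable_fun_fubini_tonelli_F _ _ T (measurableTypeR R) R (@lebesgue_measure R) (F \_ D) mFD FD0.
congr measurable_fun; apply/funext => y.
rewrite [RHS]integral_mkcond; apply: eq_integral => t _.
by rewrite /patch /D; congr (if _ then _ else _); apply/idP/idP; rewrite !inE.
Qed.

Section gamma_mixture_unshifted.
Context {R : realType} (theta : R) (PD : probability (simplex R) R)
  (lam : probability R R).
Hypothesis theta_gt0 : 0 < theta.
Hypothesis lamP : laplace_identity theta PD lam.
Local Notation pos := (`]0%R, +oo[%classic : set (measurableTypeR R)).
Local Notation mu := (@lebesgue_measure R).
Context d (S : measurableType d) (U : probability S R).

(** The scale has the infinite law t^(theta - 1) dt / Gamma(theta). *)
Definition gamma_mixture (f : S -> R) (y : simplex R) : \bar R :=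
  (\int[mu]_(t in `]0%R, +oo[)
     (t `^ (theta - 1) / Gamma theta * symmetric_laplace U f (y, ln t))%:E)%E.

(** Let c decrease to 0 in [gamma_mixture_scaled]: the integrands increase, and
    ln (c + f) is dominated by ln 2 + |ln f|. *)
Lemma gamma_mixture_integral (f : S -> R) : measurable_fun setT f ->
  (forall s, 0 < f s) -> U.-integrable setT (EFin \o (fun s => ln (f s))) ->
  (\int[PD]_y gamma_mixture f y = (expR (- (theta * \int[U]_s ln (f s))))%:E)%E.
Proof.
move=> mf f0 il; have f0' s : 0 <= f s by exact: ltW.
have cn n : 0 < n.+1%:R^-1 :> R by rewrite invr_gt0.
have iln n : U.-integrable setT (EFin \o (fun s => ln (1 + (n.+1%:R^-1)^-1 * f s))).
  by apply: onepM_ln_integrable => //; rewrite invrK.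
have E n := gamma_mixture_scaled theta_gt0 lamP mf f0' (iln n) (cn n).
have S0 p : 0 <= symmetric_laplace U f p.
  by have /andP[] := symmetric_laplace_unit U p mf f0'.
pose g n y (t : R) : \bar R := (gamma_kernel theta n.+1%:R^-1 t * symmetric_laplace U f (y, ln t))%:E.
have g0 n y t : (0 <= g n y t)%E.
  by rewrite lee_fin mulr_ge0// gamma_kernel_ge0.
have mg n : measurable_fun setT (fun z : simplex R * measurableTypeR R => g n z.1 z.2).
  apply/measurable_EFinP; apply: measurable_funM.
    exact: measurableT_comp (measurable_gamma_kernel theta _) measurable_snd.
  exact: measurable_symmetric_ln.
have mgy n y : measurable_fun setT (g n y : measurableTypeR R -> \bar R).
  exact: (measurableT_comp (mg n) (pair1_measurable y)).
have g_mono y t : 0 < t -> {homo g ^~ y ^~ t : n m / (n <= m)%N >-> (n <= m)%E}.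
  move=> t0 n m nm; rewrite lee_fin ler_wpM2r// ler_wpM2l ?divr_ge0 ?powR_ge0 ?(ltW (Gamma_gt0 _))//.
  by rewrite ler_expR lerN2 ler_wpM2r ?(ltW t0)// lef_pV2 ?posrE// ler_nat.
have inner y : (\int[mu]_(t in `]0%R, +oo[) g n y t)%E @[n --> \oo] --> gamma_mixture f y.
  apply: increasing_cvg_integral => //.
  - by move=> n; apply: measurable_funTS.
  - by move=> t; rewrite /= in_itv/= andbT => t0 n m nm; exact: g_mono.
  - move=> t _; apply: cvg_EFin; first by near=> n.
    apply: cvgMl; rewrite /gamma_kernel -[X in _ --> X]mulr1.
    rewrite (_ : _ * 1 = t `^ (theta - 1) / Gamma theta * expR 0); last by rewrite expR0.
    apply: cvgMr; apply: continuous_cvg; first exact: continuous_expR.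
    rewrite -oppr0; apply: cvgN; rewrite -(mul0r t); apply: cvgMl; exact: cvg_harmonic.
have outer : (\int[PD]_y \int[mu]_(t in `]0%R, +oo[) g n y t)%E @[n --> \oo] -->
    (\int[PD]_y gamma_mixture f y)%E.
  apply: increasing_cvg_integral => //.
  - move=> n; exact: (measurable_pos_integral (mg n) (fun z => g0 n z.1 z.2)).
  - by move=> n y _; apply: integral_ge0 => t _; exact: g0.
  - move=> y _ n m nm; apply: ge0_le_integral => //.
    + by apply: measurable_funTS; exact: mgy.
    + by apply: measurable_funTS; exact: mgy.
    + by move=> t; rewrite /= in_itv/= andbT => t0; exact: g_mono.
have := cvg_unique _ outer.
apply => //; rewrite /=.
rewrite (_ : (fun n => _) = fun n => (expR (- (theta * \int[U]_s ln (n.+1%:R^-1 + f s))))%:E); last by apply/funext => n; rewrite -E.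

apply: cvg_EFin; first by near=> n.
apply: continuous_cvg; first exact: continuous_expR.
apply: cvgN; apply: cvgMr; exact: ln_shift_integral_cvg.
Unshelve. all: by end_near. Qed.

Lemma symmetric_laplace_small (f : S -> R) : measurable_fun setT f ->
  (forall s, 0 <= f s) -> U.-integrable setT (EFin \o (fun s => ln (1 + f s))) ->
  (\int[PD \x lam]_p (symmetric_laplace U (fun s => n.+1%:R^-1 * f s) p)%:E)%E @[n --> \oo] --> 1%:E.
Proof.
move=> mf f0 il.
have mfn n : measurable_fun setT (fun s => n.+1%:R^-1 * f s).
  by apply: measurable_funM => //; exact: measurable_cst.
have fn0 n s : 0 <= n.+1%:R^-1 * f s by rewrite mulr_ge0.
have iln n : U.-integrable setT (EFin \o (fun s => ln (1 + n.+1%:R^-1 * f s))).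
  apply: (le_integrable measurableT _ _ il).
    apply/measurable_EFinP; apply: (measurableT_comp (@measurable_ln R)).
    by apply: measurable_funD => //; exact: measurable_cst.
  move=> s _; rewrite lee_fin.
  have n1 : n.+1%:R^-1 <= 1 :> R by rewrite invf_le1 ?ler1n// ltr0n.
  rewrite ger0_norm ?ln_ge0 ?lerDl// ger0_norm ?ln_ge0 ?lerDl//.
  by apply: ln_mono; [rewrite ltr_pwDl|rewrite lerD2l ler_piMl].
under eq_fun do rewrite lamP//.
apply: cvg_EFin; first by near=> n.
have h : - (theta * \int[U]_s ln (1 + n.+1%:R^-1 * f s)) @[n --> \oo] --> - (theta * 0).
  by apply: cvgN; apply: cvgMr; exact: ln_scaled_integral_cvg0.
move: h.
move=> /(continuous_cvg _ (@continuous_expR R _)).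
by rewrite mulr0 oppr0 expR0.
Unshelve. all: by end_near. Qed.

End gamma_mixture_unshifted.

(** * Averaging out independent positions *)

Section rectangles.
Context {R : realType} d1 (T1 : measurableType d1) d2 (T2 : measurableType d2).

Definition rectangle_indics : set (T1 * T2 -> R) :=
  [set h | exists A B, [/\ measurable A, measurable B & h = \1_(A `*` B)]].

Lemma rectangles_determine (h : T1 * T2 -> R) : measurable_fun setT h ->
  (forall z, 0 <= h z <= 1) -> bclosure rectangle_indics h.
Proof.
have G1 : rectangle_indics (fun=> 1).
  by exists setT, setT; split => //; apply/funext => z; rewrite setXTT indicT.
apply: bclosure_unit_measurable => //; apply: bclosure_indic => //.
- move=> f g [A [B [mA mB ->]]] [C [D [mC mD ->]]]; exists (A `&` C), (B `&` D).
  split; [exact: measurableI|exact: measurableI|].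
  by rewrite setXI; apply/funext => z; rewrite indicI.
- by move=> g [A [B [mA mB ->]]]; exists 1 => z; rewrite ger0_norm// indicE; case: (_ \in _).
- move=> d' T' Psi mPsi.
  have pre A B : measurable A -> measurable B -> measurable (Psi @^-1` (A `*` B)).
    move=> mA mB; have /(_ (ex_intro _ A (ex_intro _ B (And3 mA mB erefl)))) := mPsi (\1_(A `*` B)).
    move=> /(_ measurableT [set 1] (measurable_set1 1)); rewrite setTI.
    congr measurable; apply/seteqP; split => t /=; rewrite indicE.
      by case: (boolP (_ \in _)) => [/set_mem//|_ /eqP]; rewrite eq_sym oner_eq0.
    by move=> ABt; rewrite mem_set.
  apply/prod_measurable_funP; split => _ C mC; rewrite setTI.
    have := pre _ _ mC measurableT; congr measurable.
    by apply/seteqP; split => t //= [].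
  have := pre _ _ measurableT mC; congr measurable.
  by apply/seteqP; split => t //= [].
Qed.

Context d3 (S1 : measurableType d3) (m1 : probability S1 R)
  d4 (S2 : measurableType d4) (m2 : probability S2 R).

Lemma rectangles_integral_eq (Z1 : S1 -> T1 * T2) (Z2 : S2 -> T1 * T2)
    (w1 : S1 -> R) (w2 : S2 -> R) (h : T1 * T2 -> R) :
  measurable_fun setT Z1 -> measurable_fun setT Z2 ->
  measurable_fun setT w1 -> (forall x, 0 <= w1 x <= 1) ->
  measurable_fun setT w2 -> (forall x, 0 <= w2 x <= 1) ->
  measurable_fun setT h -> (forall x, 0 <= h x <= 1) ->
  (forall A B, measurable A -> measurable B ->
    (\int[m1]_x (w1 x * \1_(A `*` B) (Z1 x))%:E = \int[m2]_x (w2 x * \1_(A `*` B) (Z2 x))%:E)%E) ->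
  (\int[m1]_x (w1 x * h (Z1 x))%:E = \int[m2]_x (w2 x * h (Z2 x))%:E)%E.
Proof.
move=> mZ1 mZ2 mw1 w1b mw2 w2b mh hb e.
have I d (S : measurableType d) (m : probability S R) (w g : S -> R) :
    measurable_fun setT w -> (forall x, 0 <= w x <= 1) ->
    measurable_fun setT g -> (forall x, 0 <= g x <= 1) ->
    m.-integrable setT (EFin \o (fun x => w x * g x)).
  move=> mw wb mg gb; apply: unit_integrable; first exact: measurable_funM.
  move=> x; have /andP[w0 w1'] := wb x; have /andP[g0 g1] := gb x.
  by rewrite mulr_ge0// mulr_ile1.
have Gm g : rectangle_indics g -> measurable_fun setT g.
  by move=> [A [B [mA mB ->]]]; apply: measurable_indic; exact: measurableX.
have G01 g z : rectangle_indics g -> 0 <= g z <= 1.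
  by move=> [A [B [mA mB ->]]]; rewrite indicE; case: (_ \in _); rewrite !lexx ?ler01.
have Gb g : rectangle_indics g -> exists M : R, forall x, `|g x| <= M.
  by move=> Gg; exists 1 => x; have /andP[? ?] := G01 g x Gg; rewrite ger0_norm.
have := @bclosure_integral_eq _ _ _ _ Gm Gb _ _ m1 _ _ m2 Z1 Z2 w1 w2 mZ1 mZ2
  (unit_integrable m1 mw1 w1b) (unit_integrable m2 mw2 w2b) _ h (rectangles_determine mh hb).
move=> E; rewrite -!EFin_Rintegral ?E//.
- move=> g Gg; apply: EFin_inj; rewrite !EFin_Rintegral.
  + by case: Gg => A [B [mA mB ->]]; exact: e.
  + apply: I => //; first exact: measurableT_comp (Gm _ Gg) mZ2.
    by move=> x; exact: G01.
  + apply: I => //; first exact: measurableT_comp (Gm _ Gg) mZ1.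
    by move=> x; exact: G01.
- by apply: I => //; exact: measurableT_comp.
- by apply: I => //; exact: measurableT_comp.
Qed.

End rectangles.

Section averages.
Context {R : realType} d1 (T : measurableType d1) d2 (S : measurableType d2)
  (U : probability S R) (F : T * S -> R).
Hypotheses (mF : measurable_fun setT F) (F01 : forall z, 0 <= F z <= 1).

Definition average (y : T) : R := \int[U]_s F (y, s).

Lemma averageE y : ((average y)%:E = \int[U]_s (F (y, s))%:E)%E.
Proof.
rewrite EFin_Rintegral//; apply: unit_integrable => //.
exact: measurableT_comp mF (pair1_measurable y).
Qed.

Lemma average_unit y : 0 <= average y <= 1.
Proof.
rewrite -!lee_fin averageE integral_ge0//=; last first.
  by move=> s _; rewrite lee_fin; have /andP[] := F01 (y, s).
rewrite -(probability_integral_cst U 1); apply: ge0_le_integral => //.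
- by move=> s _; rewrite lee_fin; have /andP[] := F01 (y, s).
- by apply/measurable_EFinP; exact: measurableT_comp mF (pair1_measurable y).
- by move=> s _; rewrite lee_fin; have /andP[] := F01 (y, s).
Qed.

Lemma measurable_average : measurable_fun setT average.
Proof.
apply: measurableT_comp => //.
apply: (@measurable_fun_fubini_tonelli_F _ _ T S R U (fun z => (F z)%:E)).
  exact/measurable_EFinP.
by move=> z; rewrite lee_fin; have /andP[] := F01 z.
Qed.

End averages.

Section iid.
Context {R : realType} dO (Om : measurableType dO) (P : probability Om R)
  d1 (T : measurableType d1) d2 (S : measurableType d2) (U : probability S R).
Variables (Y : Om -> T) (X : nat -> Om -> S).
Hypotheses (mY : measurable_fun setT Y) (mX : forall i, measurable_fun setT (X i)).
Hypothesis indep : forall n (A : set T) (B : nat -> set S),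
  measurable A -> (forall i, measurable (B i)) ->
  (P (Y @^-1` A `&` \bigcap_(i < n) (X i @^-1` B i)) =
   P (Y @^-1` A) * \prod_(i < n) U (B i))%E.

Let unit_fun (F : T * S -> R) := measurable_fun setT F /\ forall z, 0 <= F z <= 1.

Let measurable_YX (F : T * S -> R) i : measurable_fun setT F ->
  measurable_fun setT (fun w => F (Y w, X i w)).
Proof.
move=> mF; apply: measurableT_comp mF _; exact: measurable_fun_pair.
Qed.

(** The factors are averaged one index after the other.  While the first k
    factors are arbitrary, the others are indicators of sets of positions; at
    index k, indicators of rectangles extend to functions of (Y, X_k). *)
Lemma indep_average_prod n (A : set T) (F : nat -> T * S -> R) : measurable A ->
  (forall i, unit_fun (F i)) ->
  (\int[P]_w (\1_A (Y w) * \prod_(i < n) F i (Y w, X i w))%:E =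
   \int[P]_w (\1_A (Y w) * \prod_(i < n) average U (F i) (Y w))%:E)%E.
Proof.
suff H k : (k <= n)%N -> forall A F, measurable A -> (forall i, unit_fun (F i)) ->
    (forall i, (k <= i)%N -> exists2 B, measurable B & F i = \1_B \o snd) ->
  (\int[P]_w (\1_A (Y w) * \prod_(i < n) F i (Y w, X i w))%:E =
   \int[P]_w (\1_A (Y w) * \prod_(i < n) average U (F i) (Y w))%:E)%E.
  move=> mA uF.
  pose F' i := if (i < n)%N then F i else \1_setT \o snd.
  have := H n (leqnn n) A F' mA.
  have eF (i : 'I_n) : F' i = F i by rewrite /F' ltn_ord.
  have p1 w : \prod_(i < n) F' i (Y w, X i w) = \prod_(i < n) F i (Y w, X i w).
    by apply: eq_bigr => i _; rewrite eF.
  have p2 w : \prod_(i < n) average U (F' i) (Y w) = \prod_(i < n) average U (F i) (Y w).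
    by apply: eq_bigr => i _; rewrite eF.
  under eq_integral do rewrite p1.
  under [X in (_ -> _ -> _ = X) -> _]eq_integral do rewrite p2.
  apply.
    move=> i; rewrite /F'; case: ifP => // _; split.
      by apply: measurableT_comp measurable_snd; exact: measurable_indic.
    by move=> z; rewrite /= indicT lexx ler01.
  by move=> i ni; exists setT => //; rewrite /F' ltnNge ni.
elim: k => [_|k IH kn] {}A {}F mA uF.
  move=> FB; pose B i := sval (cid2 (FB i (leq0n i))).
  have mB i : measurable (B i) by rewrite /B; case: cid2.
  have FE i : F i = \1_(B i) \o snd by rewrite /B; case: cid2.
  have avB i y : average U (F i) y = fine (U (B i)).
    rewrite /average /Rintegral; congr fine.
    rewrite FE (eq_integral (fun s => (\1_(B i) s)%:E))//.
    by rewrite integral_indic// setIT.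
  have uB i : ((fine (U (B i)))%:E = U (B i))%E by rewrite fineK// fin_num_measure.
  under [RHS]eq_integral do under eq_bigr do rewrite avB.
  have mYA : measurable (Y @^-1` A) by rewrite -[X in measurable X]setTI; exact: mY.
  have := indep n mA mB.
  have mXB : measurable (\bigcap_(i < n) (X i @^-1` B i)).
    rewrite bigcap_mkcond; apply: bigcapT_measurable => i; case: ifP => // _.
    by rewrite -[X in measurable X]setTI; exact: mX.
  move=> e; transitivity (\int[P]_w (\1_(Y @^-1` A `&` \bigcap_(i < n) (X i @^-1` B i)) w)%:E)%E.
    apply: eq_integral => w _; congr EFin; rewrite indicI; congr (_ * _).
    rewrite indicE; case: (boolP (w \in _)) => [/set_mem Bw|].
      by rewrite big1// => i _; rewrite FE /= indicE mem_set//; exact: (Bw i (ltn_ord i)).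
    rewrite notin_setE => /existsNP[i /not_implyP[/= ni Bi]].
    rewrite (bigD1 (Ordinal ni))//= FE/= indicE memNset ?mul0r//.
  rewrite integral_indic ?setIT//; last exact: measurableI.
  apply: (etrans e); set c := \prod_(i < n) fine (U (B i)).
  have -> : (\prod_(i < n) U (B i) = c%:E)%E.
    rewrite /c; elim: {+}n => [|m IH]; first by rewrite !big_ord0.
    by rewrite !big_ord_recr/= IH EFinM uB.
  have c0 : 0 <= c by apply: prodr_ge0 => i _; exact: fine_ge0.
  transitivity (\int[P]_w (c%:E * (\1_(Y @^-1` A) w)%:E))%E; last first.
    by apply: eq_integral => w _; rewrite -EFinM mulrC.
  rewrite ge0_integralZl_EFin//.
    by rewrite integral_indic// setIT muleC.
  by apply/measurable_EFinP; exact: measurable_indic.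
move=> FB.
have un : (k < n)%N by [].
pose ko := Ordinal kn.
pose w1 w := \1_A (Y w) * \prod_(i < n | i != ko) F i (Y w, X i w).
pose w2 w := \1_A (Y w) * \prod_(i < n | i != ko) average U (F i) (Y w).
have av i := average_unit U (uF i).1 (uF i).2.
have mav i := measurable_average U (uF i).1 (uF i).2.
have unitM (a b : R) : 0 <= a <= 1 -> 0 <= b <= 1 -> 0 <= a * b <= 1.
  by move=> /andP[a0 a1] /andP[b0 b1]; rewrite mulr_ge0// mulr_ile1.
have A01 w : 0 <= (\1_A (Y w) : R) <= 1.
  by rewrite indicE; case: (_ \in _); rewrite !lexx ?ler01.
have mAY : measurable_fun setT (fun w => \1_A (Y w) : R).
  by apply: measurableT_comp mY; exact: measurable_indic.
have mprod (G : 'I_n -> Om -> R) : (forall i, measurable_fun setT (G i)) ->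
    measurable_fun setT (fun w => \prod_(i < n | i != ko) G i w).
  move=> mG; rewrite (_ : (fun w => _) = fun w => \prod_(i < n) if i != ko then G i w else 1).
    by apply: measurable_prod => i _; case: (i != ko).
  by apply/funext => w; rewrite big_mkcond.
have mw1 : measurable_fun setT w1.
  apply: measurable_funM => //; apply: mprod => i.
  by apply: measurable_YX; exact: (uF i).1.
have mw2 : measurable_fun setT w2.
  apply: measurable_funM => //; apply: mprod => i.
  exact: measurableT_comp (mav i) mY.
have w1b w : 0 <= w1 w <= 1.
  apply: (unitM) => //; apply: (big_ind (fun x => 0 <= x <= 1)) => [|x y|i _]; [|exact: unitM|]; first by rewrite ler01 lexx.
  exact: (uF i).2.
have w2b w : 0 <= w2 w <= 1.
  apply: (unitM) => //; apply: (big_ind (fun x => 0 <= x <= 1)) => [|x y|i _]; [|exact: unitM|]; first by rewrite ler01 lexx.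
  exact: av.
have E1 (G : nat -> T * S -> R) (C : set T) : (forall i : 'I_n, i != ko -> G i = F i) ->
    forall w, \1_C (Y w) * \prod_(i < n) G i (Y w, X i w) =
     \1_C (Y w) * (\prod_(i < n | i != ko) F i (Y w, X i w)) * G k (Y w, X k w).
  move=> GF w; rewrite (bigD1 ko)//= -mulrA [X in _ * X = _]mulrC; congr (_ * (_ * _)).
  by apply: eq_bigr => i ik; rewrite GF.
have E2 (G : nat -> T * S -> R) (C : set T) : (forall i : 'I_n, i != ko -> G i = F i) ->
    forall w, \1_C (Y w) * \prod_(i < n) average U (G i) (Y w) =
     \1_C (Y w) * (\prod_(i < n | i != ko) average U (F i) (Y w)) * average U (G k) (Y w).
  move=> GF w; rewrite (bigD1 ko)//= -mulrA [X in _ * X = _]mulrC; congr (_ * (_ * _)).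
  by apply: eq_bigr => i ik; rewrite GF.
have fub (G : T * S -> R) : unit_fun G ->
    (\int[P]_w (w2 w * average U G (Y w))%:E = \int[P \x U]_z (w2 z.1 * G (Y z.1, z.2))%:E)%E.
  move=> [mG G01].
  have mGY : measurable_fun setT (fun z : Om * S => G (Y z.1, z.2)).
    apply: measurableT_comp mG _; apply: measurable_fun_pair => //.
    exact: measurableT_comp mY measurable_fst.
  rewrite (fubini_tonelli1 (fun z => (w2 z.1 * G (Y z.1, z.2))%:E)); last 2 first.
  - apply/measurable_EFinP; apply: measurable_funM => //.
    exact: measurableT_comp mw2 measurable_fst.
  - move=> z; rewrite lee_fin; have /andP[? _] := w2b z.1.
    by have /andP[? _] := G01 (Y z.1, z.2); rewrite mulr_ge0.
  apply: eq_integral => w _; rewrite /fubini_F/= EFinM averageE//.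
  rewrite -ge0_integralZl_EFin//.
  - by move=> s _; rewrite lee_fin; have /andP[] := G01 (Y w, s).
  - by apply/measurable_EFinP; exact: measurableT_comp mG (pair1_measurable (Y w)).
  - by have /andP[] := w2b w.
under eq_integral do rewrite (E1 F)//.
under [RHS]eq_integral do rewrite (E2 F)//.
rewrite fub//.
apply: (@rectangles_integral_eq _ _ T _ S _ _ P _ _ (P \x U)%E (fun w => (Y w, X k w)) (fun z => (Y z.1, z.2)) w1 (w2 \o fst) (F k)) => //.
- exact: measurable_fun_pair.
- by apply: measurable_fun_pair => //; exact: measurableT_comp mY measurable_fst.
- exact: measurableT_comp mw2 measurable_fst.
- by move=> z; exact: w2b.
- exact: (uF k).1.
- exact: (uF k).2.
move=> C B mC mB.
pose G i := if i == k then \1_B \o snd else F i.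
have uB : unit_fun (\1_B \o snd).
  split; first by apply: measurableT_comp measurable_snd; exact: measurable_indic.
  by move=> z; rewrite /= indicE; case: (_ \in _); rewrite !lexx ?ler01.
have uG i : unit_fun (G i) by rewrite /G; case: ifP.
have GF (i : 'I_n) : i != ko -> G i = F i.
  by move=> ik; rewrite /G ifN.
have := IH (ltnW kn) (A `&` C) G (measurableI _ _ mA mC) uG.
under eq_integral do rewrite (E1 G)//.
under [X in (_ -> _ = X) -> _]eq_integral do rewrite (E2 G)//.
have GB i : (k <= i)%N -> exists2 B0, measurable B0 & G i = \1_B0 \o snd.
  rewrite /G leq_eqVlt eq_sym; case: eqP => [_ _|_ /= ki]; first by exists B.
  exact: FB.
move=> /(_ GB) e.
have iX y s : \1_(C `*` B) (y, s) = \1_C y * \1_B s :> R.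
  by rewrite !indicE in_setX -natrM mulnb.
transitivity (\int[P]_w (\1_(A `&` C) (Y w) *
   \prod_(i < n | i != ko) F i (Y w, X i w) * G k (Y w, X k w))%:E)%E.
  apply: eq_integral => w _; congr EFin; rewrite /w1 /G eqxx /= indicI.
  by rewrite iX /=; ring.
rewrite e.
transitivity (\int[P]_w (w2 w * average U (fun z => \1_(C `*` B) z) (Y w))%:E)%E.
  apply: eq_integral => w _; congr EFin; rewrite /w2 /G eqxx /= indicI.
  have -> : average U (fun z => \1_(C `*` B) z) (Y w) = \1_C (Y w) * average U (\1_B \o snd) (Y w).
    rewrite /average -RintegralZl//; first by apply: eq_Rintegral => s _; rewrite iX.
    apply: unit_integrable; first exact: measurable_indic.
    by move=> s; rewrite /= indicE; case: (_ \in _); rewrite !lexx ?ler01.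
  by rewrite /=; ring.
rewrite fub//; split; first by apply: measurable_indic; exact: measurableX.
by move=> z; rewrite indicE; case: (_ \in _); rewrite !lexx ?ler01.
Qed.

Lemma indep_average_iprod (F : nat -> T * S -> R) : (forall i, unit_fun (F i)) ->
  (\int[P]_w (iprod (fun i => F i (Y w, X i w)))%:E =
   \int[P]_w (iprod (fun i => average U (F i) (Y w)))%:E)%E.
Proof.
move=> uF.
have av i := average_unit U (uF i).1 (uF i).2.
have mav i := measurable_average U (uF i).1 (uF i).2.
have lim (G : nat -> Om -> R) : (forall i, measurable_fun setT (G i)) ->
    (forall i w, 0 <= G i w <= 1) ->
    (\int[P]_w (\prod_(i < n) G i w)%:E)%E @[n --> \oo] --> (\int[P]_w (iprod (G ^~ w))%:E)%E.
  move=> mG G01; apply: (@bounded_cvg_integral _ _ _ _ (fun n w => \prod_(i < n) G i w) _ 1).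
  - by move=> n; apply: measurable_prod.
  - move=> n w; have /andP[p0 p1] := @prod_unit _ (G ^~ w) n (G01 ^~ w).
    by rewrite ger0_norm.
  - by move=> w; apply: iprod_cvg => i.
have l1 := lim (fun i w => F i (Y w, X i w)) (fun i => measurable_YX i (uF i).1)
  (fun i w => (uF i).2 (Y w, X i w)).
have l2 := lim (fun i w => average U (F i) (Y w)) (fun i => measurableT_comp (mav i) mY)
  (fun i w => av i (Y w)).
have E n : (\int[P]_w (\prod_(i < n) F i (Y w, X i w))%:E =
   \int[P]_w (\prod_(i < n) average U (F i) (Y w))%:E)%E.
  have := indep_average_prod n measurableT uF.
  under eq_integral do rewrite indicT mul1r.
  by under [X in _ = X -> _]eq_integral do rewrite indicT mul1r.
rewrite (funext E) in l1.
exact: (cvg_unique (@ereal_hausdorff R) l1 l2).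
Qed.

End iid.

(** * Ranking a summable sequence *)

Section enumeration.
Variables (before : rel nat) (bound : nat -> nat).
Hypotheses (before_irr : irreflexive before) (before_trans : transitive before).
Hypothesis before_total : forall i j, i != j -> before i j || before j i.
Hypothesis before_bound : forall i j, before j i -> (j < bound i)%N.

Let preds i := [seq j <- iota 0 (bound i) | before j i].
Let rank i := size (preds i).

Let mem_preds i j : (j \in preds i) = before j i.
Proof.
rewrite mem_filter mem_iota /= add0n; apply/idP/idP => [/andP[]//|ji].
by rewrite ji before_bound.
Qed.

Let uniq_preds i : uniq (preds i). Proof. by rewrite filter_uniq// iota_uniq. Qed.

Let rank_mono i k : before i k -> (rank i < rank k)%N.
Proof.
move=> ik; have -> : (rank i).+1 = size (i :: preds i) by [].
apply: uniq_leq_size => /=.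
  by rewrite uniq_preds andbT mem_preds before_irr.
move=> j; rewrite inE mem_preds => /orP[/eqP ->|]; first by rewrite mem_preds.
by rewrite mem_preds => ji; exact: before_trans ik.
Qed.

Let rank_inj : injective rank.
Proof.
move=> i j e; apply/eqP; apply: contraT => /before_total /orP[] /rank_mono;
  by rewrite e ltnn.
Qed.

(** The predecessors of i have distinct ranks below the rank of i, which is their
    number; so these ranks take all smaller values. *)
Let rank_below i k : (k < rank i)%N -> exists j, rank j = k.
Proof.
move=> ki; have := @uniq_min_size _ (map rank (preds i)) (iota 0 (rank i)).
rewrite map_inj_uniq// size_map size_iota => /(_ (uniq_preds i)).
case=> // [m /mapP[j]|_ /(_ k)].
  by rewrite mem_preds => /rank_mono ji ->; rewrite mem_iota.
by rewrite mem_iota/= add0n ki => /mapP[j _ ->]; exists j.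
Qed.

Let rank_surj n : exists i, rank i = n.
Proof.
apply: contrapT => h.
have lt i : (rank i < n)%N.
  rewrite ltnNge; apply/negP; rewrite leq_eqVlt => /orP[/eqP e|/rank_below//].
  by apply: h; exists i.
suff : (n.+1 <= n)%N by rewrite ltnn.
rewrite -{1}(size_iota 0 n.+1) -(size_map rank) -[leqRHS](size_iota 0 n).
apply: uniq_leq_size; first by rewrite map_inj_uniq// iota_uniq.
by move=> m /mapP[i _ ->]; rewrite mem_iota/= add0n lt.
Qed.

(** The number of predecessors is an isomorphism onto the natural numbers. *)
Lemma order_enumeration : exists s : nat -> nat,
  bijective s /\ forall n, before (s n) (s n.+1).
Proof.
pose s n := sval (cid (rank_surj n)).
have rs n : rank (s n) = n by rewrite /s; case: cid.
exists s; split.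
  by exists rank => // i; apply: rank_inj; rewrite rs.
move=> n; have ne : s n != s n.+1.
  by apply/eqP => /(congr1 rank) /eqP; rewrite !rs ltn_eqF.
by have /orP[//|/rank_mono] := before_total ne; rewrite !rs ltnNge leqnSn.
Qed.

End enumeration.

Section arrangement.
Context {R : realType}.
Implicit Types z : nat -> R.

(** Larger values come first, and ties are broken by the index.  The last
    hypothesis ensures that a zero value has finitely many predecessors. *)
Lemma arrangement_exists z : (forall i, 0 <= z i) -> z @ \oo --> (0 : R) ->
  (forall i j, (i <= j)%N -> z i = 0 -> z j = 0) ->
  exists s : nat -> nat, bijective s /\ forall n, z (s n.+1) <= z (s n).
Proof.
move=> z0 zc zz.
pose before : rel nat := fun i j => (z j < z i) || ((z i == z j) && (i < j)%N).
have zlt (c : R) : 0 < c -> exists N, forall j, (N <= j)%N -> z j < c.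
  move=> c0; have [N _ h] : \forall j \near \oo, z j < c by apply: (cvgr_lt 0 zc).
    by exists N => j Nj; exact: h.
have hb i : exists N, forall j, before j i -> (j < N)%N.
  have [zi|zi] := eqVneq (z i) 0.
    exists i => j /orP[|/andP[]//]; rewrite zi => zj.
    by rewrite ltnNge; apply/negP => ij; rewrite (zz i j)// ltxx in zj.
  have [|N hN] := zlt (z i); first by rewrite lt_neqAle eq_sym zi z0.
  exists (maxn N i) => j /orP[h|/andP[_ ij]]; last by rewrite (leq_trans ij)// leq_maxr.
  rewrite (leq_trans _ (leq_maxl _ _))// ltnNge; apply/negP => /hN; rewrite ltNge.
  by rewrite ltW.
have [||||s [bs hs]] := @order_enumeration before (fun i => sval (cid (hb i))).
- by move=> i; rewrite /before ltxx eqxx ltnn.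
- move=> j i k /orP[ji|/andP[/eqP ij1 ij]] /orP[jk|/andP[/eqP jk1 jk]]; rewrite /before.
  + by rewrite (lt_trans jk).
  + by rewrite -jk1 ji.
  + by rewrite ij1 jk.
  + by rewrite ij1 jk1 eqxx (ltn_trans ij) ?orbT.
- move=> i j; rewrite /before => ij; case: (ltgtP (z i) (z j)) => //= e.
  by rewrite -neq_ltn.
- by move=> i; case: cid => N hN /=; exact: hN.
exists s; split => // n; have /orP[/ltW//|/andP[/eqP -> _]] := hs n.
exact: lexx.
Qed.

(** The right-hand side counts the values above c without reference to the
    arrangement, and is visibly measurable in z. *)
Lemma arrangement_gt z (s : nat -> nat) (c : R) n : bijective s ->
  (forall n, z (s n.+1) <= z (s n)) ->
  c < z (s n) <-> exists N, (n < \sum_(i < N) (c < z i)%R)%N.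
Proof.
case=> t sK tK /nonincreasing_seqP zs.
have cnt N : (\sum_(i < N) (c < z i)%R)%N = size [seq i <- iota 0 N | c < z i].
  by rewrite -(big_mkord xpredT (fun i => (c < z i)%R : nat)) size_filter -sum1_count [RHS]big_mkcond/= /index_iota subn0; apply: eq_bigr => i _; case: ifP.
split.
  move=> cz; exists (\max_(i < n.+1) s i).+1; rewrite cnt.
  rewrite -{1}(size_iota 0 n.+1) -(size_map s).
  apply: uniq_leq_size; first by rewrite map_inj_uniq ?iota_uniq//; exact: can_inj sK.
  move=> k /mapP[i]; rewrite mem_iota add0n => /andP[_ ni] ->.
  rewrite mem_filter mem_iota add0n leq0n andTb ltnS (leq_bigmax (Ordinal ni))// andbT.
  by rewrite (lt_le_trans cz)// zs.
move=> [N]; rewrite cnt; apply: contraTT; rewrite -leNgt -leqNgt => zc.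
rewrite -[leqRHS](size_iota 0 n) -(size_map s (iota 0 n)).
apply: uniq_leq_size; first by rewrite filter_uniq ?iota_uniq.
move=> i; rewrite mem_filter => /andP[ci _]; apply/mapP; exists (t i); last by rewrite tK.
rewrite mem_iota/= add0n ltnNge; apply/negP => nt.
by have := zs _ _ nt; rewrite tK leNgt (le_lt_trans zc).
Qed.

Lemma nneseries_bij (f : nat -> \bar R) (s : nat -> nat) : (forall i, 0 <= f i)%E ->
  bijective s -> (\sum_(0 <= i <oo) f (s i) = \sum_(0 <= i <oo) f i)%E.
Proof.
move=> f0 bs; rewrite !nneseries_esumT//; apply/esym/reindex_esum.
by rewrite setTT_bijective.
Qed.

Lemma arranged_exists (y : simplex R) (b : nat -> R) (sigma : R) :
  (forall i, 0 < b i) -> (\sum_(0 <= i <oo) (b i * y i)%:E = sigma%:E)%E ->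
  exists w : simplex R, arranged (fun i => b i * y i / sigma) w.
Proof.
move=> b0 bs.
have by0 i : 0 <= b i * y i by rewrite mulr_ge0 ?coords_ge0 ?ltW.
have s0 : 0 < sigma.
  rewrite -lte_fin -bs; apply: lt_le_trans (nneseries_lim_ge 1 _); last by move=> i _; rewrite lee_fin.
  by rewrite big_nat1 lte_fin mulr_gt0 ?simplex_gt0.
have cz : (fun i => b i * y i) @ \oo --> (0 : R).
  apply: cvg_series_cvg_0; apply/cvg_ex; exists sigma.
  have h : (\sum_(0 <= i < n) (b i * y i)%:E)%E @[n --> \oo] --> (sigma%:E : \bar R).
    by rewrite -bs; apply: is_cvg_nneseries => i _ _; rewrite lee_fin.
  move/fine_cvgP : h => [_]; apply: cvg_trans.
  by apply: near_eq_cvg; near=> n => /=; rewrite sumEFin.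
pose z i := b i * y i / sigma.
have z0 i : 0 <= z i by rewrite divr_ge0// ltW.
have [||s [bij_s hs]] := @arrangement_exists z z0.
- by rewrite -[X in _ --> X](mul0r sigma^-1); apply: cvgMl.
- move=> i j ij /eqP; rewrite mulf_eq0 invr_eq0 (gt_eqF s0) orbF mulf_eq0 gt_eqF//= => /eqP yi.
  rewrite /z (_ : y j = 0) ?mulr0 ?mul0r//.
  by apply/le_anti; rewrite coords_ge0 andbT -yi simplex_antimono.
have sum1 : (\sum_(0 <= i <oo) (z (s i))%:E = 1)%E.
  rewrite (nneseries_bij (f := fun i => (z i)%:E))//.
  under eq_eseriesr do rewrite /z mulrC EFinM.
  rewrite nneseriesZl; last by move=> i _; rewrite lee_fin.
  by rewrite bs -EFinM mulVf// gt_eqF.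
exists (@Simplex R (fun n => z (s n)) (fun n => z0 (s n)) hs sum1).
by exists s.
Unshelve. all: by end_near. Qed.

End arrangement.

(** * The transformed point as a random variable *)

Section transform.
Context {R : realType} (theta : R) (PD : probability (simplex R) R) (lam : probability R R).
Hypothesis lamP : laplace_identity theta PD lam.
Context d (Om : measurableType d) (P : probability Om R)
  (Y : {RV P >-> simplex R}) (X : nat -> {RV P >-> R}).
Hypothesis YX : markov_input PD Y X.
Local Notation U := (@unif R).

Let mY : measurable_fun setT Y. Proof. exact: measurable_funP. Qed.
Let mX i : measurable_fun setT (X i : Om -> measurableTypeR R).
Proof. exact: (measurable_funP (X i)). Qed.

Let indep n (A : set (simplex R)) (B : nat -> set (measurableTypeR R)) :
  measurable A -> (forall i, measurable (B i)) ->
  (P (Y @^-1` A `&` \bigcap_(i < n) (X i @^-1` B i)) =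
   P (Y @^-1` A) * \prod_(i < n) U (B i))%E.
Proof.
move=> mA mB; case: YX => _ XU /(_ n A B mA mB) ->; congr (_ * _)%E.
by apply: eq_bigr => i _; have := XU i (B i) (mB i).
Qed.

Lemma integral_input_law (g : simplex R * R -> R) : measurable_fun setT g ->
  (forall p, 0 <= g p) ->
  (\int[P \x lam]_z (g (Y z.1, z.2))%:E = \int[PD \x lam]_p (g p)%:E)%E.
Proof.
move=> mg g0.
have mYz : measurable_fun setT (fun z : Om * R => (Y z.1, z.2)).
  by apply: measurable_fun_pair => //; exact: measurableT_comp mY measurable_fst.
rewrite (fubini_tonelli2 (fun z : Om * R => (g (Y z.1, z.2))%:E)); last 2 first.
- by apply/measurable_EFinP; exact: measurableT_comp mg mYz.
- by move=> z; rewrite lee_fin.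
rewrite (fubini_tonelli2 (fun z => (g z)%:E)); last 2 first.
- exact/measurable_EFinP.
- by move=> z; rewrite lee_fin.
apply: eq_integral => u _; rewrite /fubini_G/=.
have mgu : measurable_fun setT (fun y => (g (y, u))%:E).
  by apply/measurable_EFinP; exact: measurableT_comp mg (pair2_measurable u).
transitivity (\int[distribution P Y]_y (g (y, u))%:E)%E.
  by rewrite ge0_integral_distribution//; move=> y; rewrite lee_fin.
by apply: eq_measure_integral => A mA _; case: YX => h _ _; exact: h.
Qed.

Section positive.
Variable b : R -> R.
Hypotheses (mb : measurable_fun setT (b : measurableTypeR R -> R)) (b0 : forall s, 0 < b s).
Hypothesis ib : U.-integrable setT (EFin \o (fun s => ln (1 + b s))).

Definition weights w i := b (X i w) * Y w i.
Definition total_weight w : \bar R := (\sum_(0 <= i <oo) (weights w i)%:E)%E.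

Lemma weights_ge0 w i : 0 <= weights w i.
Proof. by rewrite mulr_ge0 ?coords_ge0// ltW. Qed.

Lemma measurable_weights i : measurable_fun setT (weights ^~ i).
Proof.
apply: measurable_funM; first exact: measurableT_comp mb (mX i).
exact: measurableT_comp (measurable_coord i) mY.
Qed.

Lemma total_gt0 w : (0 < total_weight w)%E.
Proof.
apply: lt_le_trans (nneseries_lim_ge 1 _); last by move=> i _; rewrite lee_fin weights_ge0.
by rewrite big_nat1 lte_fin mulr_gt0 ?simplex_gt0.
Qed.

Lemma measurable_total : measurable_fun setT total_weight.
Proof.
apply: (ge0_emeasurable_sum (P := xpredT)) => [k w _ _|k _].
  by rewrite lee_fin weights_ge0.
by apply/measurable_EFinP; exact: measurable_weights.
Qed.

Let mtotal_lty : measurable [set w | (total_weight w < +oo)%E].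
Proof.
rewrite (_ : [set w | _] = ~` (total_weight @^-1` [set +oo%E])); last first.
  apply/seteqP; split => w /=; first by case: (total_weight w).
  by rewrite ltey => /eqP.
apply: measurableC; rewrite -[X in measurable X]setTI; exact: measurable_total.
Qed.

(** Given Y and the scale, the positions are independent and uniform, so the
    factors may be averaged separately. *)
Lemma weights_average (phi : R -> R) : measurable_fun setT phi ->
  (forall q, 0 <= q -> 0 <= phi q <= 1) ->
  (\int[P \x lam]_z (iprod (fun i => phi (expR z.2 * weights z.1 i)))%:E =
   \int[PD \x lam]_p (iprod (fun i => \int[U]_s phi (expR p.2 * (b s * p.1 i))))%:E)%E.
Proof.
move=> mphi phi01.
(* [phi] is bounded on the half-line only, where the weights lie. *)
pose psi (q : R) := phi `|q|.
have mpsi : measurable_fun setT psi by apply: measurableT_comp mphi _; exact: normr_measurable.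
have psi01 q : 0 <= psi q <= 1 by exact: phi01.
have psiE q : 0 <= q -> psi q = phi q by move=> q0; rewrite /psi ger0_norm.
pose F i (v : (simplex R * R) * measurableTypeR R) := psi (expR v.1.2 * (b v.2 * v.1.1 i)).
have mF i : measurable_fun setT (F i).
  apply: measurableT_comp mpsi _; apply: measurable_funM.
    by apply: measurableT_comp => //; exact: measurableT_comp measurable_snd measurable_fst.
  apply: measurable_funM; first exact: measurableT_comp mb measurable_snd.
  exact: measurableT_comp (measurable_coord i) (measurableT_comp measurable_fst measurable_fst).
pose A i (p : simplex R * R) := average U (F i) p.
have mA i : measurable_fun setT (A i) by exact: (measurable_average U (mF i) (fun v => psi01 _)).
have A01 i p : 0 <= A i p <= 1 by exact: (average_unit U (mF i) (fun v => psi01 _)).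
transitivity (\int[PD \x lam]_p (iprod (A ^~ p))%:E)%E; last first.
  apply: eq_integral => p _; congr EFin; congr iprod; apply/funext => i.
  apply: eq_Rintegral => s _; rewrite /F psiE// mulr_ge0 ?expR_ge0// mulr_ge0 ?coords_ge0//.
  exact: ltW.
rewrite -(@integral_input_law (fun p => iprod (A ^~ p))); last 2 first.
- by apply: measurable_iprod => [|i|p _ i]; [exact: measurableT|exact: mA|exact: A01].
- by move=> p; have /andP[] := iprod_unit (A01 ^~ p).
have mFz i : measurable_fun setT (fun z : Om * R => F i ((Y z.1, z.2), X i z.1)).
  apply: measurableT_comp (mF i) _; apply: measurable_fun_pair.
    by apply: measurable_fun_pair => //; exact: measurableT_comp mY measurable_fst.
  exact: measurableT_comp (mX i) measurable_fst.
have mAz i : measurable_fun setT (fun z : Om * R => A i (Y z.1, z.2)).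
  apply: measurableT_comp (mA i) _; apply: measurable_fun_pair => //.
  exact: measurableT_comp mY measurable_fst.
have slice (B : nat -> Om * R -> R) : (forall i, measurable_fun setT (B i)) ->
    (forall i z, 0 <= B i z <= 1) ->
    (\int[P \x lam]_z (iprod (B ^~ z))%:E = \int[lam]_u \int[P]_w (iprod (fun i => B i (w, u)))%:E)%E.
  move=> mB B01; rewrite (fubini_tonelli2 (fun z => (iprod (B ^~ z))%:E))//.
    by apply/measurable_EFinP; apply: measurable_iprod => //; move=> z _ i; exact: B01.
  by move=> z; rewrite lee_fin; have /andP[] := iprod_unit (B01 ^~ z).
transitivity (\int[P \x lam]_z (iprod (fun i => F i ((Y z.1, z.2), X i z.1)))%:E)%E.
  apply: eq_integral => z _; congr EFin; congr iprod; apply/funext => i.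
  by rewrite /F/= psiE// mulr_ge0 ?expR_ge0// weights_ge0.
apply: (etrans (slice (fun i z => F i ((Y z.1, z.2), X i z.1)) mFz (fun i z => psi01 _))).
apply: (etrans _ (esym (slice (fun i z => A i (Y z.1, z.2)) mAz (fun i z => A01 i _)))).
apply: eq_integral => u _.
apply: (indep_average_iprod mY mX indep (F := fun i (v : simplex R * measurableTypeR R) => F i ((v.1, u), v.2))).
move=> i; split; last by move=> v; exact: psi01.
apply: measurableT_comp (mF i) _; apply: measurable_fun_pair => //.
apply: measurable_fun_pair => //; exact: measurable_cst.
Qed.

(** Where the sum of the weights is infinite, the products of the
    e^(- e^u weight / n) vanish for all n; but their expectations tend to 1. *)
Lemma total_finite : {ae P, forall w, (total_weight w < +oo)%E}.
Proof.
pose N := ~` [set w | (total_weight w < +oo)%E].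
have mN : measurable N by exact: measurableC.
exists N; split => //.
pose h n (z : Om * R) := iprod (fun i => expR (- (n.+1%:R^-1 * (expR z.2 * weights z.1 i)))).
have n0 n : 0 < n.+1%:R^-1 :> R by rewrite invr_gt0.
have e01 n (q : R) : 0 <= q -> 0 <= expR (- (n.+1%:R^-1 * q)) <= 1.
  by move=> q0; rewrite expR_ge0/= -expR0 ler_expR oppr_le0 mulr_ge0// ltW.
have ew0 (z : Om * R) i : 0 <= expR z.2 * weights z.1 i by rewrite mulr_ge0 ?expR_ge0 ?weights_ge0.
have mh n : measurable_fun setT (h n).
  apply: measurable_iprod => [|i|z _ i]; [exact: measurableT| |exact: e01].
  apply: measurableT_comp => //; apply: measurable_funN; apply: measurable_funM; first exact: measurable_cst.
  apply: measurable_funM; first by apply: measurableT_comp => //.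
  exact: measurableT_comp (measurable_weights i) measurable_fst.
have h01 n z : 0 <= h n z <= 1 by apply: iprod_unit => i; exact: e01.
have hcvg : (\int[P \x lam]_z (h n z)%:E)%E @[n --> \oo] --> 1%:E.
  rewrite (_ : (fun n => _) = (fun n => \int[PD \x lam]_p (symmetric_laplace U (fun s => n.+1%:R^-1 * b s) p)%:E)%E).
    by apply: (symmetric_laplace_small lamP) => // s; exact: ltW.
  apply/funext => n; rewrite (weights_average (phi := fun q => expR (- (n.+1%:R^-1 * q)))).
  - have E (p : simplex R * R) : iprod (fun i => \int[U]_s expR (- (n.+1%:R^-1 * (expR p.2 * (b s * p.1 i))))) =
        symmetric_laplace U (fun s => n.+1%:R^-1 * b s) p.
      rewrite /symmetric_laplace; apply: (f_equal (@iprod R)); apply/funext => i.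
      rewrite /laplace; apply: eq_Rintegral => s _; apply: (f_equal expR); ring.
    apply: eq_integral => p _; exact: (congr1 EFin (E p)).
  - by apply: measurable_exp_scaled.
  - by move=> q q0; exact: e01.
have [M [mM M0 NM]] := ae_exists_gt0 (P := (P \x lam)%E) mh h01 hcvg.
have NTM : N `*` setT `<=` M.
  move=> [w u] [/= Nw _]; apply: NM => /= -[n hn]; apply: Nw => /=.
  pose k := n.+1%:R^-1 * expR u.
  have k0 : 0 < k by rewrite mulr_gt0 ?expR_gt0.
  have bd m : \sum_(0 <= i < m) weights w i <= - ln (h n (w, u)) / k.
    rewrite ler_pdivlMr// mulrC -lerN2 opprK -ler_expR (lnK (_ : _ \is Num.pos)) ?posrE//.
    apply: (le_trans (iprod_le m _)); first by move=> i; exact: (e01 n _ (ew0 (w, u) i)).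
    rewrite -expR_sum big_mkord sumrN mulr_sumr; rewrite ler_expR lerN2.
    by apply: ler_sum => i _; rewrite /= /k -mulrA lexx.
  apply: (@le_lt_trans _ _ (- ln (h n (w, u)) / k)%:E); last exact: ltry.
  apply: lime_le; first by apply: is_cvg_nneseries => i _ _; rewrite lee_fin weights_ge0.
  by apply: nearW => m; rewrite sumEFin lee_fin.
have : (P \x lam)%E (N `*` setT) = 0%E.
  by apply: (subset_measure0 _ mM) => //; exact: measurableX.
by move=> h0; rewrite -[LHS]mule1 -(probability_setT lam); rewrite product_measure1E in h0.
Qed.

(** A choice among the points related by [is_Sa]; [arrangement_gt] applies to
    whichever point is chosen and gives measurability. *)
Definition transform w : simplex R :=
  xget (simplex_vertex R) [set v | is_Sa b (fun i => X i w) (Y w) v].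

Lemma transform_Sa w : (total_weight w < +oo)%E -> is_Sa b (fun i => X i w) (Y w) (transform w).
Proof.
move=> tw; have tf : total_weight w = (fine (total_weight w))%:E.
  by rewrite fineK// ge0_fin_numE//; apply: nneseries_ge0 => i _ _; rewrite lee_fin weights_ge0.
have [v hv] := arranged_exists (b := fun i => b (X i w)) (fun i => b0 _) tf.
apply: (xgetPex (simplex_vertex R) (P := [set v | is_Sa b (fun i => X i w) (Y w) v])).
by exists v; exists (fine (total_weight w)).
Qed.

Lemma transform_default w : ~ (total_weight w < +oo)%E -> transform w = simplex_vertex R.
Proof.
move=> tw; rewrite /transform; case: xgetP => // v _ [sigma e _]; exfalso; apply: tw.
by rewrite /total_weight /weights e ltry.
Qed.

Lemma measurable_transform : measurable_fun setT transform.
Proof.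
apply: measurable_to_simplex => n mT.
apply: (measurability _ (RGenOInfty.measurableE R)) => //.
move=> _ [_ [c ->] <-]; rewrite setTI.
pose D := [set w | (total_weight w < +oo)%E].
have mwt := measurable_weights.
have mft : measurable_fun setT (fun w => fine (total_weight w)).
  exact: measurableT_comp measurable_total.
pose C N := [set w | n.+1%:R <= \sum_(i < N) (\1_[set w | c * fine (total_weight w) < weights w i] w : R)].
have mC N : measurable (C N).
  rewrite -[X in measurable X]setTI; apply: measurable_fun_le => //.
  apply: measurable_sum => i; apply: measurable_indic.
  have := @measurable_fun_ltr _ _ R setT _ _ (measurable_funM (measurable_cst c) mft) (mwt i).
  by move=> /(_ measurableT [set true] I); rewrite setTI; congr measurable; apply/seteqP; split.
pose E := if (c < simplex_vertex R n)%R then [set: Om] else set0.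
have mE : measurable E by rewrite /E; case: ifP.
rewrite (_ : _ @^-1` _ = (D `&` \bigcup_N C N) `|` (~` D `&` E)).
  apply: measurableU; apply: measurableI => //; last exact: measurableC.
  exact: bigcupT_measurable.
have CE w N : C N w <-> (n < \sum_(i < N) (c * fine (total_weight w) < weights w i)%R)%N.
  rewrite /C /= (_ : \sum_(i < N) _ = (\sum_(i < N) (c * fine (total_weight w) < weights w i)%R)%:R); first by rewrite ler_nat.
  rewrite natr_sum; apply: eq_bigr => i _; rewrite indicE; congr (nat_of_bool _)%:R.
  by apply/idP/idP => [/set_mem//|?]; exact/mem_set.
have gt w : D w -> c < transform w n <-> exists N, (n < \sum_(i < N) (c * fine (total_weight w) < weights w i)%R)%N.
  move=> Dw; have [sigma e [s bs hs]] := transform_Sa Dw.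
  have -> : fine (total_weight w) = sigma by rewrite /total_weight /weights e.
  have s0 : 0 < sigma by rewrite -lte_fin -e; exact: total_gt0.
  have cE i : (c * sigma < weights w i) = (c < weights w i / sigma) by rewrite ltr_pdivlMr.
  have -> : (fun N => is_true (n < \sum_(i < N) (c * sigma < weights w i)%R)%N) =
      (fun N => is_true (n < \sum_(i < N) (c < weights w i / sigma)%R)%N).
    by apply/funext => N; congr (is_true (_ < _)%N); apply: eq_bigr => i _; rewrite cE.
  rewrite hs.
  apply: (arrangement_gt (z := fun i => weights w i / sigma)) => // m.
  by rewrite -!hs coords_noninc.
apply/seteqP; split => w /=; rewrite in_itv/= andbT.
  have [Dw|Dw] := pselect (D w).
    by move/(gt w Dw) => [N hN]; left; split => //; exists N => //; apply/CE.
  by rewrite transform_default// => cv; right; split => //; rewrite /E cv.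
case=> [[Dw [N _ /CE hN]]|[Dw]]; first by apply/(gt w Dw); exists N.
by rewrite /E transform_default//; case: ifP.
Qed.

End positive.
End transform.

(** * Joint law of the transformed point and its scale *)

Section product_laplace.
Context {R : realType} d1 (S1 : measurableType d1) (U : probability S1 R)
  d2 (S2 : measurableType d2) (V : probability S2 R).

Lemma integrable_fst (h : S1 -> R) : U.-integrable setT (EFin \o h) ->
  (U \x V)%E.-integrable setT (EFin \o (fun s => h s.1)).
Proof.
move=> /integrableP[/measurable_EFinP mh hoo].
have mh1 : measurable_fun setT (fun s : S1 * S2 => h s.1).
  exact: measurableT_comp mh measurable_fst.
apply/integrableP; split; first exact/measurable_EFinP.
rewrite (fubini_tonelli1 (fun s : S1 * S2 => `|(h s.1)%:E|)%E)//.
  rewrite /fubini_F/=; under eq_integral do rewrite probability_integral_cst.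
  exact: hoo.
by apply: measurableT_comp => //; exact/measurable_EFinP.
Qed.

Lemma Rintegral_fst (h : S1 -> R) : U.-integrable setT (EFin \o h) ->
  \int[(U \x V)%E]_s h s.1 = \int[U]_s h s.
Proof.
move=> ih; have := integrable_fst ih => ih2.
rewrite /Rintegral; congr fine.
rewrite -(@integral12_prod_meas1 _ _ _ _ _ U V _ ih2).
by apply: eq_integral => s _; rewrite /fubini_F/= probability_integral_cst.
Qed.

Lemma laplace_scaled (b : S1 -> R) (g : S2 -> R) q :
  measurable_fun setT b -> (forall s, 0 <= b s) ->
  measurable_fun setT g -> (forall s, 0 <= g s) -> 0 <= q ->
  laplace (U \x V)%E (fun s => b s.1 * g s.2) q = \int[U]_s laplace V g (q * b s).
Proof.
move=> mb b0 mg g0 q0.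
have mbg : measurable_fun setT (fun s : S1 * S2 => b s.1 * g s.2).
  by apply: measurable_funM; [exact: measurableT_comp mb measurable_fst|exact: measurableT_comp mg measurable_snd].
have bg0 s : 0 <= b s.1 * g s.2 by rewrite mulr_ge0.
have mexp : measurable_fun setT (fun s : S1 * S2 => expR (- (q * (b s.1 * g s.2)))).
  apply: measurableT_comp => //; apply: measurable_funN; apply: measurable_funM => //.
have mL : measurable_fun setT (fun s => laplace V g (q * b s)).
  apply: (measurable_average V (F := fun s => expR (- (q * b s.1 * g s.2)))).
    by move: mexp; congr measurable_fun; apply/funext => s; rewrite mulrA.
  by move=> s; apply: exp_unit => //; rewrite mulr_ge0.
apply: EFin_inj; rewrite laplaceE// EFin_Rintegral; last first.
  by apply: unit_integrable => // s; apply: laplace_unit => //; rewrite mulr_ge0.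
rewrite (fubini_tonelli1 (fun s => (expR (- (q * (b s.1 * g s.2))))%:E))//; last first.
  exact/measurable_EFinP.
apply: eq_integral => s _; rewrite /fubini_F/= laplaceE ?mulr_ge0//.
by apply: eq_integral => t _; rewrite mulrA.
Qed.

Lemma laplace_sum (r : S1 -> R) (g : S2 -> R) q :
  measurable_fun setT r -> (forall s, 0 <= r s) ->
  measurable_fun setT g -> (forall s, 0 <= g s) -> 0 <= q ->
  laplace (U \x V)%E (fun s => g s.2 + r s.1) q = laplace V g q * laplace U r q.
Proof.
move=> mr r0 mg g0 q0.
have mrg : measurable_fun setT (fun s : S1 * S2 => g s.2 + r s.1).
  by apply: measurable_funD; [exact: measurableT_comp mg measurable_snd|exact: measurableT_comp mr measurable_fst].
have rg0 s : 0 <= g s.2 + r s.1 by rewrite addr_ge0.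
have mexp d (S : measurableType d) (h : S -> R) : measurable_fun setT h ->
    measurable_fun setT (fun s => expR (- (q * h s))).
  move=> mh; apply: measurableT_comp => //; apply: measurable_funN; apply: measurable_funM => //.
apply: EFin_inj; rewrite laplaceE// EFinM (laplaceE U)//.
rewrite (fubini_tonelli1 (fun s => (expR (- (q * (g s.2 + r s.1))))%:E))//; last first.
  by apply/measurable_EFinP; exact: mexp.
have [L0 _] := andP (laplace_unit V mg g0 q0).
rewrite -ge0_integralZl_EFin//; last by apply/measurable_EFinP; exact: mexp.
apply: eq_integral => s _; rewrite /fubini_F/= muleC laplaceE//.
rewrite -ge0_integralZl_EFin ?expR_ge0//; last by apply/measurable_EFinP; exact: mexp.
by apply: eq_integral => t _; rewrite -EFinM -expRD; congr (expR _)%:E; ring.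
Qed.

End product_laplace.

Section half_line.
Context {R : realType} d (T : measurableType d) (m : probability T R).
Local Notation mu := (@lebesgue_measure R).

Definition half_line_indic (t : measurableTypeR R) : R := \1_(`]0%R, +oo[%classic : set R) t.

Lemma half_line_integral (F : T * measurableTypeR R -> R) : measurable_fun setT F ->
  (forall z, 0 <= F z) ->
  (\int[m \x mu]_z (half_line_indic z.2 * F z)%:E =
   \int[m]_y \int[mu]_(t in `]0%R, +oo[) (F (y, t))%:E)%E.
Proof.
move=> mF F0.
have h0 z : (0 <= (half_line_indic z.2 * F z)%:E)%E by rewrite lee_fin mulr_ge0.
rewrite (fubini_tonelli1 (fun z => (half_line_indic z.2 * F z)%:E))//.
  apply: eq_integral => y _; rewrite /fubini_F/= [RHS]integral_mkcond.
  apply: eq_integral => t _; rewrite /patch /half_line_indic indicE.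
  by case: ifP; rewrite ?mul1r ?mul0r.
apply/measurable_EFinP; apply: measurable_funM => //.
apply: measurableT_comp measurable_snd.
by apply: measurable_indic; exact: measurable_itv.
Qed.

End half_line.

Section transform_law.
Context {R : realType} (theta : R) (PD : probability (simplex R) R) (lam : probability R R).
Hypothesis theta_gt0 : 0 < theta.
Hypothesis lamP : laplace_identity theta PD lam.
Context d (Om : measurableType d) (P : probability Om R)
  (Y : {RV P >-> simplex R}) (X : nat -> {RV P >-> R}).
Hypothesis YX : markov_input PD Y X.
Local Notation U := (@unif R).
Local Notation mu := (@lebesgue_measure R).
Local Notation U2 := (U \x U)%E.
Variable b : R -> R.
Hypotheses (mb : measurable_fun setT (b : measurableTypeR R -> R)) (b0 : forall s, 0 < b s).
Hypothesis ib : U.-integrable setT (EFin \o (fun s => ln (b s))).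

Let b0' s : 0 <= b s. Proof. exact: ltW. Qed.

Lemma scaled_ln_integrable k : 0 <= k -> U.-integrable setT (EFin \o (fun s => ln (1 + k * b s))).
Proof. by move=> k0; apply: onepM_ln_integrable. Qed.

Lemma ln1_integrable : U.-integrable setT (EFin \o (fun s => ln (1 + b s))).
Proof.
have := scaled_ln_integrable ler01; congr (integrable _ _ _).
by apply/funext => s; rewrite /= mul1r.
Qed.

Local Notation total_weight := (total_weight Y X b).
Local Notation transform := (transform Y X b).

(** The transformed point, with the logarithm of its total mass e^u sigma before
    normalization. *)
Definition marked (z : Om * R) : simplex R * R :=
  (transform z.1, z.2 + ln (fine (total_weight z.1))).

Lemma measurable_marked : measurable_fun setT marked.
Proof.
apply: measurable_fun_pair.
  exact: measurableT_comp (measurable_transform Y X mb b0) measurable_fst.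
apply: measurable_funD => //.
apply: (measurableT_comp (@measurable_ln R)).
have mt : measurable_fun setT (fun w => fine (total_weight w)).
  exact: measurableT_comp (measurable_total Y X mb b0).
exact: measurableT_comp mt measurable_fst.
Qed.

(** The product is invariant under rearrangement, and the normalization by sigma
    cancels with the second component. *)
Lemma marked_product n x w u : (forall k, 0 <= x k) -> (total_weight w < +oo)%E ->
  symmetric_product n x (marked (w, u)) =
  iprod (fun i => avgexp n x (expR u * weights Y X b w i)).
Proof.
move=> x0 tw; have [sigma e [s bs hs]] := transform_Sa b0 tw.
have s0 : 0 < sigma by rewrite -lte_fin -e; exact: total_gt0.
have ts : fine (total_weight w) = sigma by rewrite /total_weight /weights e.
pose beta i := avgexp n x (expR u * weights Y X b w i).
have beta01 : unit_seq beta.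
  by move=> i; apply: avgexp_unit => //; rewrite mulr_ge0 ?expR_ge0 ?weights_ge0.
rewrite -[RHS](iprod_bij bs beta01) /symmetric_product; apply: (f_equal (@iprod R)).
apply/funext => i; rewrite /beta /=; apply: (f_equal (avgexp n x)).
rewrite hs ts expRD lnK ?posrE// /weights; field.
by rewrite gt_eqF.
Qed.

Lemma product_steps (n : nat) (x : nat -> R) : (forall k, 0 <= x k) ->
  measurable_fun setT (fun s : measurableTypeR R * measurableTypeR R => b s.1 * grid_step n x s.2) /\
  U2.-integrable setT (EFin \o (fun s => ln (1 + b s.1 * grid_step n x s.2))).
Proof.
move=> x0; have [M gM] := grid_step_bounded n x0.
have mf : measurable_fun setT (fun s : measurableTypeR R * measurableTypeR R => b s.1 * grid_step n x s.2).
  apply: measurable_funM; first exact: measurableT_comp mb measurable_fst.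
  exact: measurableT_comp (measurable_grid_step n x) measurable_snd.
split => //.
have M0 : 0 <= M by have /andP[/le_trans h /h] := gM 0.
apply: (le_integrable measurableT _ _ (integrable_fst U (scaled_ln_integrable M0))).
  apply/measurable_EFinP; apply: (measurableT_comp (@measurable_ln R)).
  by apply: measurable_funD => //; exact: measurable_cst.
move=> s _; rewrite lee_fin; have /andP[g0 gm] := gM s.2.
rewrite ger0_norm ?ln_ge0 ?lerDl ?mulr_ge0// ger0_norm ?ln_ge0 ?lerDl ?mulr_ge0//.
apply: ln_mono; first by rewrite ltr_pwDl// mulr_ge0.
by rewrite lerD2l mulrC ler_wpM2r.
Qed.

(** The marks are uniform on the square: the first coordinate is the position
    used by [b], and the second one samples the step function. *)
Lemma marked_law_products (n : nat) (x : nat -> R) : (forall k, 0 <= x k) ->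
  (\int[P \x lam]_z (symmetric_product n x (marked z))%:E =
   (expR (- (theta * \int[U2]_s ln (1 + b s.1 * grid_step n x s.2))))%:E)%E.
Proof.
move=> x0; have [mf il] := product_steps n x0.
have f0 (s : measurableTypeR R * measurableTypeR R) : 0 <= b s.1 * grid_step n x s.2.
  by rewrite mulr_ge0// grid_step_ge0.
rewrite -(lamP mf f0 il).
have msp : measurable_fun setT (symmetric_product n x).
  by apply: symmetric_product_measurable; exists n, x.
have beta01 w u : unit_seq (fun i => avgexp n x (expR u * weights Y X b w i)).
  by move=> i; apply: avgexp_unit => //; rewrite mulr_ge0 ?expR_ge0 ?weights_ge0.
have mbeta : measurable_fun setT (fun z : Om * R => iprod (fun i => avgexp n x (expR z.2 * weights Y X b z.1 i))).
  apply: measurable_iprod => [|i|z _ i]; first exact: measurableT.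
    apply: measurable_avgexp; apply: measurable_funM; first exact: measurableT_comp.
    exact: measurableT_comp (measurable_weights Y X mb i) measurable_fst.
  exact: beta01.
transitivity (\int[P \x lam]_z (iprod (fun i => avgexp n x (expR z.2 * weights Y X b z.1 i)))%:E)%E.
  rewrite (fubini_tonelli2 (fun z => (symmetric_product n x (marked z))%:E)); last 2 first.
  - by apply/measurable_EFinP; exact: measurableT_comp msp measurable_marked.
  - by move=> z; rewrite lee_fin; have /andP[] := symmetric_product_unit n (marked z) x0.
  rewrite (fubini_tonelli2 (fun z => (iprod (fun i => avgexp n x (expR z.2 * weights Y X b z.1 i)))%:E)); last 2 first.
  - exact/measurable_EFinP.
  - by move=> z; rewrite lee_fin; have /andP[] := iprod_unit (beta01 z.1 z.2).
  apply: eq_integral => u _; rewrite /fubini_G/=.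
  apply: ge0_ae_eq_integral => //.
  - apply/measurable_EFinP; apply: (measurableT_comp (measurableT_comp msp measurable_marked)).
    exact: pair2_measurable.
  - apply/measurable_EFinP; exact: (measurableT_comp (g := fun w : Om => (w, u)) mbeta (pair2_measurable u)).
  - by move=> w _; rewrite lee_fin; have /andP[] := symmetric_product_unit n (marked (w, u)) x0.
  - by move=> w _; rewrite lee_fin; have /andP[] := iprod_unit (beta01 w u).
  - have := total_finite lamP YX mb b0 ln1_integrable; apply: filterS => w tw _.
    by apply: (congr1 EFin); exact: marked_product.
rewrite (weights_average lam YX mb b0 (phi := avgexp n x)).
- apply: eq_integral => p _; apply: (congr1 EFin); apply: (f_equal (@iprod R)).
  apply/funext => i.
  rewrite laplace_scaled//; last 3 first.
  + exact: measurable_grid_step.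
  + by move=> s; exact: grid_step_ge0.
  + exact: simplex_scale_ge0.
  apply: eq_Rintegral => s _; rewrite laplace_step//; last by rewrite mulr_ge0// simplex_scale_ge0.
  by apply: (f_equal (avgexp n x)); ring.
- exact: measurable_avgexp.
- by move=> q q0; exact: avgexp_unit.
Qed.

End transform_law.

(** * Density of the transformed point *)

Section reciprocal.
Context {R : realType} (b : R -> R).
Hypotheses (mb : measurable_fun setT (b : measurableTypeR R -> R)) (b0 : forall s, 0 < b s).

Definition reciprocal (s : measurableTypeR R) : R := (b s)^-1.

Lemma reciprocal_gt0 s : 0 < reciprocal s. Proof. by rewrite invr_gt0. Qed.

Lemma measurable_reciprocal : measurable_fun setT reciprocal.
Proof.
rewrite (_ : reciprocal = fun s => expR (- ln (b s))).
  apply: measurableT_comp => //; apply: measurable_funN.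
  exact: (measurableT_comp (@measurable_ln R) mb).
by apply/funext => s; rewrite expRN lnK ?posrE.
Qed.

End reciprocal.

Section density_law.
Context {R : realType} (theta : R) (PD : probability (simplex R) R) (lam : probability R R).
Hypothesis theta_gt0 : 0 < theta.
Hypothesis lamP : laplace_identity theta PD lam.
Local Notation U := (@unif R).
Local Notation mu := (@lebesgue_measure R).
Local Notation U2 := (U \x U)%E.
Variable b : R -> R.
Hypotheses (mb : measurable_fun setT (b : measurableTypeR R -> R)) (b0 : forall s, 0 < b s).
Hypothesis ib : U.-integrable setT (EFin \o (fun s => ln (b s))).

Local Notation r := (reciprocal b).
Let r0 : forall s, 0 < r s := reciprocal_gt0 b0.
Let mr : measurable_fun setT r := measurable_reciprocal mb b0.
Let c := expR (- (theta * \int[U]_s ln (b s))).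

(** The joint density of the transformed point and its total mass t. *)
Definition half_line_weight (z : simplex R * measurableTypeR R) : R :=
  half_line_indic z.2 * (c * (z.2 `^ (theta - 1) / Gamma theta * symmetric_laplace U r (z.1, ln z.2))).

Let S0 p : 0 <= symmetric_laplace U r p.
Proof. by have /andP[] := symmetric_laplace_unit U p mr (fun s => ltW (r0 s)). Qed.

Let body (z : simplex R * measurableTypeR R) : R :=
  c * (z.2 `^ (theta - 1) / Gamma theta * symmetric_laplace U r (z.1, ln z.2)).

Let body_ge0 z : 0 <= body z.
Proof.
rewrite mulr_ge0 ?expR_ge0// mulr_ge0 ?S0// divr_ge0 ?powR_ge0// ltW//.
exact: Gamma_gt0.
Qed.

Let mbody : measurable_fun setT body.
Proof.
apply: measurable_funM; first exact: measurable_cst.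
apply: measurable_funM.
  apply: measurable_funM; last exact: measurable_cst.
  exact: (measurableT_comp (f := fun t : measurableTypeR R => t `^ (theta - 1)) (measurable_powR (theta - 1)) measurable_snd).
exact: (measurable_symmetric_ln U mr (fun s => ltW (r0 s))).
Qed.

Lemma half_line_weight_ge0 z : 0 <= half_line_weight z.
Proof. by rewrite mulr_ge0 ?body_ge0. Qed.

Lemma measurable_half_line_weight : measurable_fun setT half_line_weight.
Proof.
apply: measurable_funM; last exact: mbody.
apply: measurableT_comp measurable_snd.
by apply: measurable_indic; exact: measurable_itv.
Qed.

Definition log_time (z : simplex R * measurableTypeR R) : simplex R * R := (z.1, ln z.2).

Lemma measurable_log_time : measurable_fun setT log_time.
Proof.
apply: measurable_fun_pair => //.
exact: measurableT_comp (@measurable_ln R) measurable_snd.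
Qed.

(** The Laplace transforms of the step function g and of 1 / b multiply to that
    of g + 1 / b, and ln (g + 1 / b) = ln (1 + b g) - ln b. *)
Lemma half_line_weight_products (n : nat) (x : nat -> R) : (forall k, 0 <= x k) ->
  (\int[PD \x mu]_z (half_line_weight z * symmetric_product n x (log_time z))%:E =
   (expR (- (theta * \int[U2]_s ln (1 + b s.1 * grid_step n x s.2))))%:E)%E.
Proof.
move=> x0; have [mf il] := product_steps mb b0 ib n x0.
have msp : measurable_fun setT (symmetric_product n x).
  by apply: symmetric_product_measurable; exists n, x.
have sp0 p : 0 <= symmetric_product n x p by have /andP[] := symmetric_product_unit n p x0.
pose f' (s : measurableTypeR R * measurableTypeR R) := grid_step n x s.2 + r s.1.
have mf' : measurable_fun setT f'.
  apply: measurable_funD; first exact: measurableT_comp (measurable_grid_step n x) measurable_snd.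
  exact: measurableT_comp mr measurable_fst.
have f'0 s : 0 < f' s by rewrite ltr_wpDl// grid_step_ge0.
have lnf' s : ln (f' s) = ln (1 + b s.1 * grid_step n x s.2) - ln (b s.1).
  rewrite -ln_div ?posrE//; last by rewrite ltr_pwDl// mulr_ge0 ?grid_step_ge0// ltW.
  by congr ln; rewrite /f' /reciprocal; field; rewrite gt_eqF.
have ilf' : U2.-integrable setT (EFin \o (fun s => ln (f' s))).
  rewrite (_ : (fun s => ln (f' s)) = fun s => ln (1 + b s.1 * grid_step n x s.2) - ln (b s.1)).
    exact: integrableB il (integrable_fst U ib).
  by apply/funext => s; rewrite lnf'.
have splE (y : simplex R) (t : R) : symmetric_laplace U r (y, ln t) * symmetric_product n x (y, ln t) =
    symmetric_laplace U2 f' (y, ln t).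
  rewrite mulrC symmetric_product_laplace// /symmetric_laplace -iprodM; last 2 first.
  - by apply: symmetric_laplace_seq; [exact: measurable_grid_step|move=> s; exact: grid_step_ge0].
  - by apply: symmetric_laplace_seq => // s; exact: ltW.
  apply: (f_equal (@iprod R)); apply/funext => i; rewrite -laplace_sum//.
  - by move=> s; exact: ltW.
  - exact: measurable_grid_step.
  - by move=> s; exact: grid_step_ge0.
  - exact: simplex_scale_ge0.
transitivity (\int[PD \x mu]_z (half_line_indic z.2 * (body z * symmetric_product n x (log_time z)))%:E)%E.
  by apply: eq_integral => z _; rewrite mulrA.
have mbs : measurable_fun setT (fun z => body z * symmetric_product n x (log_time z)).
  by apply: measurable_funM; [exact: mbody|exact: (measurableT_comp msp measurable_log_time)].
rewrite half_line_integral//; last by move=> z; rewrite mulr_ge0.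
have inner y : (\int[mu]_(t in `]0%R, +oo[) (body (y, t) * symmetric_product n x (log_time (y, t)))%:E =
    c%:E * gamma_mixture theta U2 f' y)%E.
  rewrite /gamma_mixture -ge0_integralZl_EFin ?expR_ge0//.
  - by apply: eq_integral => t _; rewrite -EFinM -splE /body/=; congr EFin; ring.
  - move=> t _; rewrite lee_fin mulr_ge0 ?divr_ge0 ?powR_ge0 ?(ltW (Gamma_gt0 _))//.
    by have /andP[] := symmetric_laplace_unit U2 (y, ln t) mf' (fun s => ltW (f'0 s)).
  - apply/measurable_EFinP; apply: measurable_funTS; apply: measurable_funM.
      by apply: measurable_funM; [exact: measurable_powR|exact: measurable_cst].
    exact: (measurableT_comp (measurable_symmetric_ln U2 mf' (fun s => ltW (f'0 s))) (pair1_measurable y)).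
have mK : measurable_fun setT (fun z : simplex R * measurableTypeR R =>
    (z.2 `^ (theta - 1) / Gamma theta * symmetric_laplace U2 f' (z.1, ln z.2))%:E).
  apply/measurable_EFinP; apply: measurable_funM; last exact: (measurable_symmetric_ln U2 mf' (fun s => ltW (f'0 s))).
  apply: measurable_funM; last exact: measurable_cst.
  exact: (measurableT_comp (f := fun t : measurableTypeR R => t `^ (theta - 1)) (measurable_powR (theta - 1)) measurable_snd).
have K0 (z : simplex R * measurableTypeR R) :
    (0 <= (z.2 `^ (theta - 1) / Gamma theta * symmetric_laplace U2 f' (z.1, ln z.2))%:E)%E.
  rewrite lee_fin mulr_ge0 ?divr_ge0 ?powR_ge0 ?(ltW (Gamma_gt0 _))//.
  by have /andP[] := symmetric_laplace_unit U2 (z.1, ln z.2) mf' (fun s => ltW (f'0 s)).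
under eq_integral do rewrite inner.
rewrite ge0_integralZl_EFin ?expR_ge0//; last 2 first.
- by move=> y _; apply: integral_ge0 => t _; exact: (K0 (y, t)).
- exact: (measurable_pos_integral mK K0).
rewrite (gamma_mixture_integral theta_gt0 lamP mf' f'0 ilf') -EFinM -expRD.
congr (expR _)%:E.
rewrite -(Rintegral_fst U ib) -opprD -mulrDr; congr (- (_ * _)).
under [X in _ + X]eq_Rintegral do rewrite lnf'.
rewrite RintegralB//; last exact: (integrable_fst U ib).
by rewrite addrC subrK.
Qed.

Lemma symmetric_product0 n (p : simplex R * R) : symmetric_product n (fun=> 0) p = 1.
Proof.
rewrite /symmetric_product (_ : (fun _ => _) = (fun=> 1)).
  by apply/cvg_lim => //; under eq_cvg do rewrite big1//; exact: cvg_cst.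
apply/funext => i; rewrite /avgexp; under eq_bigr do rewrite mul0r oppr0 expR0.
exact: avgexp_cst.
Qed.

Lemma half_line_weight_integral :
  (\int[PD \x mu]_z (half_line_weight z)%:E = 1)%E.
Proof.
have := half_line_weight_products 0 (x := fun=> 0) (fun=> lexx 0).
under eq_integral do rewrite symmetric_product0 mulr1.
move=> ->; rewrite -[RHS]/(1%:E); congr EFin.
rewrite (_ : (fun s => _) = fun=> 0); last by apply/funext => s; rewrite /grid_step; under eq_bigr do rewrite mul0r; rewrite big1// mulr0 addr0 ln1.
by rewrite probability_Rintegral_cst mulr0 oppr0 expR0.
Qed.

Lemma half_line_weight_integrable :
  (PD \x mu)%E.-integrable setT (EFin \o half_line_weight).
Proof.
apply/integrableP; split; first by apply/measurable_EFinP; exact: measurable_half_line_weight.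
rewrite (eq_integral (fun z => (half_line_weight z)%:E)).
  by rewrite half_line_weight_integral ltry.
by move=> z _; rewrite /= ger0_norm// half_line_weight_ge0.
Qed.

End density_law.

Section transform_density.
Context {R : realType} (theta : R) (PD : probability (simplex R) R) (lam : probability R R).
Hypothesis theta_gt0 : 0 < theta.
Hypothesis lamP : laplace_identity theta PD lam.
Context d (Om : measurableType d) (P : probability Om R)
  (Y : {RV P >-> simplex R}) (X : nat -> {RV P >-> R}).
Hypothesis YX : markov_input PD Y X.
Local Notation U := (@unif R).
Local Notation mu := (@lebesgue_measure R).
Variable b : R -> R.
Hypotheses (mb : measurable_fun setT (b : measurableTypeR R -> R)) (b0 : forall s, 0 < b s).
Hypothesis ib : U.-integrable setT (EFin \o (fun s => ln (b s))).

Local Notation r := (reciprocal b).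
Let r0 : forall s, 0 < r s := reciprocal_gt0 b0.
Let mr : measurable_fun setT r := measurable_reciprocal mb b0.

Definition transform_density (y : simplex R) : \bar R :=
  ((expR (- (theta * \int[U]_s ln (b s))))%:E *
   gamma_mixture theta U r y)%E.

Let K (z : simplex R * measurableTypeR R) : R :=
  z.2 `^ (theta - 1) / Gamma theta * symmetric_laplace U r (z.1, ln z.2).
Let mK : measurable_fun setT K.
Proof.
apply: measurable_funM; last exact: (measurable_symmetric_ln U mr (fun s => ltW (r0 s))).
apply: measurable_funM; last exact: measurable_cst.
exact: (measurableT_comp (f := fun t : measurableTypeR R => t `^ (theta - 1)) (measurable_powR (theta - 1)) measurable_snd).
Qed.
Let K0 z : 0 <= K z.
Proof.
rewrite mulr_ge0 ?divr_ge0 ?powR_ge0 ?(ltW (Gamma_gt0 _))//.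
by have /andP[] := symmetric_laplace_unit U (z.1, ln z.2) mr (fun s => ltW (r0 s)).
Qed.

Lemma gamma_mixture_inv_ge0 y : (0 <= gamma_mixture theta U r y)%E.
Proof. by apply: integral_ge0 => t _; rewrite lee_fin; exact: (K0 (y, t)). Qed.

Lemma transform_density_ge0 y : (0 <= transform_density y)%E.
Proof. by rewrite mule_ge0 ?lee_fin ?expR_ge0 ?gamma_mixture_inv_ge0. Qed.

Lemma measurable_gamma_mixture_inv :
  measurable_fun setT (gamma_mixture theta U r).
Proof.
apply: (measurable_pos_integral (F := fun z => (K z)%:E)); first exact/measurable_EFinP.
by move=> z; rewrite lee_fin K0.
Qed.

Lemma measurable_transform_density : measurable_fun setT transform_density.
Proof.
by apply: emeasurable_funM => //; exact: measurable_gamma_mixture_inv.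
Qed.

(** Both sides are integrals of a function of the pair (point, logarithm of its
    mass), against laws that agree on symmetric products. *)
Lemma transform_law (phi : simplex R -> R) : measurable_fun setT phi ->
  (forall y, 0 <= phi y <= 1) ->
  (\int[P]_w (phi (transform Y X b w))%:E =
   \int[PD]_y ((phi y)%:E * transform_density y))%E.
Proof.
move=> mphi phi01.
have phi0 y : 0 <= phi y by have /andP[] := phi01 y.
have mphi1 : measurable_fun setT (fun p : simplex R * R => phi p.1).
  exact: measurableT_comp mphi measurable_fst.
have phiB y : `|phi y| <= 1.
  by have /andP[? ?] := phi01 y; rewrite ger0_norm.
have clos : bclosure symmetric_products (fun p : simplex R * R => phi p.1).
  apply: bclosure_unit_measurable => //.
  - by move=> A mA; exact: symmetric_products_determine.
  - exact: symmetric_products1.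
have iw1 : (P \x lam)%E.-integrable setT (EFin \o (fun=> 1 : R)).
  by apply: (@bounded_integrable _ _ _ _ _ 1) => // z; rewrite normr1.
have iw2 := half_line_weight_integrable theta_gt0 lamP mb b0 ib.
have mM := measurable_marked Y X mb b0.
have prods g : symmetric_products g ->
    \int[(P \x lam)%E]_z (1 * g (marked Y X b z)) =
    \int[(PD \x mu)%E]_z (half_line_weight theta b z * g (log_time z)).
  move=> [n [x [x0 ->]]].
  under eq_Rintegral do rewrite mul1r.
  rewrite /Rintegral; congr fine.
  rewrite (marked_law_products lamP YX mb b0 ib n x0).
  by rewrite (half_line_weight_products theta_gt0 lamP mb b0 ib n x0).
have E := @bclosure_integral_eq _ _ _ _ (@symmetric_product_measurable R) (@symmetric_products_bounded R)
  _ _ (P \x lam)%E _ _ (PD \x mu)%E (marked Y X b) (@log_time R) (fun=> 1) (half_line_weight theta b)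
  mM (@measurable_log_time R) iw1 iw2 prods _ clos.
have mpm : measurable_fun setT (fun z => phi (marked Y X b z).1).
  exact: (measurableT_comp mphi1 mM).
have e1 : (\int[P \x lam]_z (1 * phi (marked Y X b z).1)%:E = \int[P]_w (phi (transform Y X b w))%:E)%E.
  rewrite (fubini_tonelli1 (fun z => (1 * phi (marked Y X b z).1)%:E)); last 2 first.
  - by apply/measurable_EFinP; apply: measurable_funM => //; exact: measurable_cst.
  - by move=> z; rewrite lee_fin mul1r.
  by apply: eq_integral => w _; rewrite /fubini_F/= mul1r probability_integral_cst.
have e2 : (\int[PD \x mu]_z (half_line_weight theta b z * phi (log_time z).1)%:E =
   \int[PD]_y ((phi y)%:E * transform_density y))%E.
  pose body (z : simplex R * measurableTypeR R) := expR (- (theta * \int[U]_s ln (b s))) * K z * phi z.1.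
  have body0 z : 0 <= body z.
    by apply: mulr_ge0 => //; apply: mulr_ge0; [exact: expR_ge0|exact: K0].
  have mphi1' : measurable_fun setT (fun z : simplex R * measurableTypeR R => phi z.1).
    exact: measurableT_comp mphi measurable_fst.
  have mbody : measurable_fun setT body.
    by apply: measurable_funM => //; apply: measurable_funM => //; exact: measurable_cst.
  transitivity (\int[PD \x mu]_z (half_line_indic z.2 * body z)%:E)%E.
    apply: eq_integral => z _; apply: (congr1 EFin).
    by rewrite /half_line_weight -/(K z) /body -[LHS]mulrA.
  rewrite half_line_integral//; apply: eq_integral => y _.
  rewrite /transform_density /gamma_mixture muleA -EFinM -ge0_integralZl_EFin.
  - apply: eq_integral => t _; rewrite -EFinM /body/=; congr EFin.
    by rewrite mulrC mulrA.
  - by [].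
  - by move=> t _; rewrite lee_fin; exact: (K0 (y, t)).
  - apply/measurable_EFinP; apply: measurable_funTS.
    exact: (measurableT_comp mK (pair1_measurable y)).
  - by rewrite mulr_ge0 ?expR_ge0.
rewrite -e1 -e2.
have i1 : (P \x lam)%E.-integrable setT (EFin \o (fun z => 1 * phi (marked Y X b z).1)).
  apply: (weighted_integrable iw1 (h := fun z => phi (marked Y X b z).1) (M := 1)); first exact: mpm.
  by move=> z; exact: phiB.
have i2 : (PD \x mu)%E.-integrable setT (EFin \o (fun z => half_line_weight theta b z * phi (log_time z).1)).
  apply: (weighted_integrable iw2 (h := fun z => phi (log_time z).1) (M := 1)).
    exact: (measurableT_comp mphi1 (@measurable_log_time R)).
  by move=> z; exact: phiB.
have := congr1 EFin E; rewrite /Rintegral !fineK//; exact: integrable_fin_num.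
Qed.

End transform_density.

(** * Passing to a positive multiplier *)

Section uniform.
Context {R : realType}.
Local Notation U := (@unif R).
Local Notation mu := (@lebesgue_measure R).
Local Notation D := (unit_itv R).

Lemma unif_integral_ge0 (f : measurableTypeR R -> \bar R) : measurable_fun setT f ->
  (forall s, 0 <= f s)%E -> (\int[U]_s f s = \int[mu]_(s in D) f s)%E.
Proof.
move=> mf f0; have := @integral_uniform R 0 1 ltr01 f mf f0.
by rewrite subr0 invr1 mul1e.
Qed.

Lemma unif_integral (f : measurableTypeR R -> \bar R) : measurable_fun setT f ->
  (\int[U]_s f s = \int[mu]_(s in D) f s)%E.
Proof.
move=> mf; rewrite integralE [RHS]integralE; congr (_ - _)%E.
  by apply: unif_integral_ge0 => //; exact: measurable_funepos.
by apply: unif_integral_ge0 => //; exact: measurable_funeneg.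
Qed.

Lemma unif_measure (A : set (measurableTypeR R)) : measurable A -> U A = mu (A `&` D).
Proof.
move=> mA; have := integral_indic U measurableT mA; rewrite setIT => <-.
rewrite unif_integral; last exact/measurable_EFinP/measurable_indic.
by rewrite integral_indic//; exact: measurable_unit_itv.
Qed.

End uniform.

Section positive_modification.
Context {R : realType} (a : R -> R).
Hypothesis la : logintegrable a.
Local Notation U := (@unif R).
Local Notation mu := (@lebesgue_measure R).
Local Notation D := (unit_itv R).

(** Log-integrability makes [a] positive almost everywhere on the unit interval,
    so this changes it there on a null set only. *)
Definition modification (s : measurableTypeR R) : R :=
  if (0 <= s <= 1) && (0 < a s) then a s else 1.
Local Notation b := modification.

Lemma modification_gt0 s : 0 < b s.
Proof. by rewrite /modification; case: ifP => // /andP[]. Qed.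

Let mD : measurable (D : set (measurableTypeR R)) := measurable_unit_itv.
Let ma : measurable_fun (D : set (measurableTypeR R)) a. Proof. by case: la. Qed.
Let pos : set (measurableTypeR R) := D `&` [set s | 0 < a s].
Let mpos : measurable pos.
Proof. by have := ma mD (measurable_itv `]0, +oo[); congr measurable; apply/seteqP; split => s /=; rewrite in_itv/= andbT. Qed.

Let DE s : D s = (0 <= s <= 1) :> Prop.
Proof. by rewrite /unit_itv /= in_itv. Qed.

Let bE s : b s = (a \_ pos) s + \1_(~` pos) s.
Proof.
rewrite /modification /patch indicE in_setC.
have -> : (0 <= s <= 1) && (0 < a s) = (s \in pos).
  apply/idP/idP => [/andP[s01 as0]|]; first by apply/mem_set; split => //; rewrite DE.
  by move=> /set_mem [/=]; rewrite DE => -> ->.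
by case: (s \in pos); rewrite ?addr0// add0r.
Qed.

Lemma measurable_modification : measurable_fun setT b.
Proof.
rewrite (_ : b = fun s => (a \_ pos) s + \1_(~` pos) s); last exact/funext/bE.
apply: measurable_funD; last by apply: measurable_indic; exact: measurableC.
apply/(measurable_restrictT _ mpos); apply: measurable_funS ma => //.
by move=> s [].
Qed.

Let zero : set (measurableTypeR R) := D `\` pos.
Let mzero : measurable zero. Proof. exact: measurableD. Qed.

Let zeroE s : D s -> (s \in zero) = (a s <= 0).
Proof.
move=> Ds; rewrite leNgt; apply/idP/idP => [/set_mem[_ ns]|as0].
  by apply/negP => as0; apply: ns.
by apply/mem_set; split => // -[_ /=]; rewrite (negbTE as0).
Qed.

Let lneE s : D s -> lne (a s)%:E = ((ln (b s))%:E + -oo * (\1_zero s)%:E)%E.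
Proof.
move=> Ds; have s01 : 0 <= s <= 1 by move: Ds; rewrite DE.
rewrite indicE zeroE// /lne /modification s01 leNgt.
by have [as0|as0] := ltP 0 (a s); rewrite /= ?mule0 ?adde0// mule1 ln1 add0e.
Qed.

Let mlne : measurable_fun (D : set (measurableTypeR R)) (fun s => lne (a s)%:E).
Proof.
apply: (eq_measurable_fun (fun s => (ln (b s))%:E + -oo * (\1_zero s)%:E)%E).
  by move=> s /set_mem Ds; rewrite lneE.
apply: measurable_funTS; apply: emeasurable_funD.
  by apply/measurable_EFinP; exact: (measurableT_comp (@measurable_ln R) measurable_modification).
apply: emeasurable_funM; first exact: measurable_cst.
by apply/measurable_EFinP; exact: measurable_indic.
Qed.

Let ilne : mu.-integrable D (fun s => lne (a s)%:E).
Proof. by apply/integrableP; split => //; case: la. Qed.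

Let zero_null : mu zero = 0%E.
Proof.
have [N [mN N0 hN]] := integrable_ae mD ilne.
apply: (subset_measure0 _ mN _ N0) => //.
move=> s sz; apply: hN => /= h; have [Ds _] := sz.
have := h Ds; rewrite /lne -zeroE// mem_set//.
Qed.

Lemma modification_ln_integrable : U.-integrable setT (EFin \o (fun s => ln (b s))).
Proof.
have mln : measurable_fun setT (fun s => ln (b s)).
  exact: (measurableT_comp (@measurable_ln R) measurable_modification).
apply/integrableP; split; first exact/measurable_EFinP.
rewrite unif_integral_ge0//; last by apply: measurableT_comp => //; exact/measurable_EFinP.
apply: le_lt_trans (_ : (\int[mu]_(s in D) `|lne (a s)%:E| < +oo)%E); last by case: la.
apply: ge0_le_integral => //.
- by apply: measurable_funTS; apply: measurableT_comp => //; exact/measurable_EFinP.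
- exact: measurableT_comp.
- move=> s Ds; rewrite (lneE Ds) indicE; case: (s \in zero); first by rewrite mule1/= ?leey.
  by rewrite mule0 adde0.
Qed.

Let ae_mod : {ae mu, forall s, D s -> b s = a s}.
Proof.
exists zero; split => // s /= /not_implyP[Ds ne].
apply: contrapT => nz; apply: ne; rewrite /modification.
have [as0|as0] := ltP 0 (a s); first by rewrite andbT -/(is_true _) (_ : 0 <= s <= 1) //; rewrite -DE.
by exfalso; apply: nz; apply/set_mem; rewrite zeroE.
Qed.

Lemma modification_ln_integral :
  (\int[mu]_(s in D) lne (a s)%:E = (\int[U]_s ln (b s))%:E)%E.
Proof.
rewrite EFin_Rintegral; last exact: modification_ln_integrable.
have mln : measurable_fun setT (EFin \o (fun s => ln (b s))).
  by apply/measurable_EFinP; exact: (measurableT_comp (@measurable_ln R) measurable_modification).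
rewrite unif_integral//; apply: ae_eq_integral => //; first exact: measurable_funTS.
exists zero; split => // s /not_implyP[Ds ne]; apply: contrapT => nz; apply: ne.
by rewrite (lneE Ds) indicE memNset// mule0 adde0.
Qed.

Lemma modification_laplace q : 0 <= q ->
  laplace_inv a q = laplace U (reciprocal b) q.
Proof.
move=> q0; rewrite /laplace_inv /laplace /Rintegral; congr fine.
have mr := measurable_reciprocal measurable_modification modification_gt0.
rewrite unif_integral; last first.
  apply/measurable_EFinP; by apply: measurable_exp_scaled.
have mexp : measurable_fun setT (fun s => expR (- (q * reciprocal b s))).
  by apply: measurable_exp_scaled.
apply: ae_eq_integral => //.
- apply: (eq_measurable_fun (fun s => (expR (- (q * reciprocal b s)) * (1 - \1_zero s) + \1_zero s)%:E)).
    move=> s /set_mem Ds; have s01 : 0 <= s <= 1 by move: Ds; rewrite DE.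
    rewrite indicE zeroE// /reciprocal /modification s01 leNgt.
    have [as0|as0] := ltP 0 (a s); rewrite /= ?subr0 ?mulr1 ?addr0//.
    rewrite (_ : a s = 0) ?invr0 ?mulr0 ?oppr0 ?expR0 ?subrr ?mulr0 ?add0r//.
    by apply/le_anti; rewrite as0; case: la => + _ _; apply.
  apply/measurable_EFinP; apply: measurable_funTS; apply: measurable_funD; last exact: measurable_indic.
  apply: measurable_funM => //; apply: measurable_funB; first exact: measurable_cst.
  exact: measurable_indic.
- by apply/measurable_EFinP; exact: measurable_funTS.
- have [N [mN N0 hN]] := ae_mod; exists N; split => // s /= h; apply: hN => /= e; apply: h => Ds.
  by rewrite /reciprocal e.
Qed.

Lemma modification_sample d (Om : measurableType d) (P : probability Om R)
    (X : nat -> {RV P >-> R}) :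
  (forall i (B : set R), measurable B -> distribution P (X i) B = uniform_prob (@ltr01 R) B) ->
  {ae P, forall w, forall i, b (X i w) = a (X i w)}.
Proof.
move=> XU; pose N := zero `|` ~` D.
have mN : measurable N by apply: measurableU => //; exact: measurableC.
have UN : U N = 0%E.
  rewrite unif_measure// setIUl setICl setU0; apply: (subset_measure0 _ mzero _ zero_null).
    exact: measurableI.
  by move=> s [].
have XN i : P (X i @^-1` N) = 0%E by have := XU i N mN; rewrite -[RHS]/(U N) UN.
apply/ae_foralln => i; exists (X i @^-1` N); split => //.
- by rewrite -[X in measurable X]setTI; exact: measurable_funP.
- exact: XN.
move=> w /= ne.
apply: contrapT => /not_orP[nz /contrapT Dx]; apply: ne.
rewrite /modification; have [as0|as0] := ltP 0 (a (X i w)).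
  by rewrite andbT; move: Dx; rewrite DE => ->.
by exfalso; apply: nz; apply/set_mem; rewrite zeroE.
Qed.

End positive_modification.

(** * Quasi-invariance *)

Section density_positive.
Context {R : realType} (theta : R) (PD : probability (simplex R) R) (lam : probability R R).
Hypothesis theta_gt0 : 0 < theta.
Hypothesis lamP : laplace_identity theta PD lam.
Local Notation U := (@unif R).
Local Notation mu := (@lebesgue_measure R).
Variable b : R -> R.
Hypotheses (mb : measurable_fun setT (b : measurableTypeR R -> R)) (b0 : forall s, 0 < b s).
Hypothesis ib : U.-integrable setT (EFin \o (fun s => ln (b s))).
Local Notation r := (reciprocal b).
Let r0 : forall s, 0 < r s := reciprocal_gt0 b0.
Let r0' s : 0 <= r s. Proof. exact: ltW. Qed.
Let mr : measurable_fun setT r := measurable_reciprocal mb b0.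

Lemma symmetric_laplace_noninc (y : simplex R) (u v : R) : u <= v ->
  symmetric_laplace U r (y, v) <= symmetric_laplace U r (y, u).
Proof.
move=> uv; apply: iprod_mono => [| |i]; [exact: symmetric_laplace_seq|exact: symmetric_laplace_seq|].
apply: laplace_noninc => //; first exact: (simplex_scale_ge0 (y, u)).
by rewrite ler_wpM2r ?coords_ge0// ler_expR.
Qed.

(** The integrand decreases with the mass, so it is positive on a whole interval
    of masses as soon as it is positive at one mass. *)
Lemma gamma_mixture_gt0 (y : simplex R) (v : R) : 0 < symmetric_laplace U r (y, v) ->
  (0 < gamma_mixture theta U r y)%E.
Proof.
move=> h; rewrite lt_neqAle eq_sym gamma_mixture_inv_ge0// andbT; apply/eqP => e0.
pose F (t : measurableTypeR R) : \bar R := (t `^ (theta - 1) / Gamma theta * symmetric_laplace U r (y, ln t))%:E.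
have F0 t : (0 <= F t)%E.
  rewrite lee_fin; apply: mulr_ge0.
    by apply: divr_ge0; [exact: powR_ge0|exact: ltW (Gamma_gt0 theta_gt0)].
  by have /andP[] := symmetric_laplace_unit U (y, ln t) mr r0'.
have mF : measurable_fun setT F.
  apply/measurable_EFinP; apply: measurable_funM.
    by apply: measurable_funM; [exact: measurable_powR|exact: measurable_cst].
  exact: (measurableT_comp (measurable_symmetric_ln U mr r0') (pair1_measurable y)).
have := @ae_eq_integral_abs _ _ _ mu `]0%R, +oo[%classic (measurable_itv _) F (measurable_funTS mF).
under eq_integral do rewrite gee0_abs//.
case=> /(_ e0)[N [mN N0 hN]] _.
have : (mu `]0%R, expR v[%classic <= 0)%E.
  rewrite -N0; apply: le_measure; rewrite ?inE//.
  move=> t /=; rewrite in_itv/= => /andP[t0 tv]; apply: hN => /= ne.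
  have Ft0 : F t = 0%E by apply: ne; rewrite in_itv/= t0.
  have : (0 < F t)%E.
    rewrite lte_fin; apply: mulr_gt0.
      by apply: divr_gt0; [exact: powR_gt0|exact: Gamma_gt0].
    apply: lt_le_trans h _; apply: symmetric_laplace_noninc.
    by rewrite -(expRK v) ler_ln ?posrE ?expR_gt0// ltW.
  by rewrite Ft0 ltxx.
by rewrite lebesgue_measure_itv/= lte_fin expR_gt0 sube0 lee_fin leNgt expR_gt0.
Qed.

(** Dividing 1 / b by n amounts to shifting the logarithm of the mass, and for n
    large the symmetric product of 1 / (n b) is positive by
    [symmetric_laplace_small]. *)
Lemma transform_density_gt0 : {ae PD, forall y, (0 < transform_density theta b y)%E}.
Proof.
have ir : U.-integrable setT (EFin \o (fun s => ln (r s))).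
  rewrite (_ : EFin \o _ = \- (EFin \o (fun s => ln (b s))))%E; first exact: integrableN.
  by apply/funext => s /=; rewrite lnV ?posrE.
have ir1 : U.-integrable setT (EFin \o (fun s => ln (1 + r s))).
  have := onepM_ln_integrable mr ler01 r0 ir; congr (integrable _ _ _).
  by apply/funext => s; rewrite /= mul1r.
pose h n p := symmetric_laplace U (fun s => n.+1%:R^-1 * r s) p.
have n0 n : 0 < n.+1%:R^-1 :> R by rewrite invr_gt0.
have mrn n : measurable_fun setT (fun s => n.+1%:R^-1 * r s).
  by apply: measurable_funM => //; exact: measurable_cst.
have rn0 n s : 0 <= n.+1%:R^-1 * r s by rewrite mulr_ge0// ltW.
have mh n : measurable_fun setT (h n) by exact: measurable_symmetric_laplace.
have h01 n p : 0 <= h n p <= 1 by exact: symmetric_laplace_unit.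
have [M [mM M0 NM]] := ae_exists_gt0 (P := (PD \x lam)%E) mh h01
  (symmetric_laplace_small lamP mr r0' ir1).
pose N := gamma_mixture theta U r @^-1` [set 0%E].
have mN : measurable N.
  by rewrite -[N]setTI; apply: (measurable_gamma_mixture_inv theta_gt0 mb b0).
exists N; split => //.
  have NTM : N `*` setT `<=` M.
    move=> [y u] [/= Ny _]; apply: NM => /= -[n hn].
    have : (0 < gamma_mixture theta U r y)%E.
      apply: (@gamma_mixture_gt0 y (u + ln n.+1%:R^-1)).
      by rewrite symmetric_laplace_shift.
    by rewrite Ny ltxx.
  have : (PD \x lam)%E (N `*` setT) = 0%E.
    by apply: (subset_measure0 _ mM) => //; exact: measurableX.
  by move=> e0; rewrite -[LHS]mule1 -(probability_setT lam); rewrite product_measure1E in e0.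
move=> y /= ny; apply: contrapT => yN; apply: ny.
rewrite /transform_density mule_gt0 ?lte_fin ?expR_gt0//.
rewrite lt_neqAle gamma_mixture_inv_ge0// andbT eq_sym; apply/eqP; exact: yN.
Qed.

End density_positive.

Section quasi_invariance.
Context {R : realType} (theta : R) (PD : probability (simplex R) R) (lam : probability R R).
Hypothesis theta_gt0 : 0 < theta.
Hypothesis lamP : laplace_identity theta PD lam.
Context d (Om : measurableType d) (P : probability Om R)
  (Y : {RV P >-> simplex R}) (X : nat -> {RV P >-> R}).
Hypothesis YX : markov_input PD Y X.
Local Notation U := (@unif R).
Local Notation mu := (@lebesgue_measure R).

Lemma Sa_density_modification a (y : simplex R) : logintegrable a ->
  Sa_density theta a y = transform_density theta (modification a) y.
Proof.
move=> la.
have e1 : expeR (- (theta%:E * \int[mu]_(s in unit_itv R) lne (a s)%:E)) =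
    (expR (- (theta * \int[U]_s ln (modification a s))))%:E.
  by rewrite (modification_ln_integral la).
rewrite /Sa_density e1 /transform_density; apply: (f_equal (mule _)).
rewrite /gamma_mixture; apply: eq_integral => t; rewrite inE/= in_itv/= andbT => t0.
apply: (congr1 EFin); apply: (f_equal (fun q : R => t `^ (theta - 1) / Gamma theta * q)); rewrite /symmetric_laplace /iprod.
apply: (f_equal (fun g : nat -> R => limn g)); apply/funext => n; apply: eq_bigr => i _.
rewrite (modification_laplace la) /=; last by rewrite mulr_ge0 ?coords_ge0// ltW.
by apply: (f_equal (fun q : R => laplace U (reciprocal (modification a)) (q * y i))); rewrite lnK.
Qed.

Lemma is_Sa_modification a (x : nat -> R) (y v : simplex R) :
  (forall i, modification a (x i) = a (x i)) ->
  is_Sa (modification a) x y v -> is_Sa a x y v.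
Proof.
move=> e [sigma e1 [s bs hs]]; exists sigma.
  by rewrite -e1; apply: eq_eseriesr => i _; rewrite e.
by exists s => // i; rewrite hs e.
Qed.

Section law.
Variable b : R -> R.
Hypotheses (mb : measurable_fun setT (b : measurableTypeR R -> R)) (b0 : forall s, 0 < b s).
Hypothesis ib : U.-integrable setT (EFin \o (fun s => ln (b s))).

Lemma transform_law_set (A : set (simplex R)) : measurable A ->
  (P (transform Y X b @^-1` A) = \int[PD]_(y in A) transform_density theta b y)%E.
Proof.
move=> mA; have mS := measurable_transform Y X mb b0.
have := transform_law theta_gt0 lamP YX mb b0 ib (measurable_indic mA).
have -> : (\int[P]_w (\1_A (transform Y X b w))%:E = P (transform Y X b @^-1` A))%E.
  rewrite -(setIT (_ @^-1` _)) -integral_indic//.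
  by rewrite -[X in measurable X]setTI; exact: mS.
move=> ->; last by move=> y; rewrite indicE; case: (_ \in _); rewrite !lexx ?ler01.
rewrite [RHS]integral_mkcond; apply: eq_integral => y _.
by rewrite /patch indicE; case: (y \in A); rewrite ?mul1e ?mul0e.
Qed.

End law.

Lemma quasi_invariance a : logintegrable a ->
  exists SaY : {RV P >-> simplex R},
      [/\ {ae P, forall w, is_Sa a (fun i => X i w) (Y w) (SaY w)},
          distribution P SaY `<< PD,
          PD `<< distribution P SaY &
          ae_eq PD setT
            ('d (charge_of_finite_measure (distribution P SaY)) '/d PD)
            (Sa_density theta a) ].
Proof.
move=> la; pose b := modification a.
have b0 : forall s, 0 < b s := modification_gt0 a.
have mb := measurable_modification la.
have ib := modification_ln_integrable la.
have mS : measurable_fun setT (transform Y X b) := measurable_transform Y X mb b0.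
pose SaY : {RV P >-> simplex R} := mfun_Sub (mem_set mS).
have law A : measurable A ->
    (distribution P SaY A = \int[PD]_(y in A) transform_density theta b y)%E.
  by move=> mA; exact: transform_law_set.
have mD : measurable_fun setT (transform_density theta b) := measurable_transform_density theta_gt0 mb b0.
have D0 y : (0 <= transform_density theta b y)%E := transform_density_ge0 theta_gt0 mb b0 y.
have dom : distribution P SaY `<< PD.
  apply/null_content_dominatesP => A mA A0; rewrite law//.
  transitivity (\int[PD]_(y in A) (cst 0%E y))%E; last by rewrite integral0.
  apply: ge0_ae_eq_integral => //; first exact: measurable_funTS.
  by exists A; split => // y /= /not_implyP[].
exists SaY; split => //.
- have := total_finite lamP YX mb b0 (ln1_integrable mb b0 ib).
  have XU : forall i (B : set R), measurable B -> distribution P (X i) B = uniform_prob (@ltr01 R) B.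
    by case: YX.
  move: (modification_sample la XU); apply: filterS2 => w e tw.
  by apply: is_Sa_modification => //; exact: (transform_Sa b0 tw).
- apply/null_content_dominatesP => A mA dA0.
  have A0 := etrans (esym (law A mA)) dA0.
  have := @ae_eq_integral_abs _ _ _ PD A mA _ (measurable_funTS mD).
  under eq_integral do rewrite gee0_abs//.
  case=> /(_ A0) null _.
  have [N [mN N0 hN]] : {ae PD, forall y, ~ A y}.
    move: null (transform_density_gt0 theta_gt0 lamP mb b0 ib).
    by apply: filterS2 => y Ay0 Dy Ay; rewrite Ay0// ltxx in Dy.
  by apply: (subset_measure0 mA mN _ N0) => y Ay; apply: hN => /= nA; exact: nA.
- rewrite (_ : Sa_density theta a = transform_density theta b); last first.
    by apply/funext => y; exact: Sa_density_modification.
  apply: integral_ae_eq => //.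
  + exact: Radon_Nikodym_integrable.
  + move=> A _ mA; rewrite -Radon_Nikodym_integral//; exact: law.
Qed.

End quasi_invariance.

(** * Ergodicity *)

Section ergodicity.
Context {R : realType} (theta : R) (PD : probability (simplex R) R) (lam : probability R R).
Hypothesis theta_gt0 : 0 < theta.
Hypothesis lamP : laplace_identity theta PD lam.
Context d (Om : measurableType d) (P : probability Om R)
  (Y : {RV P >-> simplex R}) (X : nat -> {RV P >-> R}).
Hypothesis YX : markov_input PD Y X.
Local Notation U := (@unif R).
Local Notation mu := (@lebesgue_measure R).

Section one_step.
Variables (n : nat) (x : nat -> R).
Hypothesis x0 : forall k, 0 <= x k.
Local Notation g := (grid_step n x).

(** The summand 1 restores the factor e^(- t) in the density, which becomes an
    average over the law of the total mass. *)
Definition step_contraction (s : measurableTypeR R) : R := reciprocal (fun s => 1 + g s) s.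
Local Notation a := step_contraction.

Let g1_gt0 s : 0 < 1 + g s. Proof. by rewrite ltr_pwDl// grid_step_ge0. Qed.
Let mg : measurable_fun setT (g : measurableTypeR R -> R). Proof. exact: measurable_grid_step. Qed.
Let mg1 : measurable_fun setT ((fun s => 1 + g s) : measurableTypeR R -> R).
Proof. by apply: measurable_funD => //; exact: measurable_cst. Qed.

Let ma : measurable_fun setT (a : measurableTypeR R -> R) := measurable_reciprocal mg1 g1_gt0.
Let a_gt0 s : 0 < a s. Proof. exact: (reciprocal_gt0 g1_gt0). Qed.

Let ln_a s : ln (a s) = - ln (1 + g s).
Proof. by rewrite lnV ?posrE. Qed.

Let ln_bound : exists M : R, forall s, `|ln (a s)| <= M.
Proof.
have [M gM] := grid_step_bounded n x0; exists (ln (1 + M)) => s.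
have /andP[g0 gm] := gM s.
by rewrite ln_a normrN ger0_norm ?ln_ge0 ?lerDl//; apply: ln_mono => //; rewrite lerD2l.
Qed.

Let mln : measurable_fun setT (fun s : measurableTypeR R => ln (a s)).
Proof. exact: (measurableT_comp (@measurable_ln R) ma). Qed.

Let ia : U.-integrable setT (EFin \o (fun s => ln (a s))).
Proof. by have [M aM] := ln_bound; exact: (bounded_integrable U mln aM). Qed.

Let log_a : logintegrable a.
Proof.
split.
- by move=> s _; exact: ltW.
- exact: measurable_funTS.
- have /integrableP[_] := ia; rewrite unif_integral_ge0//; last first.
    by apply: measurableT_comp => //; exact/measurable_EFinP.
  rewrite [X in (X < _)%E -> _](eq_integral (fun s => `|lne (a s)%:E|)%E)//.
  by move=> s _; rewrite lne_EFin.
Qed.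

Let recip_a : reciprocal a = (fun s => g s + 1).
Proof. by apply/funext => s; rewrite /a /reciprocal invrK addrC. Qed.

Let c := expR (- (theta * \int[U]_s ln (a s))).

Let density_a (y : simplex R) : transform_density theta a y =
  (c%:E * \int[lam]_u (symmetric_product n x (y, u))%:E)%E.
Proof.
rewrite /transform_density recip_a; apply: (f_equal (mule _)); apply: esym.
have msp : measurable_fun setT (symmetric_product n x).
  by apply: symmetric_product_measurable; exists n, x.
have sp0 p : 0 <= symmetric_product n x p by have /andP[] := symmetric_product_unit n p x0.
have mh : measurable_fun setT (fun u : R => symmetric_product n x (y, u)).
  exact: (measurableT_comp msp (pair1_measurable y)).
apply: (etrans (log_gamma_integral theta_gt0 (lam_laplace lamP) mh (fun u => symmetric_product_unit n (y, u) x0))).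
rewrite /gamma_mixture; apply: eq_integral => t; rewrite inE/= in_itv/= andbT => t0.
apply: (congr1 EFin).
rewrite (symmetric_laplaceD_cst U (y, ln t) mg)//; last by move=> s; exact: grid_step_ge0.
rewrite symmetric_product_laplace// /gamma_weight /= lnK ?posrE// mul1r.
move: (symmetric_laplace _ _ _) => q; ring.
Qed.

(** Averaging phi at the transformed point brings in the density of its law,
    which is c times the expectation of the symmetric product over the mass. *)
Lemma invariant_average (phi : simplex R -> R) : measurable_fun setT phi ->
  (forall y, 0 <= phi y <= 1) ->
  {ae P, forall w, forall z, is_Sa a (fun i => X i w) (Y w) z -> phi z = phi (Y w)} ->
  \int[PD]_y phi y = c * \int[(PD \x lam)%E]_p (phi p.1 * symmetric_product n x p).
Proof.
move=> mphi phi01 inv.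
have phi0 y : 0 <= phi y by have /andP[] := phi01 y.
have mphi1 : measurable_fun setT (fun p : simplex R * R => phi p.1).
  exact: measurableT_comp mphi measurable_fst.
have msp : measurable_fun setT (symmetric_product n x).
  by apply: symmetric_product_measurable; exists n, x.
have sp01 p := symmetric_product_unit n p x0.
have sp0 p : 0 <= symmetric_product n x p by have /andP[] := sp01 p.
have mphisp : measurable_fun setT (fun p : simplex R * R => phi p.1 * symmetric_product n x p).
  exact: measurable_funM.
apply: EFin_inj; rewrite EFinM !EFin_Rintegral; last 2 first.
- apply: unit_integrable => // p; have /andP[? ?] := phi01 p.1; have /andP[? ?] := sp01 p.
  by rewrite mulr_ge0// mulr_ile1.
- exact: unit_integrable.
have mS := measurable_transform Y X ma a_gt0.
have mY : measurable_fun setT Y by exact: measurable_funP.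
transitivity (\int[P]_w (phi (transform Y X a w))%:E)%E.
  transitivity (\int[distribution P Y]_y (phi y)%:E)%E.
    by apply: eq_measure_integral => A mA _; case: YX => h _ _; exact/esym/h.
  rewrite ge0_integral_distribution//=; last exact/measurable_EFinP.
  apply: ge0_ae_eq_integral => //.
  - by apply/measurable_EFinP; exact: measurableT_comp mphi mY.
  - by apply/measurable_EFinP; exact: measurableT_comp mphi mS.
  - by move=> w _; rewrite lee_fin.
  - by move=> w _; rewrite lee_fin.
  move: inv (total_finite lamP YX ma a_gt0 (ln1_integrable ma a_gt0 ia)).
  apply: filterS2 => w h tw _ /=; apply: (congr1 EFin); apply/esym/h.
  exact: (transform_Sa a_gt0 tw).
rewrite (transform_law theta_gt0 lamP YX ma a_gt0 ia mphi phi01).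
rewrite (fubini_tonelli1 (fun p => (phi p.1 * symmetric_product n x p)%:E)); last 2 first.
- exact/measurable_EFinP.
- by move=> p; rewrite lee_fin mulr_ge0.
have I0 y : (0 <= \int[lam]_u (symmetric_product n x (y, u))%:E)%E.
  by apply: integral_ge0 => u _; rewrite lee_fin.
rewrite -ge0_integralZl_EFin ?expR_ge0//; last 2 first.
- by move=> y _; apply: integral_ge0 => u _; rewrite lee_fin mulr_ge0.
- apply: (@measurable_fun_fubini_tonelli_F _ _ _ _ R lam (fun p => (phi p.1 * symmetric_product n x p)%:E)).
    exact/measurable_EFinP.
  by move=> p; rewrite lee_fin mulr_ge0.
apply: eq_integral => y _; rewrite density_a muleCA; apply: (f_equal (mule _)).
rewrite /fubini_F/= -ge0_integralZl_EFin//.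
  by move=> u _; rewrite lee_fin.
by apply/measurable_EFinP; exact: (measurableT_comp msp (pair1_measurable y)).
Qed.

(** The case of a constant function determines c. *)
Lemma invariant_uncorrelated (phi : simplex R -> R) : measurable_fun setT phi ->
  (forall y, 0 <= phi y <= 1) ->
  (forall a, logintegrable a ->
    {ae P, forall w, forall z, is_Sa a (fun i => X i w) (Y w) z -> phi z = phi (Y w)}) ->
  \int[(PD \x lam)%E]_p (phi p.1 * symmetric_product n x p) =
  \int[(PD \x lam)%E]_p ((\int[PD]_y phi y) * symmetric_product n x p).
Proof.
move=> mphi phi01 inv; have e1 := invariant_average mphi phi01 (inv _ log_a).
have e2 : 1 = c * \int[(PD \x lam)%E]_p (symmetric_product n x p).
  rewrite -[LHS](probability_Rintegral_cst PD) (@invariant_average (fun=> 1)).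
  - by congr (_ * _); apply: eq_Rintegral => p _; rewrite mul1r.
  - exact: measurable_cst.
  - by move=> y; rewrite ler01 lexx.
  - exact: aeW.
have msp : measurable_fun setT (symmetric_product n x).
  by apply: symmetric_product_measurable; exists n, x.
rewrite RintegralZl//; last first.
  by apply: unit_integrable => // p; exact: symmetric_product_unit.
have c0 : c != 0 by rewrite gt_eqF// expR_gt0.
by apply: (mulfI c0); rewrite -e1 mulrCA -e2 mulr1.
Qed.

End one_step.

Lemma ergodicity : Sa_ergodic PD Y X.
Proof.
move=> G mG inv.
(* An injective bounded function of G. *)
pose phi y := expR (- expR (G y)).
have mphi : measurable_fun setT phi.
  apply: measurableT_comp => //; apply: measurable_funN; exact: measurableT_comp.
have phi01 y : 0 <= phi y <= 1 by rewrite expR_ge0/= -expR0 ler_expR oppr_le0 expR_ge0.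
have phi_inv a : logintegrable a ->
    {ae P, forall w, forall z, is_Sa a (fun i => X i w) (Y w) z -> phi z = phi (Y w)}.
  by move=> la; move: (inv a la); apply: filterS => w h z /h; rewrite /phi => ->.
pose m := \int[PD]_y phi y.
have iphi : PD.-integrable setT (EFin \o phi) by exact: unit_integrable.
suff [N [mN N0 hN]] : ae_eq PD setT (EFin \o phi) (EFin \o cst m).
  exists (ln (- ln m)); exists N; split => // y /= ne; apply: hN => /= h; apply: ne.
  have [<-] := h I.
  by rewrite /phi expRK opprK expRK.
have mphi1 : measurable_fun setT (fun p : simplex R * R => phi p.1).
  exact: measurableT_comp mphi measurable_fst.
have iw1 : (PD \x lam)%E.-integrable setT (EFin \o (fun p : simplex R * R => phi p.1)).
  exact: integrable_fst.
have im : (PD \x lam)%E.-integrable setT (EFin \o (fun _ : simplex R * R => m)).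
  by apply: (@bounded_integrable _ _ _ _ _ `|m|).
have prods h : symmetric_products h ->
    \int[(PD \x lam)%E]_p (phi p.1 * h p) = \int[(PD \x lam)%E]_p (m * h p).
  by move=> [n [x [x0 ->]]]; exact: invariant_uncorrelated.
apply: integral_ae_eq => //; first exact/measurable_EFinP/measurable_cst.
move=> E _ mE.
have clos : bclosure symmetric_products (fun p : simplex R * R => \1_E p.1).
  apply: bclosure_unit_measurable.
  - by move=> A mA; exact: symmetric_products_determine.
  - exact: symmetric_products1.
  - exact: measurableT_comp (measurable_indic mE) measurable_fst.
  - by move=> p; rewrite indicE; case: (_ \in _); rewrite !lexx ?ler01.
have e := @bclosure_integral_eq _ _ _ _ (@symmetric_product_measurable R) (@symmetric_products_bounded R)
  _ _ (PD \x lam)%E _ _ (PD \x lam)%E id id (fun p => phi p.1) (fun=> m)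
  (@measurable_id _ _ _) (@measurable_id _ _ _) iw1 im prods _ clos.
have bE y : `|\1_E y| <= 1 :> R by rewrite ger0_norm// indicE; case: (_ \in _).
have i1 : PD.-integrable setT (EFin \o (fun y => phi y * \1_E y)).
  exact: (weighted_integrable iphi (measurable_indic mE) bE).
have i2 : PD.-integrable setT (EFin \o (fun y => m * \1_E y)).
  apply: (weighted_integrable _ (measurable_indic mE) bE).
  by apply: (@bounded_integrable _ _ _ _ _ `|m|).
have {}e : \int[PD]_y (phi y * \1_E y) = \int[PD]_y (m * \1_E y).
  by rewrite -(Rintegral_fst lam i1) -(Rintegral_fst lam i2).
have restr (f : simplex R -> R) :
    (\int[PD]_(y in E) (f y)%:E = \int[PD]_y (f y * \1_E y)%:E)%E.
  rewrite integral_mkcond; apply: eq_integral => y _.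
  by rewrite /patch indicE; case: (y \in E); rewrite ?mulr1 ?mulr0.
by rewrite !restr -!EFin_Rintegral// e.
Qed.

End ergodicity.

Theorem theorem5 (R : realType) (theta : R) (theta_gt0 : 0 < theta)
    (PD : probability (simplex R) R) (PD_theta : poisson_dirichlet theta PD)
    (d : measure_display) (Om : measurableType d) (P : probability Om R)
    (Y : {RV P >-> simplex R}) (X : nat -> {RV P >-> R})
    (YX : markov_input PD Y X) :
  (forall a : R -> R, logintegrable a ->
    exists SaY : {RV P >-> simplex R},
      [/\ {ae P, forall w, is_Sa a (fun i => X i w) (Y w) (SaY w)},
          distribution P SaY `<< PD,
          PD `<< distribution P SaY &
          ae_eq PD setT
            ('d (charge_of_finite_measure (distribution P SaY)) '/d PD)
            (Sa_density theta a) ]) /\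
  Sa_ergodic PD Y X.
Proof.
have [lam lamP] := poisson_dirichlet_split theta_gt0 PD_theta.
split; first by move=> a la; exact: (quasi_invariance theta_gt0 lamP YX la).
exact: (ergodicity theta_gt0 lamP YX).
Qed.
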